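(* Let $\{p(x,y)\}_{x,y}$ be a symmetric transition kernel on $\mathbb{Z}^d$ and let $\lambda>0$. Let $O_n$ be the inverted orbit of the origin along integer times for the random stirring process with kernel $\lambda p(\cdot,\cdot)$. Then for any integer $n\ge0$, $$\mathbb{E}\Big[\big(\tfrac12\big)^{|O_n|}\Big]\le e^{-\frac{n+1}{2}\,\mathbb{P}^{\,0}_{\lambda p}[T=\infty]}.$$ More generally, for any $q\in[0,1]$ and any conductance profile $\{c(x,y)\}_{x,y}$ on $\mathbb{Z}^d$, if $O_n$ denotes the inverted orbit of the origin along integer times for the random stirring process with rates $c(\cdot,\cdot)$, then for all integers $n\ge0$, $$\mathbb{E}\big[(1-q)^{|O_n|}\big]\le e^{-q(n+1)\,\mathbb{P}^{\,0}_{c}[T=\infty]}.$$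
   Context: A symmetric transition kernel on $\mathbb{Z}^d$ is $p:\mathbb{Z}^d\times\mathbb{Z}^d\to[0,\infty)$ with $p(x,y)=p(y,x)$ and $\sum_yp(x,y)=1$ for all $x$. A conductance profile on $\mathbb{Z}^d$ is a symmetric function $c:\mathbb{Z}^d\times\mathbb{Z}^d\to[0,\infty)$ with $c(x):=\sum_yc(x,y)\in(0,\infty)$ for all $x$ and $\sup_xc(x)<\infty$. The random stirring process with rates $c(\cdot,\cdot)$ (respectively with kernel $\lambda p$, i.e. $c=\lambda p$) is the Markov process $(\tau_t)_{t\ge0}$ with values in the group $\mathfrak{S}(\mathbb{Z}^d)$ of permutations of $\mathbb{Z}^d$, with $\tau_0=\mathrm{Id}$, constructed as follows: independently for each pair $\{x,y\}$, take a Poisson point process of rate $c(x,y)$ on $\mathbb{R}_+$, and at each of its points $t$ set $\tau_t=T_{xy}\circ\tau_{t-}$, where $T_{xy}$ is the transposition of $x$ and $y$ (this is well defined since $\sup_xc(x)<\infty$). The inverted orbit of the origin along integer times is $O_n=\bigcup_{0\le k\le n}\tau_k^{-1}(\{0\})$, the union being over integers $k$. $\mathbb{P}^{\,0}_c[T=\infty]$ is defined as follows: let $(\bar X_t)_{t\ge0}$ be the continuous-time random walk on $\mathbb{Z}^d$ started at $0$ which, when at $x$, jumps at rate $c(x)$ according to the kernel $c(x,y)/c(x)$; let $X_n=\bar X_n$ for $n\in\mathbb{N}$ and $T=\inf\{n\ge1:X_n=0\}$. Then $\mathbb{P}^{\,0}_c[T=\infty]$ is the probability that $T=\infty$. For $c=\lambda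 p$ this is denoted $\mathbb{P}^{\,0}_{\lambda p}[T=\infty]$, and $(X_n)$ has transition kernel $e^{\lambda(p-\mathrm{Id})}$. *)

(* Defs.v *)
From HB Require Import structures.
From mathcomp Require Import all_boot all_order all_algebra finmap.
From mathcomp Require Import all_classical all_reals all_analysis.

Set Implicit Arguments.
Unset Strict Implicit.
Unset Printing Implicit Defensive.

Import Order.TTheory GRing.Theory Num.Theory.
Import numFieldNormedType.Exports.

Local Open Scope classical_set_scope.
Local Open Scope card_scope.
Local Open Scope ring_scope.

Notation "'Z^' d" := 'rV[int]_d (at level 8, d at level 2, format "'Z^' d").

Section Rates.
Context {R : realType} {d : nat}.
Implicit Types p c : Z^d -> Z^d -> R.

Definition symmetric_kernel p : Prop :=
  [/\ forall x y, 0 <= p x y,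
      forall x y, p x y = p y x &
      forall x, (\esum_(y in [set: Z^d]) (p x y)%:E = 1)%E].

Definition total_rate_ereal c (x : Z^d) : \bar R :=
  (\esum_(y in [set: Z^d]) (c x y)%:E)%E.

Definition conductance_profile c : Prop :=
  [/\ forall x y, 0 <= c x y,
      forall x y, c x y = c y x,
      forall x, (0 < total_rate_ereal c x < +oo)%E &
      (ereal_sup (range (total_rate_ereal c)) < +oo)%E].

Definition total_rate c (x : Z^d) : R := fine (total_rate_ereal c x).

End Rates.

Section Poisson.
Context {R : realType} {disp : measure_display} {Omega : measurableType disp}.
Variable P : probability Omega R.

(* A random set of points is a map Omega -> set R. *)
Definition count_event (N : Omega -> set R) (B : set R) (k : nat) : set Omega :=
  [set w | (N w `&` B) #= `I_k].

(* The library's poisson_pmf is constantly 1 at rate 0, whereas pairs with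
   c x y = 0 must carry an almost surely empty process; here 0 ^+ 0 = 1 makes
   rate 0 the Dirac mass at 0. *)
Definition poisson_weight (r : R) (k : nat) : R :=
  r ^+ k / k`!%:R * expR (- r).

(* m = 1 is the Poisson law of a single count. *)
Definition poisson_point_process (r : R) (N : Omega -> set R) : Prop :=
  [/\ forall w, N w `<=` [set t | 0 <= t],
      forall B k, measurable B -> measurable (count_event N B k) &
      forall (m : nat) (B : 'I_m -> set R) (k : 'I_m -> nat),
        (forall i, [/\ measurable (B i), B i `<=` [set t | 0 <= t] &
                       (lebesgue_measure (B i) < +oo)%E]) ->
        trivIset [set: 'I_m] B ->
        P (\bigcap_(i in [set: 'I_m]) count_event N (B i) (k i)) =
        (\prod_(i < m)
           poisson_weight (r * fine (lebesgue_measure (B i))) (k i))%:E].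

Definition point_sigma_algebra (N : Omega -> set R) : set (set Omega) :=
  <<s [set A | exists B k, measurable B /\ A = count_event N B k] >>.

Definition mutually_independent (I : choiceType) (D : set I)
    (F : I -> set (set Omega)) : Prop :=
  forall (J : {fset I}) (A : I -> set Omega),
    [set` J] `<=` D -> (forall i, i \in J -> F i (A i)) ->
    P (\bigcap_(i in [set` J]) A i) = (\prod_(i <- J) P (A i))%E.

End Poisson.

Section Stirring.
Context {R : realType} {d : nat}.

Definition transposition (x y z : Z^d) : Z^d :=
  if z == x then y else if z == y then x else z.

(* Unordered pairs of distinct sites: the rings of {x, x} would act by the
   identity. *)
Definition site_pairs : set {fset Z^d} :=
  [set e | exists x y : Z^d, x != y /\ e = [fset x; y]%fset].

(* taum is the left limit tau_{t-}.  Limits are site by site, in the discrete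
   topology of Z^d: infinitely many pairs ring in any time interval. *)
Definition stirring_path (N : {fset Z^d} -> set R) (tau : R -> Z^d -> Z^d) :=
  [/\ tau 0 = id,
      forall t, 0 <= t -> forall z, \forall s \near t^'+, tau s z = tau t z &
      forall t, 0 < t -> exists taum : Z^d -> Z^d,
        [/\ forall z, \forall s \near t^'-, tau s z = taum z,
            forall x y, x != y -> N [fset x; y]%fset t ->
              tau t = transposition x y \o taum &
            (forall e, site_pairs e -> ~ N e t) -> tau t = taum]].

Definition stirring_process {disp} {Omega : measurableType disp}
    (P : probability Omega R) (c : Z^d -> Z^d -> R)
    (tau : R -> Omega -> Z^d -> Z^d) : Prop :=
  [/\ forall t w, 0 <= t -> bijective (tau t w),
      forall t x y, 0 <= t -> measurable [set w | tau t w x = y] &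
      exists N : {fset Z^d} -> Omega -> set R,
        [/\ forall x y, x != y ->
              poisson_point_process P (c x y) (N [fset x; y]%fset),
            mutually_independent P site_pairs
              (fun e => point_sigma_algebra (N e)) &
            {ae P, forall w,
              stirring_path (fun e => N e w) (fun t => tau t w)}]].

Definition inverted_orbit {Omega : Type} (tau : R -> Omega -> Z^d -> Z^d)
    (n : nat) (w : Omega) : set Z^d :=
  \bigcup_(k in `I_n.+1) (tau k%:R w @^-1` [set 0]).

End Stirring.

Section RandomWalk.
Context {R : realType} {d : nat}.
Context {disp : measure_display} {Omega : measurableType disp}.

(* Y is the sequence of visited sites and H the sequence of holding times:
   Y is a Markov chain from 0 with kernel c x y / c x and, given Y, the H i are
   independent exponential variables of rates c (Y i). *)
Definition random_walk (P : probability Omega R) (c : Z^d -> Z^d -> R)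
    (X : R -> Omega -> Z^d) : Prop :=
  (forall t x, 0 <= t -> measurable [set w | X t w = x]) /\
  exists (Y : nat -> Omega -> Z^d) (H : nat -> Omega -> R),
    [/\ forall i x, measurable [set w | Y i w = x],
        forall i, measurable_fun setT (H i),
        forall (k : nat) (y : nat -> Z^d) (s : nat -> R),
          (forall i, 0 <= s i) ->
          P [set w | forall i, (i <= k)%N -> Y i w = y i /\ s i < H i w] =
          ((y 0%N == 0)%:R
           * (\prod_(i < k) (c (y i) (y i.+1) / total_rate c (y i)))
           * \prod_(i < k.+1) expR (- (total_rate c (y i) * s i)))%:E &
        {ae P, forall w, forall t k, 0 <= t ->
           \sum_(i < k) H i w <= t < \sum_(i < k.+1) H i w ->
           X t w = Y k w}].

Definition return_time (X : R -> Omega -> Z^d) (w : Omega) : \bar R :=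
  ereal_inf [set (n%:R)%:E | n in [set n : nat | (1 <= n)%N /\ X n%:R w = 0]].

Definition escape_probability (P : probability Omega R)
    (X : R -> Omega -> Z^d) : R :=
  fine (P [set w | return_time X w = +oo%E]).

End RandomWalk.

(* Main.v *)
Require Import Defs.
From HB Require Import structures.
From mathcomp Require Import all_boot all_order all_algebra finmap.
From mathcomp Require Import all_classical all_reals all_analysis.
From mathcomp Require Import measurable_realfun complex ring lra.

(** Colour every site independently with probability [q]. Then [(1 - q)^|O_n|] is the
    conditional probability, given the stirring process, that no coloured particle sits at the
    origin at the times [0, ..., n]. The configuration of coloured particles has a stable
    generating polynomial (no zero with all variables in the upper half-plane); stability
    survives random transpositions and the tilt [z_0 -> eps z_0], a soft version of
    conditioning on an empty origin, and it implies pairwise negative correlation. Hence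
    conditioning can only raise the density elsewhere, so that the density at the origin at
    time [k] is at least [q P(X_1, ..., X_k <> 0) >= q P(T = oo)]: each inspection of the
    origin contributes a factor at most [1 - q P(T = oo)].

    The stirring process is compared with a finite one: unit time is cut into [m^2] cells, and
    in each cell the pairs of the first [m] sites that ring are transposed one after the
    other. Almost surely the two processes agree on the inverted orbit for large [m]. The
    random walk is discretised on the same grid, by rounding up its holding times. *)

Set Implicit Arguments.
Unset Strict Implicit.
Unset Printing Implicit Defensive.

Import Order.TTheory GRing.Theory Num.Theory.
Import numFieldNormedType.Exports.

Local Open Scope classical_set_scope.
Local Open Scope ring_scope.

(** * Stable polynomials in two variables *)

(** The tilt keeps [eps > 0] because putting [z_0 = 0] can turn a stable polynomial into zero, for
    instance when [q = 1]. A positive rescaling maps the upper half-plane to itself, and [eps]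
    becomes small only in the final estimate.

    Densities are never computed, only bounded below, by a recursion: set the density at the origin
    to 0 at an inspection, then mix. As [c] is symmetric, the same recursion gives the survival
    probability of the walk from the origin that is killed when it sits there at an integer time;
    this is how the escape probability enters.

    All comparisons are one-sided. With step [h = m^-2], replacing a cell by at most one jump costs
    [O(h^2)], so [O(m^-2)] per unit of time, whereas rounding up at most [m] holding times delays
    the walk by at most [m h = 1/m]. With only [m] cells per unit of time this delay could be of
    order 1; hence the square. *)

Section Bivariate.
Variable R : rcfType.
Local Notation C := R[i].
Local Notation Re := (@complex.Re R).
Local Notation Im := (@complex.Im R).
Implicit Types a b c d u w p r : C.

Lemma ReM u w : Re (u * w) = Re u * Re w - Im u * Im w.
Proof. by case: u w => [? ?] [? ?]. Qed.

Lemma ImM u w : Im (u * w) = Re u * Im w + Im u * Re w.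
Proof. by case: u w => [? ?] [? ?]. Qed.

Lemma ReD u w : Re (u + w) = Re u + Re w.
Proof. by case: u w => [? ?] [? ?]. Qed.

Lemma ImD u w : Im (u + w) = Im u + Im w.
Proof. by case: u w => [? ?] [? ?]. Qed.

Lemma ReN u : Re (- u) = - Re u.
Proof. by case: u. Qed.

Lemma ImN u : Im (- u) = - Im u.
Proof. by case: u. Qed.

Lemma ReIm_ext u w : Re u = Re w -> Im u = Im w -> u = w.
Proof. by case: u w => [? ?] [? ?] /= -> ->. Qed.

Lemma Re_real (x : R) : Re (x%:C)%C = x. Proof. by []. Qed.

Lemma Im_real (x : R) : Im (x%:C)%C = 0. Proof. by []. Qed.

Definition ReIm_E := (ReD, ImD, ReN, ImN, ReM, ImM, Re_real, Im_real).

Lemma complex_neq0 u : 0 < Im u -> u != 0.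
Proof. by apply: contraTneq => ->; rewrite ltxx. Qed.

(* z |-> 1 / (z - r) maps the upper half-plane onto
   [{p | Im p - Im r * |p|^2 < 0}], which is convex if [Im r <= 0]. *)
Lemma recip_upperP r p : p != 0 ->
  (0 < Im (r + p^-1)) = (Im p - Im r * (Re p ^+ 2 + Im p ^+ 2) < 0).
Proof.
case: p => a b; rewrite eq_complex /= => p0.
have n0 : 0 < a ^+ 2 + b ^+ 2.
  rewrite lt_neqAle eq_sym paddr_eq0 ?sqr_ge0 // !sqrf_eq0 p0 /=.
  by rewrite addr_ge0 ?sqr_ge0.
case: r => r1 r2 /=.
have -> : r2 - b / (a ^+ 2 + b ^+ 2) =
   - (b - r2 * (a ^+ 2 + b ^+ 2)) / (a ^+ 2 + b ^+ 2).
  by field; rewrite gt_eqF.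
by rewrite pmulr_lgt0 ?invr_gt0 // oppr_gt0.
Qed.

Lemma convex_gt0 (F : realFieldType) (t x y : F) :
  0 <= t <= 1 -> 0 < x -> 0 < y -> 0 < (1 - t) * x + t * y.
Proof.
move=> /andP[t0 t1] x0 y0; have [->|tn0] := eqVneq t 0.
  by rewrite subr0 mul1r mul0r addr0.
apply: ltr_wpDl; first by rewrite mulr_ge0 ?subr_ge0 // ltW.
by rewrite mulr_gt0 // lt0r tn0.
Qed.

(** If [d = 0], symmetrising an affine form amounts to evaluating it at two convex combinations of
    [u] and [w]. If not, shift by a root [r] of the diagonal restriction and pass to reciprocals:
    the form divided by [(u - r) (w - r)] is affine in [1/(u - r)] and [1/(w - r)], and the same
    argument works because the image of the half-plane is convex by [recip_upperP]. *)
Lemma biaffine_symmetrize (t : R) a b c d :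
  0 <= t <= 1 ->
  (forall u w, 0 < Im u -> 0 < Im w -> a + b * u + c * w + d * (u * w) != 0) ->
  forall u w, 0 < Im u -> 0 < Im w ->
    (1 - t)%:C%C * (a + b * u + c * w + d * (u * w)) +
    t%:C%C * (a + b * w + c * u + d * (w * u)) != 0.
Proof.
move=> /andP[t0 t1] H u w u0 w0.
have [d0|d0] := eqVneq d 0.
  pose u' := (1 - t)%:C%C * u + t%:C%C * w.
  pose w' := (1 - t)%:C%C * w + t%:C%C * u.
  have u'0 : 0 < Im u'.
    by rewrite /u' !ReIm_E !mul0r !addr0 convex_gt0 ?t0.
  have w'0 : 0 < Im w'.
    by rewrite /w' !ReIm_E !mul0r !addr0 convex_gt0 ?t0.
  have := H _ _ u'0 w'0; rewrite d0; congr (_ != 0).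
  rewrite /u' /w' rmorphB rmorph1; ring.
(* [p] is the form on the diagonal; [H r r] keeps its root out of the open upper half-plane. *)
pose p := \poly_(i < 3) [:: a; b + c; d]`_i.
have sp : size p = 3 by rewrite size_poly_eq.
have [r] : exists r, root p r.
  by apply/closed_rootP; rewrite sp.
rewrite /root /p horner_poly !big_ord_recl big_ord0 /= /bump /= => /eqP.
rewrite expr0 expr1 mulr1 addr0 => pr.
have r0 : Im r <= 0.
  rewrite leNgt; apply/negP => r0; have /eqP := H r r r0 r0; apply.
  by rewrite -pr; ring.
have ur : u - r != 0 by apply: complex_neq0; rewrite !ReIm_E; nra.
have wr : w - r != 0 by apply: complex_neq0; rewrite !ReIm_E; nra.
have conv : forall x y (s : R), x != 0 -> y != 0 -> 0 <= s <= 1 ->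
   0 < Im (r + x^-1) -> 0 < Im (r + y^-1) ->
   let z := (1 - s)%:C%C * x + s%:C%C * y in z != 0 /\ 0 < Im (r + z^-1).
  move=> x y s x0 y0 /andP[s0 s1]; rewrite !recip_upperP // => hx hy z.
  have hz : Im z - Im r * (Re z ^+ 2 + Im z ^+ 2) < 0.
    rewrite /z !ReIm_E.
    move: (Re x) (Im x) (Re y) (Im y) (Im r) hx hy r0 => x1 x2 y1 y2 r2 hx hy r0.
    have -> : (1 - s) * x2 + 0 * x1 + (s * y2 + 0 * y1) -
      r2 * (((1 - s) * x1 - 0 * x2 + (s * y1 - 0 * y2)) ^+ 2 +
            ((1 - s) * x2 + 0 * x1 + (s * y2 + 0 * y1)) ^+ 2) =
      (1 - s) * (x2 - r2 * (x1 ^+ 2 + x2 ^+ 2)) +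
      s * (y2 - r2 * (y1 ^+ 2 + y2 ^+ 2)) +
      r2 * (s * (1 - s)) * ((x1 - y1) ^+ 2 + (x2 - y2) ^+ 2) by ring.
    have h1 : r2 * (s * (1 - s)) * ((x1 - y1) ^+ 2 + (x2 - y2) ^+ 2) <= 0.
      rewrite mulr_le0_ge0 ?addr_ge0 ?sqr_ge0 //.
      by rewrite mulr_le0_ge0 // mulr_ge0 // subr_ge0.
    have : 0 < (1 - s) * - (x2 - r2 * (x1 ^+ 2 + x2 ^+ 2)) +
               s * - (y2 - r2 * (y1 ^+ 2 + y2 ^+ 2)).
      by rewrite convex_gt0 ?s0 ?oppr_gt0.
    rewrite !mulrN -opprD oppr_gt0 => h2.
    by rewrite -(addr0 0) ltr_leD.
  have z0 : z != 0.
    by apply: contraTneq hz => ->; rewrite /= !expr0n /= addr0 mulr0 subr0 ltxx.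
  by split => //; rewrite recip_upperP.
have hu : 0 < Im (r + (u - r)^-1^-1) by rewrite invrK addrC subrK.
have hw : 0 < Im (r + (w - r)^-1^-1) by rewrite invrK addrC subrK.
have t01 : 0 <= t <= 1 by rewrite t0.
have [] := conv _ _ _ (invr_neq0 ur) (invr_neq0 wr) t01 hu hw.
set x := _ + _ => x0 hx.
have [] := conv _ _ _ (invr_neq0 wr) (invr_neq0 ur) t01 hw hu.
set y := _ + _ => y0 hy.
(* Up to nonzero factors, the form at [(r + 1/x, r + 1/y)] equals the symmetrised sum, so the two
   vanish together. *)
have := H _ _ hx hy; apply: contraNneq => S0.
have := congr1 (fun s => s * ((u - r)^-1 * (w - r)^-1)) S0.
rewrite mul0r => S1.
apply/eqP; apply: (mulIf (mulf_neq0 x0 y0)); rewrite mul0r -S1.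
have -> : (a + b * (r + x^-1) + c * (r + y^-1) +
  d * ((r + x^-1) * (r + y^-1))) * (x * y) =
  (a + (b + c) * r + d * r ^+ 2) * (x * y) +
  (b + d * r) * y + (c + d * r) * x + d.
  by field; rewrite x0 y0.
rewrite /x /y.
set U := _^-1; set W := _^-1.
have -> : u = r + U^-1 by rewrite invrK addrC subrK.
have -> : w = r + W^-1 by rewrite invrK addrC subrK.
rewrite rmorphB rmorph1.
have U0 : U != 0 by rewrite invr_neq0.
have W0 : W != 0 by rewrite invr_neq0.
have -> : a = - ((b + c) * r + d * r ^+ 2) by apply/eqP; rewrite -addr_eq0 -pr; apply/eqP; ring.
by field; rewrite U0 W0.
Qed.

(** The root [- (a + b u) / (c + d u)] in [w] cannot lie in the upper half-plane. For real
    coefficients and [u = i] the conclusion reads [a d <= b c], which is the form of negative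
    correlation. *)
Lemma biaffine_neg_corr a b c d :
  (forall u w, 0 < Im u -> 0 < Im w -> a + b * u + c * w + d * (u * w) != 0) ->
  forall u, 0 < Im u -> 0 <= Im ((a + b * u) * (c + d * u)^*%C).
Proof.
move=> H u u0; set A := a + b * u; set B := c + d * u.
have [->|B0] := eqVneq B 0; first by rewrite conjc0 mulr0.
rewrite leNgt; apply/negP => h.
have n0 : 0 < Re B ^+ 2 + Im B ^+ 2.
  rewrite lt_neqAle eq_sym paddr_eq0 ?sqr_ge0 // !sqrf_eq0.
  by move: B0; rewrite eq_complex => -> /=; rewrite addr_ge0 ?sqr_ge0.
have w0 : 0 < Im (- (A / B)).
  move: h n0; case: (A) => a1 a2; case: (B) => b1 b2 /= h n0.
  have -> : - (a1 * - (b2 / (b1 ^+ 2 + b2 ^+ 2)) + a2 * (b1 / (b1 ^+ 2 + b2 ^+ 2)))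
   = - (a1 * - b2 + a2 * b1) / (b1 ^+ 2 + b2 ^+ 2) by field; rewrite gt_eqF.
  by rewrite pmulr_lgt0 ?invr_gt0 // oppr_gt0.
have /eqP := H _ _ u0 w0; apply.
transitivity (A + B * (- (A / B))); first by rewrite /A /B; ring.
by field.
Qed.

End Bivariate.

(** * Changing and exchanging variables *)

Section Update.
Context {T : eqType} {V : Type}.
Implicit Types (z : T -> V) (x y : T) (v w : V).

Definition upd z x v : T -> V := fun k => if k == x then v else z k.

Lemma updC z x y v w : x != y -> upd (upd z x v) y w = upd (upd z y w) x v.
Proof.
move=> xy; apply/funext => k; rewrite /upd.
by case: eqVneq => // ->; rewrite eq_sym (negbTE xy).
Qed.

Lemma upd_id z x : upd z x (z x) = z.
Proof. by apply/funext => k; rewrite /upd; case: eqVneq => // ->. Qed.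

Lemma upd_upd z x v w : upd (upd z x v) x w = upd z x w.
Proof. by apply/funext => k; rewrite /upd; case: eqVneq. Qed.

Definition swap_site x y (z : T) : T := if z == x then y else if z == y then x else z.

Lemma swap_siteK x y : involutive (swap_site x y).
Proof.
move=> z; rewrite /swap_site; case: (eqVneq z x) => [->|zx].
  by rewrite eqxx; case: eqVneq.
by case: (eqVneq z y) => [->|zy]; rewrite ?eqxx // (negbTE zx) (negbTE zy).
Qed.

Lemma upd_swap z x y k v :
  upd z k v \o swap_site x y = upd (z \o swap_site x y) (swap_site x y k) v.
Proof.
by apply/funext => j; rewrite /upd /= (inv_eq (swap_siteK x y)).
Qed.

End Update.

Arguments upd : simpl never.

(** * Approaching real points from the upper half-plane *)

Section LipschitzAtZero.
Variable R : rcfType.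
Local Notation C := R[i].
Implicit Types g h : R -> C.

(** An algebraic substitute for right-continuity at 0, stable under sums, products and conjugation,
    and meaningful over any real closed field. *)
Definition lip_at0 g := exists M : C, forall s : R, 0 <= s <= 1 ->
  `|g s - g 0| <= M * s%:C%C.

Lemma lip_cst (k : C) : lip_at0 (fun=> k).
Proof. by exists 0 => s _; rewrite subrr normr0 mul0r. Qed.

Lemma lip_id : lip_at0 (fun s => s%:C%C).
Proof.
exists 1 => s /andP[s0 _]; rewrite mul1r subr0 ger0_norm // lecR //.
Qed.

Lemma lipD g h : lip_at0 g -> lip_at0 h -> lip_at0 (fun s => g s + h s).
Proof.
move=> [M gM] [N hN]; exists (M + N) => s s01.
rewrite mulrDl opprD addrACA (le_trans (ler_normD _ _)) //.
by rewrite lerD ?gM ?hN.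
Qed.

Lemma lip_bounded g : lip_at0 g -> exists K : C, 0 <= K /\
  forall s : R, 0 <= s <= 1 -> `|g s| <= K.
Proof.
move=> [M gM]; exists (`|M| + `|g 0|); split; first by rewrite addr_ge0.
move=> s s01; rewrite -(subrK (g 0) (g s)) (le_trans (ler_normD _ _)) // lerD2r.
have Ms := gM s s01; have Ms0 := le_trans (normr_ge0 _) Ms.
rewrite (le_trans Ms) // -(ger0_norm Ms0) normrM ler_piMr //.
by case/andP: s01 => s0 s1; rewrite ger0_norm ?lecR // ler0c.
Qed.

Lemma lipM g h : lip_at0 g -> lip_at0 h -> lip_at0 (fun s => g s * h s).
Proof.
move=> gl hl; have [K [K0 gK]] := lip_bounded gl.
case: gl hl => [M gM] [N hN].
exists (K * N + M * `|h 0|) => s s01.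
have -> : g s * h s - g 0 * h 0 = g s * (h s - h 0) + (g s - g 0) * h 0 by ring.
rewrite (le_trans (ler_normD _ _)) // [leRHS]mulrDl !normrM lerD //.
  by rewrite -mulrA ler_pM ?gK ?hN.
by rewrite mulrAC ler_wpM2r ?gM.
Qed.

Lemma lip_conj g : lip_at0 g -> lip_at0 (fun s => (g s)^*%C).
Proof.
move=> [M gM]; exists M => s s01; rewrite -rmorphB.
have -> : `|(g s - g 0)^*%C| = `|g s - g 0|; last exact: gM.
by rewrite !normc_def; case: (g s - g 0) => a b /=; rewrite sqrrN.
Qed.

Lemma norm_Im (u : C) : (`|complex.Im u|)%:C%C <= `|u|.
Proof.
rewrite normc_def lecR -sqrtr_sqr ler_sqrt ?addr_ge0 ?sqr_ge0 //.
by rewrite lerDr sqr_ge0.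
Qed.

Lemma lip_Im_ge0 g : lip_at0 g ->
  (forall s : R, 0 < s <= 1 -> 0 <= complex.Im (g s)) -> 0 <= complex.Im (g 0).
Proof.
move=> [M gM] gs; rewrite leNgt; apply/negP => g0.
pose N := complex.Re M.
have gN s : 0 < s <= 1 -> - complex.Im (g 0) <= N * s.
  move=> s01; have s01' : 0 <= s <= 1.
    by case/andP: s01 => s0 ->; rewrite ltW.
  have := le_trans (norm_Im _) (gM s s01').
  rewrite lecE => /andP[_]; rewrite !ReIm_E mulr0 subr0 => h.
  apply: le_trans h; apply: le_trans (ler_norm _).
  by rewrite lerDr gs.
pose e := - complex.Im (g 0); have e0 : 0 < e by rewrite oppr_gt0.
have N0 : 0 < N by have := gN 1; rewrite ltr01 lexx mulr1 => /(_ isT); apply: lt_le_trans.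
(* At this [s] the Lipschitz bound yields the contradiction [e <= N s <= e / 2]. *)
pose s := Num.min 1 (e / (N + N)).
have s0 : 0 < s by rewrite lt_min ltr01 divr_gt0 // addr_gt0.
have /gN : 0 < s <= 1 by rewrite s0 ge_min lexx.
rewrite -/e leNgt => /negP; apply.
have : s <= e / (N + N) by rewrite ge_min lexx orbT.
rewrite -(ler_pM2l N0); move=> /le_lt_trans; apply.
have -> : N * (e / (N + N)) = e / 2 by field; lra.
by lra.
Qed.

End LipschitzAtZero.

(** * Strongly Rayleigh laws *)

Section StronglyRayleigh.
Variables (R : rcfType) (T : eqType).
Local Notation C := R[i].
Local Notation Re := (@complex.Re R).
Local Notation Im := (@complex.Im R).
Implicit Types (F : (T -> C) -> C) (z v : T -> C) (x y o : T) (t e : R).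

Local Notation one := (fun _ : T => 1 : C).

(** [F] plays the generating polynomial of a finite positive measure on subsets of [T], kept as a
    function of its variables. In the order of [R[i]], [sr_ge0] also makes the values real. The mass
    [F one] is only positive, not 1, because tilts lose mass; [sr_lip] serves to reach real points
    as limits. *)
Record strongly_rayleigh F : Prop := StronglyRayleigh {
  sr_affine : forall z x (w : C),
    F (upd z x w) = F (upd z x 0) + w * (F (upd z x 1) - F (upd z x 0));
  sr_stable : forall z, (forall x, 0 < Im (z x)) -> F z != 0;
  sr_ge0 : forall z, (forall x, 0 <= z x) -> 0 <= F z;
  sr_lip : forall z v, lip_at0 (fun s => F (fun x => z x + s%:C%C * v x));
  sr_gt0 : 0 < F one }.

Definition swap_gf t x y F : (T -> C) -> C :=
  fun z => (1 - t)%:C%C * F z + t%:C%C * F (z \o swap_site x y).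

Definition tilt_gf e o F : (T -> C) -> C := fun z => F (upd z o (e%:C%C * z o)).

Lemma sr_biaffine F z x y : strongly_rayleigh F -> x != y ->
  let G u w := F (upd (upd z x u) y w) in forall u w,
  G u w = G 0 0 + (G 1 0 - G 0 0) * u + (G 0 1 - G 0 0) * w
     + (G 1 1 - G 1 0 - G 0 1 + G 0 0) * (u * w).
Proof.
move=> SF xy G u w.
have hw a b : G a b = G a 0 + b * (G a 1 - G a 0) by exact: sr_affine.
have hu a b : G a b = G 0 b + a * (G 1 b - G 0 b).
  by rewrite /G !(updC _ _ _ xy); exact: sr_affine.
rewrite hw (hu u 0) (hu u 1); ring.
Qed.

(** With the other variables frozen in the upper half-plane, [F] is biaffine in those of [x] and
    [y], and stability is [biaffine_symmetrize]. *)
Lemma sr_swap F t x y : 0 <= t <= 1 ->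
  strongly_rayleigh F -> strongly_rayleigh (swap_gf t x y F).
Proof.
move=> t01 SF; have /andP[t0 t1] := t01.
have [->|xy] := eqVneq x y.
  suff -> : swap_gf t y y F = F by [].
  apply/funext => z; rewrite /swap_gf (_ : z \o swap_site y y = z).
    by rewrite -mulrDl -rmorphD subrK rmorph1 mul1r.
  by apply/funext => k; rewrite /swap_site /=; do 2 (case: eqVneq => [->|_] //).
have t0' : 0 <= t%:C%C by rewrite ler0c.
have t1' : 0 <= (1 - t)%:C%C by rewrite ler0c subr_ge0.
split.
- move=> z k w; rewrite /swap_gf !upd_swap.
  rewrite (sr_affine SF z) (sr_affine SF (z \o _)); ring.
- move=> z z0; pose G u w := F (upd (upd z x u) y w).
  have Fz : F z = G (z x) (z y) by rewrite /G upd_id upd_id.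
  have Fz' : F (z \o swap_site x y) = G (z y) (z x).
    congr F; apply/funext => k; rewrite /upd /swap_site /=.
    case: (eqVneq k x) => [->|kx]; first by rewrite (negbTE xy).
    by case: (eqVneq k y).
  rewrite /swap_gf Fz Fz' /G (sr_biaffine z SF xy (z x)) (sr_biaffine z SF xy (z y)).
  apply: biaffine_symmetrize => // u w u0 w0.
  rewrite -sr_biaffine //; apply: (sr_stable SF) => k.
  by rewrite /upd; do 2 case: eqP => // _.
- move=> z z0; rewrite /swap_gf addr_ge0 ?mulr_ge0 ?(sr_ge0 SF) //.
  by move=> k /=.
- move=> z v; rewrite /swap_gf; apply: lipD; apply: lipM; try exact: lip_cst.
    exact: (sr_lip SF).
  exact: (sr_lip SF (z \o _) (v \o _)).
- rewrite /swap_gf (_ : one \o _ = one) // -mulrDl -rmorphD subrK rmorph1 mul1r.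
  exact: sr_gt0.
Qed.

Lemma sr_tilt_one F e o : strongly_rayleigh F ->
  tilt_gf e o F one = (1 - e)%:C%C * F (upd one o 0) + e%:C%C * F one.
Proof.
move=> SF; rewrite /tilt_gf mulr1 (sr_affine SF) (_ : upd one o 1 = one).
  by rewrite rmorphB rmorph1; ring.
exact: (upd_id one).
Qed.

Lemma sr_tilt F e o : 0 < e <= 1 ->
  strongly_rayleigh F -> strongly_rayleigh (tilt_gf e o F).
Proof.
move=> /andP[e0 e1] SF; have e0' : 0 < e%:C%C by rewrite (ltcR 0 e).
have e1' : 0 <= (1 - e)%:C%C by rewrite ler0c subr_ge0.
split.
- move=> z x w; rewrite /tilt_gf.
  have [->|xo] := eqVneq x o.
    by rewrite !upd_upd /upd eqxx mulr0 mulr1 -/(upd z o _)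
     -/(upd z o _) -/(upd z o _) (sr_affine SF)
     [F (fun k => if k == o then e%:C%C else z k)](sr_affine SF z o e%:C%C); ring.
  have E u : upd (upd z x u) o (e%:C%C * upd z x u o) =
             upd (upd z o (e%:C%C * z o)) x u.
    by rewrite updC // [upd z x u o]/upd eq_sym (negbTE xo).
  by rewrite !E; exact: sr_affine.
- move=> z z0; apply: (sr_stable SF) => x; rewrite /upd; case: eqP => // _.
  by rewrite !ReIm_E mul0r addr0 mulr_gt0.
- move=> z z0; apply: (sr_ge0 SF) => x; rewrite /upd; case: eqP => // _.
  by rewrite mulr_ge0 // ltW.
- move=> z v; rewrite /tilt_gf.
  have := sr_lip SF (upd z o (e%:C%C * z o)) (upd v o (e%:C%C * v o)).
  congr lip_at0; apply/funext => s; congr F; apply/funext => k; rewrite /upd.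
  by case: eqP => // _ /=; ring.
- rewrite sr_tilt_one // ltr_wpDl ?mulr_gt0 ?(sr_gt0 SF) //.
  rewrite mulr_ge0 // (sr_ge0 SF) // => k; rewrite /upd.
  by case: eqP => _; rewrite ?ler01.
Qed.

(** This is [biaffine_neg_corr] at [u = i]. The other variables should equal 1, which is not in the
    open half-plane: they are set to [1 + s i] and [s] tends to 0. At [s = 0] the coefficients are
    real and the imaginary part is the difference of the two sides. *)
Lemma sr_neg_corr F x y : strongly_rayleigh F -> x != y ->
  F one * F (upd (upd one x 0) y 0) <= F (upd one x 0) * F (upd one y 0).
Proof.
move=> SF xy; pose zz (s : R) : T -> C := fun=> 1 + s%:C%C * 'i%C.
pose G s u w := F (upd (upd (zz s) x u) y w).
have Gl (u w : C) : lip_at0 (fun s => G s u w).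
  have := sr_lip SF (upd (upd one x u) y w) (upd (upd (fun=> 'i%C) x 0) y 0).
  congr lip_at0; apply/funext => s; congr F; apply/funext => k; rewrite /upd.
  by do 2 (case: eqP => _; first by rewrite mulr0 addr0).
pose g s := (G s 0 0 + (G s 1 0 - G s 0 0) * 'i%C) *
  ((G s 0 1 - G s 0 0) + (G s 1 1 - G s 1 0 - G s 0 1 + G s 0 0) * 'i%C)^*%C.
have lipB (a b : R -> C) : lip_at0 a -> lip_at0 b -> lip_at0 (fun s => a s - b s).
  move=> la lb; have := lipD la (lipM (lip_cst (-1)) lb).
  by congr lip_at0; apply/funext => s; rewrite mulN1r.
have gl : lip_at0 g.
  apply: lipM; last apply: lip_conj.
    by apply: lipD => //; apply: lipM; [exact: lipB|exact: lip_cst].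
  apply: lipD; first exact: lipB.
  apply: lipM; last exact: lip_cst.
  by apply: lipD => //; apply: (lipB) => //; exact: lipB.
have : 0 <= Im (g 0).
  apply: lip_Im_ge0 gl _ => s /andP[s0 s1].
  apply: biaffine_neg_corr; last by rewrite /= ltr01.
  move=> u w u0 w0; rewrite -(sr_biaffine (zz s) SF xy).
  apply: (sr_stable SF) => k; rewrite /upd /zz; do 2 case: eqP => // _.
  by rewrite /= mul0r mulr1 add0r addr0.
have zz0 : zz 0 = one by apply/funext => k; rewrite /zz mul0r addr0.
have G0 (u w : C) : 0 <= u -> 0 <= w -> exists r : R, G 0 u w = r%:C%C.
  move=> u0 w0; have : 0 <= G 0 u w.
    apply: (sr_ge0 SF) => k; rewrite /upd; do 2 case: eqP => // _.
    by rewrite zz0 ler01.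
  by rewrite lecE => /andP[/eqP h _]; exists (Re (G 0 u w)); apply: ReIm_ext.
have E11 : G 0 1 1 = F one.
  by rewrite /G zz0 (upd_id one x) (upd_id one y).
have E01 : G 0 0 1 = F (upd one x 0).
  by rewrite /G zz0 updC // (upd_id one y).
have E10 : G 0 1 0 = F (upd one y 0) by rewrite /G zz0 (upd_id one x).
have E00 : G 0 0 0 = F (upd (upd one x 0) y 0) by rewrite /G zz0.
rewrite /g -E11 -E10 -E01 -E00.
have [r11 ->] := G0 _ _ ler01 ler01.
have [r10 ->] := G0 _ _ ler01 (lexx 0).
have [r01 ->] := G0 _ _ (lexx 0) ler01.
have [r00 ->] := G0 _ _ (lexx 0) (lexx 0).
rewrite -!rmorphM lecR /= => h; rewrite -subr_ge0; apply: le_trans h _.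
by rewrite le_eqVlt; apply/orP; left; apply/eqP; ring.
Qed.

Definition mix_density t x y (u : T -> R) : T -> R :=
  fun k => (1 - t) * u k + t * u (swap_site x y k).

Definition kill_density o (u : T -> R) : T -> R :=
  fun k => if k == o then 0 else u k.

(* [1 - F (upd one x 0) / F one] is the density at [x] of the law with
   generating function proportional to [F]. *)
Definition density_ge F (u : T -> R) :=
  forall x, F (upd one x 0) <= (1 - u x)%:C%C * F one.

Lemma density_swap F t x y u : 0 <= t <= 1 ->
  density_ge F u -> density_ge (swap_gf t x y F) (mix_density t x y u).
Proof.
move=> /andP[t0 t1] Fu k; rewrite /swap_gf !upd_swap /mix_density.
have E : one \o swap_site x y = one by [].
rewrite !E -mulrDl -rmorphD subrK rmorph1 mul1r.
have -> : (1 - ((1 - t) * u k + t * u (swap_site x y k)))%:C%C =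
  (1 - t)%:C%C * (1 - u k)%:C%C + t%:C%C * (1 - u (swap_site x y k))%:C%C.
  rewrite -!rmorphM -rmorphD; congr (_%:C)%C; ring.
by rewrite mulrDl -!mulrA lerD // ler_wpM2l ?ler0c ?subr_ge0.
Qed.

(** One inspection. Penalising a particle at [o] raises the densities elsewhere by negative
    correlation; at [o] itself the lower bound is given up and becomes 0. The mass drops by the
    stated factor because [o] is occupied with density at least [u o]. *)
Lemma density_tilt F e o u : 0 < e <= 1 -> (forall x, 0 <= u x) ->
  strongly_rayleigh F -> density_ge F u ->
  density_ge (tilt_gf e o F) (kill_density o u) /\
  tilt_gf e o F one <= (1 - (1 - e) * u o)%:C%C * F one.
Proof.
move=> /andP[e0 e1] u0 SF Fu.
have Fone := sr_gt0 SF.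
have e1' : 0 <= (1 - e)%:C%C by rewrite ler0c subr_ge0.
have F_ge0 x : 0 <= F (upd one x 0).
  by apply: (sr_ge0 SF) => k; rewrite /upd; case: eqP => _; rewrite ?ler01.
split; last first.
  rewrite sr_tilt_one //.
  have -> : (1 - (1 - e) * u o)%:C%C = (1 - e)%:C%C * (1 - u o)%:C%C + e%:C%C.
    by rewrite -rmorphM -rmorphD; congr (_%:C)%C; ring.
  by rewrite mulrDl lerD2r -mulrA ler_wpM2l.
move=> x; rewrite /kill_density; case: eqVneq => [->|xo].
  rewrite subr0 rmorph1 mul1r sr_tilt_one // /tilt_gf upd_upd /upd eqxx mulr0.
  rewrite -/(upd one o 0).
  have E : F (upd one o 0) = (1 - e)%:C%C * F (upd one o 0) + e%:C%C * F (upd one o 0).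
    by rewrite -mulrDl -rmorphD subrK rmorph1 mul1r.
  rewrite [leLHS]E lerD2l ler_wpM2l ?ler0c ?(ltW e0) //.
  apply: le_trans (Fu o) _; rewrite ler_piMl ?(ltW Fone) //.
  by rewrite lecE /= eqxx lerBlDr lerDl u0.
(* After multiplication by [F one], the part of weight [1 - e] is exactly [sr_neg_corr]. *)
rewrite -(ler_pM2r Fone) -!mulrA.
apply: (@le_trans _ _ (F (upd one x 0) * tilt_gf e o F one)); last first.
  rewrite [leRHS]mulrA mulrAC mulrC [leRHS]mulrC ler_wpM2l ?Fu //.
  by rewrite ltW // sr_gt0 //; apply: sr_tilt; rewrite ?e0.
rewrite sr_tilt_one //.
have -> : tilt_gf e o F (upd one x 0) =
   (1 - e)%:C%C * F (upd (upd one x 0) o 0) + e%:C%C * F (upd one x 0).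
  rewrite /tilt_gf [upd one x 0 o]/upd eq_sym (negbTE xo) mulr1 (sr_affine SF).
  have -> : upd (upd one x 0) o 1 = upd one x 0.
    by rewrite updC // (upd_id one o).
  by rewrite rmorphB rmorph1; ring.
rewrite mulrDl mulrDr; apply: lerD; last first.
  by rewrite mulrCA mulrA.
rewrite -mulrA [leRHS]mulrCA ler_wpM2l // mulrC.
exact: sr_neg_corr.
Qed.

Lemma sr_prod (s : seq T) (q : R) : uniq s -> 0 <= q <= 1 ->
  strongly_rayleigh (fun z => \prod_(x <- s) ((1 - q)%:C%C + q%:C%C * z x)).
Proof.
move=> us /andP[q0 q1].
have q0' : 0 <= q%:C%C by rewrite ler0c.
have q1' : 0 <= (1 - q)%:C%C by rewrite ler0c subr_ge0.
split.
- move=> z x w; have [xs|xs] := boolP (x \in s).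
    rewrite !(perm_big _ (perm_to_rem xs)) /= !big_cons /=.
    have E (u : C) : \prod_(j <- rem x s) ((1 - q)%:C%C + q%:C%C * upd z x u j) =
      \prod_(j <- rem x s) ((1 - q)%:C%C + q%:C%C * z j).
      rewrite big_seq [RHS]big_seq; apply: eq_bigr => j.
      by rewrite mem_rem_uniq // !inE => /andP[/negbTE jx _]; rewrite /upd jx.
    by rewrite !E /upd eqxx; ring.
  have E (u : C) : \prod_(j <- s) ((1 - q)%:C%C + q%:C%C * upd z x u j) =
      \prod_(j <- s) ((1 - q)%:C%C + q%:C%C * z j).
    rewrite big_seq [RHS]big_seq; apply: eq_bigr => j js; rewrite /upd.
    by case: eqP => // jx; move: xs; rewrite -jx js.
  by rewrite !E subrr mulr0 addr0.
- move=> z z0; rewrite prodf_seq_neq0; apply/allP => x _ /=.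
  (* At [q = 0] the factor is the real number 1, so its imaginary part gives nothing. *)
  have [->|qn0] := eqVneq q 0; first by rewrite subr0 mul0r addr0 oner_neq0.
  by apply: complex_neq0; rewrite !ReIm_E mul0r addr0 add0r mulr_gt0 // lt0r qn0.
- by move=> z z0; apply: prodr_ge0 => x _; rewrite addr_ge0 // mulr_ge0.
- move=> z v; elim: s {us} => [|x s IH].
    by under eq_fun do rewrite big_nil; exact: lip_cst.
  under eq_fun do rewrite big_cons.
  apply: lipM => //; apply: lipD; first exact: lip_cst.
  apply: lipM; first exact: lip_cst.
  by apply: lipD; [exact: lip_cst|apply: lipM; [exact: lip_id|exact: lip_cst]].
- rewrite big1 ?ltr01 // => x _; rewrite mulr1 -rmorphD subrK rmorph1 //.
Qed.

End StronglyRayleigh.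

(** * Inspecting the origin *)

(** Expectation over independent bits as a finite sum, so that the algebraic half of the proof
    involves no measure. *)
Fixpoint bits_expectation (R : pzRingType) (th : seq R) (g : seq bool -> R) : R :=
  if th is t :: th' then
    (1 - t) * bits_expectation th' (fun b => g (false :: b)) +
    t * bits_expectation th' (fun b => g (true :: b))
  else g [::].

Lemma eq_bits_expectation (R : pzRingType) (th : seq R) (g h : seq bool -> R) :
  (forall b, size b = size th -> g b = h b) ->
  bits_expectation th g = bits_expectation th h.
Proof.
elim: th g h => [|t th IH] g h gh /=; first exact: gh.
by congr (_ * _ + _ * _); apply: IH => b sb; rewrite gh //= sb.
Qed.

(* A program is a list of instructions: [None] inspects the site [o], [Some i]
   swaps the two sites of [i] with probability [th i]. *)
Section Programs.
Variables (R : rcfType) (T : eqType) (I : Type).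
Variables (o : T) (tr : I -> T * T) (th : I -> R).
Local Notation C := R[i].
Local Notation one := (fun _ : T => 1 : C).
Implicit Types (prog : seq (option I)) (u : T -> R) (x : T).

Definition swap_of i := swap_site (tr i).1 (tr i).2.

Definition mix_of i u := mix_density (th i) (tr i).1 (tr i).2 u.

Fixpoint visits prog (bits : seq bool) x : nat :=
  match prog, bits with
  | None :: p, _ => ((x == o) + visits p bits x)%N
  | Some i :: p, b :: bs => visits p bs (if b then swap_of i x else x)
  (* A default value: programs are run with one bit per swap. *)
  | Some _ :: _, [::] => 0%N
  | [::], _ => 0%N
  end.

Fixpoint avoid_bound (e : R) prog u : R :=
  match prog with
  | [::] => 1
  | None :: p => (1 - (1 - e) * u o) * avoid_bound e p (kill_density o u)
  | Some i :: p => avoid_bound e p (mix_of i u)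
  end.

Fixpoint run_gf (e : R) prog (F : (T -> C) -> C) : (T -> C) -> C :=
  match prog with
  | [::] => F
  | None :: p => run_gf e p (tilt_gf e o F)
  | Some i :: p => run_gf e p (swap_gf (th i) (tr i).1 (tr i).2 F)
  end.

Hypothesis th01 : forall i, 0 <= th i <= 1.

Lemma avoid_bound_ge0 e prog u : 0 < e <= 1 -> (forall x, 0 <= u x <= 1) ->
  0 <= avoid_bound e prog u.
Proof.
move=> /andP[e0 e1]; elim: prog u => [|[i|] p IH] u u01 //=.
- apply: IH => x; rewrite /mix_of /mix_density.
  have /andP[a0 a1] := u01 x; have /andP[b0 b1] := u01 (swap_site (tr i).1 (tr i).2 x).
  have /andP[t0 t1] := th01 i.
  by apply/andP; split; nra.
- rewrite mulr_ge0 //.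
    by have /andP[a0 a1] := u01 o; nra.
  by apply: IH => x; rewrite /kill_density; case: eqP; rewrite ?lexx ?ler01.
Qed.

Lemma run_gf_bound e prog F u : 0 < e <= 1 -> (forall x, 0 <= u x <= 1) ->
  strongly_rayleigh F -> density_ge F u ->
  run_gf e prog F one <= (avoid_bound e prog u)%:C%C * F one.
Proof.
move=> e01; elim: prog F u => [|[i|] p IH] F u u01 SF Fu /=.
- by rewrite rmorph1 mul1r.
- have -> : F one = swap_gf (th i) (tr i).1 (tr i).2 F one.
    rewrite /swap_gf.
    have -> : one \o swap_site (tr i).1 (tr i).2 = one by [].
    by rewrite -mulrDl -rmorphD subrK rmorph1 mul1r.
  apply: IH; last 2 first.
  + exact: sr_swap.
  + exact: density_swap.
  move=> x; rewrite /mix_of /mix_density.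
  have /andP[a0 a1] := u01 x; have /andP[b0 b1] := u01 (swap_site (tr i).1 (tr i).2 x).
  have /andP[t0 t1] := th01 i.
  by apply/andP; split; nra.
- have u0 x : 0 <= u x by case/andP: (u01 x).
  have k01 x : 0 <= kill_density o u x <= 1.
    by rewrite /kill_density; case: eqP => _; rewrite ?lexx ?ler01.
  have [dF hF] := density_tilt o e01 u0 SF Fu.
  apply: le_trans (IH _ _ k01 (sr_tilt o e01 SF) dF) _.
  rewrite [(_ * avoid_bound _ _ _)%R]mulrC rmorphM -mulrA ler_wpM2l // ler0c.
  exact: avoid_bound_ge0.
Qed.

Lemma run_gf_lin e prog (F G H : (T -> C) -> C) (a b : C) :
  (forall z, F z = a * G z + b * H z) ->
  forall z, run_gf e prog F z = a * run_gf e prog G z + b * run_gf e prog H z.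
Proof.
elim: prog F G H => [|[i|] p IH] F G H FE z /=; first exact: FE.
  by apply: IH => w; rewrite /swap_gf !FE; ring.
by apply: IH => w; rewrite /tilt_gf !FE.
Qed.

(** The statement is generalised for the induction: [sg x] is the present position of the particle
    that started at [x], and [b x] has absorbed the factors [e] of its past visits. *)
Lemma run_gf_prod e prog (s : seq T) (sg : T -> T) (a : R) (b : T -> R) :
  run_gf e prog (fun z => \prod_(x <- s) (a%:C%C + (b x)%:C%C * z (sg x))) one =
  (bits_expectation [seq th i | i <- pmap id prog] (fun bits =>
     \prod_(x <- s) (a + b x * e ^+ visits prog bits (sg x))))%:C%C.
Proof.
elim: prog sg b => [|[i|] p IH] sg b /=.
- rewrite rmorph_prod; apply: eq_bigr => x _.
  by rewrite expr0 !mulr1 rmorphD.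
- have E1 := IH sg b; have E2 := IH (swap_of i \o sg) b.
  rewrite rmorphD !rmorphM; transitivity
    ((1 - th i)%:C%C * run_gf e p (fun z => \prod_(x <- s) (a%:C%C + (b x)%:C%C * z (sg x))) one
    + (th i)%:C%C * run_gf e p (fun z => \prod_(x <- s)
        (a%:C%C + (b x)%:C%C * z ((swap_of i \o sg) x))) one).
    exact: run_gf_lin.
  by rewrite E1 E2.
- have -> : tilt_gf e o (fun z => \prod_(x <- s) (a%:C%C + (b x)%:C%C * z (sg x)))
   = fun z => \prod_(x <- s) (a%:C%C + (b x * e ^+ (sg x == o))%:C%C * z (sg x)).
    apply/funext => z; rewrite /tilt_gf; apply: eq_bigr => x _; congr (_ + _).
    rewrite /upd; case: eqP => [->|_].
      by rewrite expr1 rmorphM mulrA.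
    by rewrite expr0 mulr1.
  rewrite (IH sg (fun x => b x * e ^+ (sg x == o))); congr (_%:C)%C.
  apply: eq_bits_expectation => bits _; apply: eq_bigr => x _.
  by rewrite exprD mulrA.
Qed.

(** Averaging over the colour of [x] replaces its penalty [e ^+ visits] by
    [1 - q + q * e ^+ visits]; for small [e] the left side approaches the probability that no
    coloured particle is ever seen at [o]. *)
Theorem avoid_probability_le e prog (s : seq T) (q : R) :
  0 < e <= 1 -> 0 <= q <= 1 -> uniq s ->
  bits_expectation [seq th i | i <- pmap id prog] (fun bits =>
     \prod_(x <- s) (1 - q + q * e ^+ visits prog bits x))
  <= avoid_bound e prog (fun x => if x \in s then q else 0).
Proof.
move=> e01 q01 us.
have SF := @sr_prod R T s q us q01.
rewrite -lecR -(run_gf_prod e prog s id (1 - q) (fun=> q)).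
have F1 : \prod_(x <- s) ((1 - q)%:C%C + q%:C%C * 1) = 1 :> C.
  by rewrite big1 // => x _; rewrite mulr1 -rmorphD subrK rmorph1.
apply: le_trans (@run_gf_bound e prog _ (fun x => if x \in s then q else 0) e01 _ SF _) _.
- by move=> x; case: ifP => //; rewrite lexx ler01.
- move=> x; rewrite /= F1 mulr1; case: ifPn => xs; last first.
    rewrite subr0 rmorph1 big_seq big1 // => y ys; rewrite /upd.
    case: eqP => [yx|_]; first by rewrite -yx ys in xs.
    by rewrite mulr1 -rmorphD subrK rmorph1.
  rewrite (perm_big _ (perm_to_rem xs)) /= big_cons /upd eqxx mulr0 addr0.
  rewrite big_seq big1 ?mulr1 // => y.
  rewrite mem_rem_uniq // !inE => /andP[/negbTE -> _].
  by rewrite mulr1 -rmorphD subrK rmorph1.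
- by rewrite F1 mulr1.
Qed.

End Programs.

(** * The walk on finitely many sites *)

Section SitesAndPairs.
Variable T : countType.
Implicit Types (x y : T) (e : T * T) (m : nat).

Definition sites m : seq T := pmap (@pickle_inv T) (iota 0 m).

Lemma mem_sites m x : (x \in sites m) = (choice.pickle x < m)%N.
Proof.
rewrite mem_pmap; apply/mapP/idP => [[k]|xm].
  rewrite mem_iota add0n => /andP[_ km] /esym E.
  by have := @pickle_invK T k; rewrite E /= => ->.
by exists (choice.pickle x); rewrite ?mem_iota // choice.pickleK_inv.
Qed.

Lemma uniq_sites m : uniq (sites m).
Proof.
apply: (@pmap_uniq _ _ _ choice.pickle); last exact: iota_uniq.
exact: pickle_invK.
Qed.

Lemma sub_sites r m : (r <= m)%N -> {subset sites r <= sites m}.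
Proof. by move=> rm x; rewrite !mem_sites => /leq_trans; apply. Qed.

Definition incident x e := (x == e.1) || (x == e.2).

Definition partner x e := swap_site e.1 e.2 x.

(* Each unordered pair of distinct sites is listed once, smaller code first. *)
Definition pairs m : seq (T * T) :=
  [seq e <- [seq (x, y) | x <- sites m, y <- sites m] | (choice.pickle e.1 < choice.pickle e.2)%N].

Lemma mem_pairs m e : (e \in pairs m) =
  [&& (choice.pickle e.1 < choice.pickle e.2)%N, e.1 \in sites m & e.2 \in sites m].
Proof.
rewrite mem_filter; congr (_ && _); apply/allpairsP/andP => [[[x y] [? ? ->]]//|[? ?]].
by exists e; split => //; exact: surjective_pairing.
Qed.

Lemma uniq_pairs m : uniq (pairs m).
Proof.
apply: filter_uniq; apply: allpairs_uniq; try exact: uniq_sites.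
by move=> [? ?] [? ?].
Qed.

Lemma pairs_neq m e : e \in pairs m -> e.1 != e.2.
Proof.
by rewrite mem_pairs => /andP[+ _]; apply: contraTneq => ->; rewrite ltnn.
Qed.

Lemma partner_cases x e : e.1 != e.2 -> incident x e ->
  (x = e.1 /\ partner x e = e.2) \/ (x = e.2 /\ partner x e = e.1).
Proof.
move=> e12; rewrite /incident /partner /swap_site; case: eqVneq => [->|_] /=.
  by left.
by move=> /eqP ->; right; rewrite eqxx.
Qed.

Lemma partner_id x e : ~~ incident x e -> partner x e = x.
Proof.
by rewrite /incident /partner /swap_site negb_or => /andP[/negbTE -> /negbTE ->].
Qed.

Lemma pairs_incident m x y : x \in sites m -> y \in sites m -> x != y ->
  exists2 e, e \in pairs m & incident x e /\ partner x e = y.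
Proof.
move=> xm ym xy; have : choice.pickle x != choice.pickle y.
  by apply: contraNneq xy => /(pcan_inj choice.pickleK) ->.
rewrite neq_ltn => /orP[h|h].
  exists (x, y); first by rewrite mem_pairs h xm.
  by rewrite /incident /partner /swap_site eqxx.
exists (y, x); first by rewrite mem_pairs h xm ym.
by rewrite /incident /partner /swap_site /= eqxx orbT (negbTE xy).
Qed.

(** Turns sums over the pairs containing [x] into sums over the other sites. *)
Lemma perm_partner m x : x \in sites m ->
  perm_eq [seq partner x e | e <- pairs m & incident x e]
          [seq y <- sites m | y != x].
Proof.
move=> xm; apply: uniq_perm.
- rewrite map_inj_in_uniq; first exact/filter_uniq/uniq_pairs.
  move=> e e'; rewrite [e \in _]mem_filter [e' \in _]mem_filter => /andP[ie em] /andP[ie' em'].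
  have [e12 e12'] := (pairs_neq em, pairs_neq em').
  move: em em'; rewrite !mem_pairs => /andP[lt _] /andP[lt' _].
  case: e e' ie ie' e12 e12' lt lt' => [a b] [a' b'] ie ie' e12 e12' lt lt' E.
  have [[xa pb]|[xb pa]] := partner_cases e12 ie;
  have [[xa' pb']|[xb' pa']] := partner_cases e12' ie'; move: lt lt' => /= lt lt'.
  + by move: xa xa' pb pb'; rewrite /= -E => <- <- -> ->.
  + move: xa xb' pb pa'; rewrite /= -E => xa xb' -> ba'.
    by move: lt; rewrite -xa xb' ba' ltnNge ltnW.
  + move: xb xa' pa pb'; rewrite /= -E => xb xa' -> ab'.
    by move: lt'; rewrite -xa' xb -ab' ltnNge ltnW.
  + by move: xb xb' pa pa'; rewrite /= -E => <- <- -> ->.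
- exact/filter_uniq/uniq_sites.
move=> y; rewrite mem_filter; apply/mapP/andP => [[e]|[yx ym]].
  rewrite mem_filter => /andP[ie em] ->; have e12 := pairs_neq em.
  move: em; rewrite mem_pairs => /and3P[_ e1 e2].
  by have [[-> ->]|[-> ->]] := partner_cases e12 ie; rewrite ?e1 ?e2 // eq_sym.
have xy : x != y by rewrite eq_sym.
by have [e em [ie pe]] := pairs_incident xm ym xy; exists e; first by rewrite mem_filter ie.
Qed.

End SitesAndPairs.

(** * One cell of stirring against one step of the killed walk *)

Section CellOperator.
Variables (R : realType) (T : countType) (c : T -> T -> R) (tot : T -> R) (C h : R).
Implicit Types (u : T -> R) (x y : T) (e : T * T) (l : seq (T * T)) (m r : nat).
Hypothesis c_ge0 : forall x y, 0 <= c x y.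
Hypothesis c_sym : forall x y, c x y = c y x.
Hypothesis tot_gt0 : forall x, 0 < tot x.
Hypothesis tot_le : forall x, tot x <= C.
Hypothesis c_sum : forall x s, uniq s -> \sum_(y <- s) c x y <= tot x.
Hypothesis h_ge0 : 0 <= h.

Definition ring_prob e : R := 1 - expR (- (c e.1 e.2 * h)).

Definition cell_op l u : T -> R :=
  foldl (fun v e => mix_density (ring_prob e) e.1 e.2 v) u l.

(** Not the semigroup of the walk at time [h]: at most one jump is made per step, as in the walk
    with rounded-up holding times, and leaving [B] kills. *)
Definition killed_op (B : seq T) u : T -> R := fun x =>
  if x \in B then
    expR (- (tot x * h)) * u x +
    \sum_(y <- B) (1 - expR (- (tot x * h))) * (c x y / tot x) * u y
  else 0.

Lemma ring_prob01 e : 0 <= ring_prob e <= 1.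
Proof.
rewrite /ring_prob subr_ge0 gerBl expR_ge0 andbT -expR0 ler_expR oppr_le0.
by rewrite mulr_ge0.
Qed.

Lemma cell_op_01 l u : (forall x, 0 <= u x <= 1) -> forall x, 0 <= cell_op l u x <= 1.
Proof.
elim: l u => //= e l IH u u01; apply: IH => x; rewrite /mix_density.
have /andP[t0 t1] := ring_prob01 e.
have /andP[a0 a1] := u01 x; have /andP[b0 b1] := u01 (swap_site e.1 e.2 x).
by apply/andP; split; nra.
Qed.

Lemma c_sumW x s (p : pred T) : uniq s -> \sum_(y <- s | p y) c x y <= tot x.
Proof.
by move=> us; rewrite -big_filter c_sum // filter_uniq.
Qed.

Definition incident_rate x l := \sum_(e <- l | incident x e) c e.1 e.2.

Lemma incident_rate_ge0 x l : 0 <= incident_rate x l.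
Proof. exact: sumr_ge0. Qed.

(** Only two scenarios are kept: no pair at [x] rings, or a single one does and nothing else happens
    at its two ends. The factor [expR (- (C * h))] bounds below the chance that the partner is left
    alone, whatever its rate. *)
Lemma cell_op_ge l u x : all (fun e => e.1 != e.2) l -> (forall y, 0 <= u y) ->
  (forall y, incident_rate y l <= C) ->
  expR (- (incident_rate x l * h)) *
    (u x + expR (- (C * h)) *
       \sum_(e <- l | incident x e) ring_prob e * u (partner x e))
  <= cell_op l u x.
Proof.
move=> + u0; elim/last_ind: l x => [|l e IH] x.
  rewrite /incident_rate !big_nil mul0r oppr0 expR0 mulr0 addr0 mul1r //.
rewrite all_rcons => /andP[e12 al] rateC.
have rate_rcons y : incident_rate y (rcons l e) =
  incident_rate y l + (if incident y e then c e.1 e.2 else 0).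
  by rewrite /incident_rate big_rcons.
have rateC' y : incident_rate y l <= C.
  apply: le_trans (rateC y); rewrite rate_rcons lerDl.
  by case: ifP.
have /andP[t0 t1] := ring_prob01 e.
rewrite /cell_op -cats1 foldl_cat /= -/(cell_op l u) cats1 /mix_density.
rewrite -/(partner x e) rate_rcons big_rcons /=.
have [ie|ie] := boolP (incident x e); last first.
  rewrite partner_id // -mulrDl subrK mul1r !addr0.
  exact: IH.
set S := \sum_(_ <- _ | _) _; set E := expR (- (incident_rate x l * h)).
have IHx : E * (u x + expR (- (C * h)) * S) <= cell_op l u x by exact: IH.
have S0 : 0 <= S.
  by apply: sumr_ge0 => e' _; rewrite mulr_ge0 //; case/andP: (ring_prob01 e').
have -> : expR (- ((incident_rate x l + c e.1 e.2) * h)) = (1 - ring_prob e) * E.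
  by rewrite /ring_prob opprB addrCA subrr addr0 mulrDl opprD expRD mulrC.
(* At the partner the first term of the induction hypothesis is enough. *)
have IHy : expR (- (incident_rate (partner x e) l * h)) * u (partner x e)
    <= cell_op l u (partner x e).
  apply: le_trans (IH _ al rateC'); rewrite ler_pM2l ?expR_gt0 // lerDl.
  rewrite mulr_ge0 ?expR_ge0 // sumr_ge0 // => e' _.
  by rewrite mulr_ge0 //; case/andP: (ring_prob01 e').
have EE : (1 - ring_prob e) * E * expR (- (C * h)) * u (partner x e) <=
   expR (- (incident_rate (partner x e) l * h)) * u (partner x e).
  rewrite ler_wpM2r // -[leRHS]mul1r ler_pM ?expR_ge0 //.
  - by rewrite mulr_ge0 ?expR_ge0 // subr_ge0.
  - have E1 : E <= 1.
      by rewrite /E -expR0 ler_expR oppr_le0 mulr_ge0 // incident_rate_ge0.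
    by rewrite mulr_ile1 ?subr_ge0 // ?gerBl //; exact: expR_ge0.
  - by rewrite ler_expR lerN2 ler_wpM2r.
have H1 : (1 - ring_prob e) * (E * (u x + expR (- (C * h)) * S)) <=
   (1 - ring_prob e) * cell_op l u x by rewrite ler_wpM2l // subr_ge0.
have H2 := ler_wpM2l t0 (le_trans EE IHy).
apply: le_trans (lerD H1 H2).
rewrite le_eqVlt; apply/orP; left; apply/eqP; ring.
Qed.

(** To first order in [h] the killed step is [u x - tot x h u x] plus [h] times the sum of
    [c x y u y] over the first [r] sites, and the cell gives at least as much: further sites only
    add, and a self-jump of rate [c x x] changes nothing. Of the constant 4, one unit comes from
    [Pge], two from [PQ] and one from [SA]. *)
Lemma killed_op_le_cell_op r m u x : (r <= m)%N -> (forall y, 0 <= u y <= 1) ->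
  killed_op (sites T r) u x <= cell_op (pairs T m) u x + 4 * C ^+ 2 * h ^+ 2.
Proof.
move=> rm u01; have u0 y : 0 <= u y by case/andP: (u01 y).
have u1 y : u y <= 1 by case/andP: (u01 y).
have C0 : 0 <= C by rewrite (le_trans _ (tot_le x)) // ltW.
have err0 : 0 <= 4 * C ^+ 2 * h ^+ 2 by rewrite !mulr_ge0 // sqr_ge0.
have K0 : 0 <= cell_op (pairs T m) u x by case/andP: (cell_op_01 (pairs T m) u01 x).
rewrite /killed_op; case: ifPn => [xr|_]; last by rewrite addr_ge0.
have xm : x \in sites T m by exact: sub_sites xr.
have ratesE (F : T -> R) y : y \in sites T m ->
   \sum_(e <- pairs T m | incident y e) F (partner y e) =
   \sum_(z <- sites T m | z != y) F z.
  move=> ym; rewrite -big_filter -[RHS]big_filter.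
  by rewrite -(perm_big _ (perm_partner ym)) big_map.
have cE y e : e \in pairs T m -> incident y e -> c e.1 e.2 = c y (partner y e).
  move=> em ie; have [[-> ->]//|[-> ->]] := partner_cases (pairs_neq em) ie.
  exact: c_sym.
have rateE y : y \in sites T m ->
    incident_rate y (pairs T m) = \sum_(z <- sites T m | z != y) c y z.
  move=> ym; rewrite -(ratesE (c y)) // /incident_rate big_seq_cond [RHS]big_seq_cond.
  by apply: eq_bigr => e /andP[em ie]; exact: cE.
have rate_le y : incident_rate y (pairs T m) <= C.
  have [ym|ym] := boolP (y \in sites T m).
    by rewrite rateE // (le_trans _ (tot_le y)) // c_sumW // uniq_sites.
  rewrite /incident_rate big_seq_cond big1 ?C0 // => e /andP[].
  rewrite mem_pairs => /and3P[_ e1 e2].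
  by rewrite /incident => /orP[] /eqP E; rewrite -E (negbTE ym) in e1 e2.
have allP : all (fun e => e.1 != e.2) (pairs T m).
  by apply/allP => e; exact: pairs_neq.
have low := cell_op_ge x allP u0 rate_le.
set q := incident_rate x (pairs T m) in low *.
have q0 : 0 <= q by exact: incident_rate_ge0.
have qC : q <= C by exact: rate_le.
set S := \sum_(_ <- pairs T m | _) _ in low.
(* Pairs join distinct sites, so the rate of self-jumps is missing from [q]; it reappears in [kE]
   and is absorbed in [Pge]. *)
have qx : q + c x x <= tot x.
  rewrite /q rateE // addrC -(bigD1_seq x) ?uniq_sites //=.
  exact: c_sum (uniq_sites _ _).
pose B' := [seq y <- sites T r | y != x].
have uB' : uniq B' by rewrite filter_uniq // uniq_sites.
pose A := \sum_(y <- B') c x y * u y.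
have A0 : 0 <= A by apply: sumr_ge0 => y _; rewrite mulr_ge0.
have AC : A <= C.
  apply: le_trans (tot_le x); apply: le_trans (c_sum x uB').
  by apply: ler_sum => y _; rewrite ler_piMr.
have SE : S = \sum_(z <- sites T m | z != x) (1 - expR (- (c x z * h))) * u z.
  rewrite -(ratesE (fun z => (1 - expR (- (c x z * h))) * u z)) // /S.
  rewrite big_seq_cond [RHS]big_seq_cond; apply: eq_bigr => e /andP[em ie].
  by rewrite /ring_prob -cE.
have expB (y : R) : 0 <= y -> y * (1 - y) <= 1 - expR (- y).
  move=> y0; have := expR_ge1Dx y; have := expR_ge1Dx (- y) => h1 h2.
  have : expR (- y) * expR y = 1 by rewrite -expRD addNr expR0.
  by have := expR_gt0 (- y) => ? ?; nra.
have SA : h * (1 - C * h) * A <= S.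
  rewrite SE mulr_sumr.
  apply: (@le_trans _ _ (\sum_(y <- B') (1 - expR (- (c x y * h))) * u y)).
    apply: ler_sum => y _; rewrite mulrA ler_wpM2r //.
    apply: le_trans (expB _ (mulr_ge0 (c_ge0 x y) h_ge0)).
    have cC : c x y <= C.
      apply: le_trans (tot_le x); have := @c_sum x [:: y] isT.
      by rewrite big_seq1.
    have ch : c x y * h <= C * h by rewrite ler_wpM2r.
    have := c_ge0 x y; have := mulr_ge0 (c_ge0 x y) h_ge0 => ch0 ?.
    by nra.
  rewrite /B' big_filter.
  rewrite -[leRHS]big_filter -[leLHS]big_filter.
  rewrite [leRHS](bigID [in sites T r]) /= -[X in X <= _]addr0 lerD //.
    rewrite -[leRHS]big_filter le_eqVlt; apply/orP; left; apply/eqP.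
    apply: perm_big; apply: uniq_perm; rewrite ?filter_uniq ?uniq_sites //.
    move=> y; rewrite !mem_filter.
    by have [yr|yr] := boolP (y \in sites T r);
      rewrite ?(sub_sites rm yr) ?andbT ?andbF /= ?andbT.
  apply: sumr_ge0 => y _; rewrite mulr_ge0 // subr_ge0 -expR0 ler_expR oppr_le0.
  by rewrite mulr_ge0.
have kE : \sum_(y <- sites T r) (1 - expR (- (tot x * h))) * (c x y / tot x) * u y
   <= h * (c x x * u x + A).
  have -> : h * (c x x * u x + A) = \sum_(y <- sites T r) h * (c x y * u y).
    rewrite -mulr_sumr; congr (_ * _); rewrite (bigD1_seq x) ?uniq_sites //=.
    by rewrite /A /B' big_filter.
  apply: ler_sum => y _.
  have -> : (1 - expR (- (tot x * h))) * (c x y / tot x) * u y =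
            (1 - expR (- (tot x * h))) / tot x * (c x y * u y).
    by rewrite -!mulrA; congr (_ * _); rewrite !mulrA [_^-1 * _]mulrC.
  rewrite ler_wpM2r ?mulr_ge0 // ler_pdivrMr // lerBlDr addrC -lerBlDr mulrC.
  exact: expR_ge1Dx.
apply: le_trans (lerD (lexx _) kE) _.
set P := expR (- (q * h)) in low; set Q := expR (- (C * h)) in low.
have PQ : 1 - 2 * (C * h) <= P * Q.
  rewrite /P /Q -expRD; apply: le_trans (expR_ge1Dx _) _.
  by rewrite ler_expR; have := ler_wpM2r h_ge0 qC; nra.
have PQ0 : 0 <= P * Q by rewrite mulr_ge0 ?expR_ge0.
have Pge : expR (- (tot x * h)) + c x x * h - C ^+ 2 * h ^+ 2 <= P.
  have h1 : expR (- (tot x * h)) * (1 + c x x * h) <= P.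
    apply: (@le_trans _ _ (expR (- (tot x * h)) * expR (c x x * h))).
      by rewrite ler_wpM2l ?expR_ge0 // expR_ge1Dx.
    rewrite -expRD /P ler_expR; have := ler_wpM2r h_ge0 qx; nra.
  have h2 := expR_ge1Dx (- (tot x * h)).
  have cT : c x x <= tot x by rewrite (le_trans _ qx) // lerDr.
  have cxh : 0 <= c x x * h by rewrite mulr_ge0.
  have h3 : c x x * h * (tot x * h) <= C ^+ 2 * h ^+ 2.
    rewrite -exprMn expr2 ler_pM ?mulr_ge0 ?(ltW (tot_gt0 x)) //.
      by rewrite ler_wpM2r // (le_trans cT).
    by rewrite ler_wpM2r.
  by nra.
have S0 : 0 <= S.
  rewrite SE sumr_ge0 // => y _; rewrite mulr_ge0 // subr_ge0 -expR0 ler_expR oppr_le0.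
  by rewrite mulr_ge0.
have hA0 : 0 <= h * A by rewrite mulr_ge0.
have Ch0 : 0 <= C * h by rewrite mulr_ge0.
have PQS : h * A - 3 * (C ^+ 2 * h ^+ 2) <= P * Q * S.
  have hAC : h * A <= C * h by rewrite mulrC ler_wpM2r.
  have hh : 0 <= C * h * (C * h) * (h * A) by rewrite !mulr_ge0.
  apply: (@le_trans _ _ ((1 - 3 * (C * h)) * (h * A))).
    have := ler_wpM2l Ch0 hAC; rewrite -exprMn expr2.
    by move: (C * h) (h * A) => X Y; lra.
  (* For [C h > 1] the left side is not positive; otherwise [1 - C h] is a nonnegative factor. *)
  have [hC|hC] := leP (C * h) 1; last first.
    by apply: (@le_trans _ _ 0); [nra|rewrite mulr_ge0].
  apply: (@le_trans _ _ ((1 - 2 * (C * h)) * ((1 - C * h) * (h * A)))).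
    by move: (C * h) (h * A) hh => X Y hh; lra.
  apply: (@le_trans _ _ (P * Q * ((1 - C * h) * (h * A)))).
    by rewrite ler_wpM2r // mulr_ge0 // subr_ge0.
  by rewrite ler_wpM2l // mulrCA mulrA.
have Pu := ler_wpM2r (u0 x) Pge.
have err_u : C ^+ 2 * h ^+ 2 * u x <= C ^+ 2 * h ^+ 2.
  by rewrite ler_piMr // mulr_ge0 ?sqr_ge0.
rewrite mulrDr mulrA in low.
lra.
Qed.

End CellOperator.

(** * Errors accumulated over many cells *)

Section Iteration.
Variables (R : realType) (T : countType) (c : T -> T -> R) (tot : T -> R) (C h : R).
Variable o : T.
Implicit Types (u v : T -> R) (x y : T) (e : T * T) (l : seq (T * T)) (m r M k n : nat).
Hypothesis c_ge0 : forall x y, 0 <= c x y.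
Hypothesis c_sym : forall x y, c x y = c y x.
Hypothesis tot_gt0 : forall x, 0 < tot x.
Hypothesis tot_le : forall x, tot x <= C.
Hypothesis c_sum : forall x s, uniq s -> \sum_(y <- s) c x y <= tot x.
Hypothesis h_ge0 : 0 <= h.

Local Notation cell m := (cell_op c h (pairs T m)).
Local Notation killed r := (killed_op c tot h (sites T r)).

(** Swaps carry the index of their cell, so that each of them has its own random bit. *)
Definition cell_prog m M k : seq (option (nat * (T * T))) :=
  [seq Some (j, e) | j <- iota (k * M) M, e <- pairs T m].

Fixpoint inspect_prog m M k n :=
  None :: if n is n'.+1 then cell_prog m M k ++ inspect_prog m M k.+1 n' else [::].

Definition round_density m M u := iter M (cell m) (kill_density o u).

Local Notation bound := (avoid_bound o (@snd nat (T * T)) (fun i => ring_prob c h i.2)).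

Lemma avoid_bound_swaps (eps : R) (l : seq (nat * (T * T))) p u :
  bound eps (map Some l ++ p) u = bound eps p (cell_op c h (map snd l) u).
Proof. by elim: l u => //= i l IH u; rewrite IH. Qed.

Lemma avoid_bound_inspect (eps : R) m M k n u :
  bound eps (inspect_prog m M k n) u =
  \prod_(i < n.+1) (1 - (1 - eps) * iter i (round_density m M) u o).
Proof.
elim: n k u => [|n IH] k u; first by rewrite /= big_ord_recl big_ord0.
rewrite [LHS]/= big_ord_recl; congr (_ * _).
have -> : cell_prog m M k =
   map Some [seq (j, e) | j <- iota (k * M) M, e <- pairs T m].
  by rewrite /cell_prog map_allpairs.
rewrite avoid_bound_swaps IH; apply: eq_bigr => i _.
rewrite lift0 iterSr /round_density; congr (1 - (1 - eps) * iter i _ _ o).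
elim: M {IH} (k * M)%N (kill_density o u) => //= M IHM a v.
rewrite map_cat /cell_op foldl_cat -/(cell_op _ _ _ _) -/(cell_op _ _ _ _).
rewrite -[RHS]/(iter M.+1 (cell m) v) iterSr -(IHM a.+1) /cell_op; congr foldl; congr foldl.
by rewrite -map_comp map_id_in.
Qed.

Lemma cell_op_scale l q u : cell_op c h l (fun x => q * u x) =
  fun x => q * cell_op c h l u x.
Proof.
elim: l u => //= e l IH u; rewrite -IH; congr foldl; apply/funext => x.
by rewrite /mix_density; ring.
Qed.

Lemma round_density_scale m M q u :
  round_density m M (fun x => q * u x) = fun x => q * round_density m M u x.
Proof.
rewrite /round_density.
have -> : kill_density o (fun x => q * u x) = fun x => q * kill_density o u x.
  by apply/funext => x; rewrite /kill_density; case: eqP; rewrite ?mulr0.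
by elim: M => //= M ->; rewrite cell_op_scale.
Qed.

Lemma killed_op_ge0 r u : (forall x, 0 <= u x) -> forall x, 0 <= killed r u x.
Proof.
move=> u0 x; rewrite /killed_op; case: ifP => // _.
rewrite addr_ge0 ?mulr_ge0 ?expR_ge0 // sumr_ge0 // => y _.
rewrite !mulr_ge0 ?invr_ge0 ?(ltW (tot_gt0 x)) //.
by rewrite subr_ge0 -expR0 ler_expR oppr_le0 mulr_ge0 // ltW.
Qed.

Lemma rho01 x : 0 <= 1 - expR (- (tot x * h)) <= 1.
Proof.
by rewrite subr_ge0 gerBl expR_ge0 andbT -expR0 ler_expR oppr_le0 mulr_ge0 // ltW.
Qed.

(** The operator is monotone with total mass at most 1, so a constant error is not amplified. *)
Lemma killed_op_le_shift r u v a : 0 <= a ->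
  (forall x, u x <= v x + a) -> forall x, killed r u x <= killed r v x + a.
Proof.
move=> a0 uv x; rewrite /killed_op; case: ifP => [xr|_]; last by rewrite add0r.
have /andP[r0 r1] := rho01 x; set rho := expR _ in r0 r1 *.
have rho0 : 0 <= rho by exact: expR_ge0.
have w0 y : 0 <= (1 - rho) * (c x y / tot x).
  by rewrite !mulr_ge0 // invr_ge0 ltW.
have h1 : rho * u x <= rho * v x + rho * a by rewrite -mulrDr ler_wpM2l.
have h2 : \sum_(y <- sites T r) (1 - rho) * (c x y / tot x) * u y <=
  \sum_(y <- sites T r) (1 - rho) * (c x y / tot x) * v y + (1 - rho) * a.
  apply: (@le_trans _ _ (\sum_(y <- sites T r) (1 - rho) * (c x y / tot x) * v y +
     \sum_(y <- sites T r) (1 - rho) * (c x y / tot x) * a)).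
    by rewrite -big_split /=; apply: ler_sum => y _; rewrite -mulrDr ler_wpM2l.
  rewrite lerD2l -mulr_suml ler_wpM2r // -mulr_sumr ler_piMr //.
  by rewrite -mulr_suml ler_pdivrMr // mul1r c_sum // uniq_sites.
lra.
Qed.

Lemma killed_op_le1 r u : (forall x, u x <= 1) -> forall x, killed r u x <= 1.
Proof.
move=> u1 x.
have -> : 1 = killed r (fun=> 0) x + 1.
  rewrite /killed_op mulr0 big1 => [|? _]; last by rewrite mulr0.
  by rewrite addr0 if_same add0r.
by apply: killed_op_le_shift => // y; rewrite add0r.
Qed.

(** The gain is at most the probability of a jump, hence at most [C h]. This pays for the [m] extra
    steps granted to the delayed walk. *)
Lemma killed_op_le_id r u x : (forall x, u x <= 1) -> 0 <= u x ->
  killed r u x <= u x + C * h.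
Proof.
move=> u1 u0.
have C0 : 0 <= C by rewrite (le_trans _ (tot_le x)) // ltW.
rewrite /killed_op; case: ifP => [xr|_]; last by rewrite addr_ge0 ?mulr_ge0.
have /andP[r0 r1] := rho01 x; set rho := expR _ in r0 r1 *.
have h1 : \sum_(y <- sites T r) (1 - rho) * (c x y / tot x) * u y <= C * h.
  apply: (@le_trans _ _ (1 - rho)).
    apply: (@le_trans _ _ (\sum_(y <- sites T r) (1 - rho) * (c x y / tot x))).
      apply: ler_sum => y _; rewrite ler_piMr // !mulr_ge0 // invr_ge0 ltW //.
    rewrite -mulr_sumr ler_piMr //.
    by rewrite -mulr_suml ler_pdivrMr // mul1r c_sum // uniq_sites.
  have := expR_ge1Dx (- (tot x * h)); rewrite -/rho.
  have : tot x * h <= C * h by rewrite ler_wpM2r.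
  lra.
rewrite lerD // ler_piMl //; lra.
Qed.

Definition killed_round r M u := iter M (killed r) (kill_density o u).

Definition on_sites (s : seq T) x : R := (x \in s)%:R.

Lemma on_sites01 s x : 0 <= on_sites s x <= 1.
Proof. by rewrite /on_sites; case: (_ \in _); rewrite lexx ler01. Qed.

Lemma kill_density01 u : (forall x, 0 <= u x <= 1) ->
  forall x, 0 <= kill_density o u x <= 1.
Proof. by move=> u01 x; rewrite /kill_density; case: eqP; rewrite ?lexx ?ler01. Qed.

Lemma iter_killed01 r M u : (forall x, 0 <= u x <= 1) ->
  forall x, 0 <= iter M (killed r) u x <= 1.
Proof.
move=> u01; elim: M => //= M IH x; apply/andP; split.
  by apply: killed_op_ge0 => y; case/andP: (IH y).
by apply: killed_op_le1 => y; case/andP: (IH y).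
Qed.

Lemma iter_cell01 m M v : (forall x, 0 <= v x <= 1) ->
  forall x, 0 <= iter M (cell m) v x <= 1.
Proof. by move=> v01; elim: M => //= M IH; exact: cell_op_01. Qed.

Lemma iter_killed_le r m M u v a : (r <= m)%N -> 0 <= a ->
  (forall x, 0 <= v x <= 1) -> (forall x, u x <= v x + a) ->
  forall x, iter M (killed r) u x <=
    iter M (cell m) v x + (a + M%:R * (4 * C ^+ 2 * h ^+ 2)).
Proof.
move=> rm a0 v01 uv; have k0 : 0 <= 4 * C ^+ 2 * h ^+ 2.
  by rewrite -mulrA mulr_ge0 // -exprMn sqr_ge0.
elim: M => [|M IH] x; first by rewrite mul0r addr0.
have i01 := iter_cell01 m M v01.
rewrite !iterS; apply: le_trans (killed_op_le_shift r _ IH x) _.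
  by rewrite addr_ge0 // mulr_ge0.
have := killed_op_le_cell_op c_ge0 c_sym tot_gt0 tot_le c_sum h_ge0 x rm i01.
rewrite -[M.+1]addn1 natrD; lra.
Qed.

(** For [M = m^2] and [h = m^-2] the error is [4 i C^2 / m^2]. *)
Lemma killed_round_le r m M i : (r <= m)%N -> forall x,
  iter i (killed_round r M) (on_sites (sites T r)) x <=
  iter i (round_density m M) (on_sites (sites T m)) x +
    i%:R * (M%:R * (4 * C ^+ 2 * h ^+ 2)).
Proof.
move=> rm; have k0 : 0 <= 4 * C ^+ 2 * h ^+ 2 by rewrite -mulrA mulr_ge0 // -exprMn sqr_ge0.
elim: i => [|i IH] x.
  rewrite mul0r addr0 /= /on_sites ler_nat.
  by case xr : (x \in sites T r); rewrite ?(sub_sites rm xr).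
rewrite !iterS {1}/killed_round {1}/round_density.
have i01 y : 0 <= iter i (round_density m M) (on_sites (sites T m)) y <= 1.
  elim: i {IH} y => [|i IHi] y; first exact: on_sites01.
  exact: iter_cell01 (kill_density01 IHi) y.
set a := i%:R * _ in IH *.
have a0 : 0 <= a by rewrite mulr_ge0 // mulr_ge0.
apply: le_trans (iter_killed_le M rm a0 (kill_density01 i01) _ x) _.
  by move=> y; rewrite /kill_density; case: eqP => // _; rewrite add0r.
by rewrite /a -[i.+1]addn1 natrD; lra.
Qed.

Lemma iter_killed_le_id r m u x : (forall x, 0 <= u x <= 1) ->
  iter m (killed r) u x <= u x + m%:R * (C * h).
Proof.
move=> u01; elim: m => [|m IH]; first by rewrite mul0r addr0.
have i01 := iter_killed01 r m u01.
rewrite iterS; apply: le_trans (killed_op_le_id r _ _) _.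
- by move=> y; case/andP: (i01 y).
- by case/andP: (i01 x).
by rewrite -[m.+1]addn1 natrD; lra.
Qed.

End Iteration.

(** * Jump chain and holding times *)

Section CountableFibers.
Context {R : realType} {disp : measure_display} {Omega : measurableType disp}.
Variable P : probability Omega R.

Lemma measurable_countable_fiber (K : countType) (Z : Omega -> K) (A : set K) :
  (forall k, measurable [set w | Z w = k]) -> measurable [set w | A (Z w)].
Proof.
move=> mZ.
have -> : [set w | A (Z w)] = \bigcup_k [set w | A k /\ Z w = k].
  by apply/seteqP; split => [w Aw|w [k _ /= [Ak ->]]] //; exists (Z w).
apply: countable_bigcupT_measurable => [|k]; first exact: countableP.
have [Ak|Ak] := pselect (A k).
  by rewrite (_ : [set w | _] = [set w | Z w = k]) //; apply/seteqP; split => w /=; tauto.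
by rewrite (_ : [set w | _] = set0) //; apply/seteqP; split => w //= -[].
Qed.

(** Replaces conditioning on a countably valued variable: an inequality on each fibre is summed over
    the fibres. *)
Lemma le_measure_countable_fibers (K : countType) (Z : Omega -> K)
    (D D' : set Omega) (t : R) :
  (forall k, measurable [set w | Z w = k]) -> measurable D -> measurable D' ->
  0 <= t ->
  (forall k, (P (D `&` [set w | Z w = k]) <= t%:E * P (D' `&` [set w | Z w = k]))%E) ->
  (P D <= t%:E * P D')%E.
Proof.
move=> mZ mD mD' t0 H.
pose F (E : set Omega) n := E `&` [set w | choice.pickle (Z w) = n].
have mF E n : measurable E -> measurable (F E n).
  move=> mE; apply: measurableI => //.
  exact: (@measurable_countable_fiber _ _ [set k | choice.pickle k = n]).
have FE E : \bigcup_n F E n = E.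
  by apply/seteqP; split => [w [n _ []]//|w Ew]; exists (choice.pickle (Z w)).
have tF E : trivIset setT (F E).
  by apply/trivIsetP => i j _ _ ij; apply/seteqP; split => // w [[_ /= wi] [_ /= wj]];
    move: ij; rewrite -wi wj eqxx.
have SE E : measurable E -> P E = (\sum_(0 <= n <oo) P (F E n))%E.
  move=> mE; rewrite -{1}(FE E) measure_bigcup //.
    by apply: eq_eseriesl => i /=; rewrite ?in_setT.
  by move=> i _; exact: mF.
rewrite (SE D) // (SE D') // -nneseriesZl //.
apply: lee_nneseries => // n _.
case E : (@pickle_inv K n) => [k|].
  have nE : n = choice.pickle k by have := @pickle_invK K n; rewrite E /= => <-.
  have FK (G : set Omega) : F G n = G `&` [set w | Z w = k].
    rewrite nE; congr (_ `&` _); apply/seteqP; split => w /=; last by move=> ->.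
    exact: (pcan_inj choice.pickleK).
  by rewrite !FK.
have F0 : F D n = set0.
  apply/seteqP; split => // w [_ /= wn].
  by move: E; rewrite -wn pickleK_inv.
by rewrite F0 measure0 mule_ge0.
Qed.

Lemma probability_setD (A B : set Omega) : measurable A -> measurable B ->
  P (A `\` B) = (P A - P (A `&` B))%E.
Proof.
by move=> mA mB; rewrite measureD //= -ge0_fin_numE ?fin_num_measure.
Qed.

Lemma measure_bigsetU_le (K : Type) (s : seq K) (F : K -> set Omega) :
  (forall k, measurable (F k)) ->
  (P (\big[setU/set0]_(k <- s) F k) <= \sum_(k <- s) P (F k))%E.
Proof.
move=> mF; elim: s => [|k s IH]; first by rewrite !big_nil measure0.
rewrite !big_cons; apply: le_trans (leeD2l _ IH).
by apply: measureU2 => //; exact: bigsetU_measurable.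
Qed.

End CountableFibers.

(** The law required by [random_walk], over an abstract countable state space. It speaks only of
    lower bounds [s i < H i]; everything else about holding times must be derived from them. *)
Definition jump_chain_law {R : realType} {T : countType} {disp : measure_display}
    {Omega : measurableType disp} (P : probability Omega R) (o : T) (c : T -> T -> R)
    (tot : T -> R) (Y : nat -> Omega -> T) (H : nat -> Omega -> R) :=
  forall (k : nat) (y : nat -> T) (s : nat -> R),
    (forall i, 0 <= s i) ->
    P [set w | forall i, (i <= k)%N -> Y i w = y i /\ s i < H i w] =
    ((y 0%N == o)%:R * (\prod_(i < k) (c (y i) (y i.+1) / tot (y i))) *
     \prod_(i < k.+1) expR (- (tot (y i) * s i)))%:E.

Section JumpPatterns.
Context {R : realType} {T : countType} {disp : measure_display}
  {Omega : measurableType disp}.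
Variables (P : probability Omega R) (o : T) (c : T -> T -> R) (tot : T -> R).
Variables (Y : nat -> Omega -> T) (H : nat -> Omega -> R).
Hypothesis c_ge0 : forall x y, 0 <= c x y.
Hypothesis tot_gt0 : forall x, 0 < tot x.
Hypothesis mY : forall i x, measurable [set w | Y i w = x].
Hypothesis mH : forall i, measurable_fun setT (H i).
Hypothesis law : jump_chain_law P o c tot Y H.
Implicit Types (y : nat -> T) (a b : nat -> R) (S : pred nat).

Definition pattern k y a b S : set Omega := [set w | forall i, (i <= k)%N ->
  [/\ Y i w = y i, a i < H i w & S i -> H i w <= b i]].

Definition path_weight k y : R :=
  (y 0%N == o)%:R * \prod_(i < k) (c (y i) (y i.+1) / tot (y i)).

Lemma path_weight_ge0 k y : 0 <= path_weight k y.
Proof.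
rewrite mulr_ge0 ?ler0n // prodr_ge0 // => i _.
by rewrite mulr_ge0 // invr_ge0 ltW.
Qed.

Lemma measurable_hold_gt i (a : R) : measurable [set w | a < H i w].
Proof.
have -> : [set w | a < H i w] = H i @^-1` `]a, +oo[.
  by apply/seteqP; split => w /=; rewrite in_itv /= andbT.
by rewrite -[X in measurable X]setTI; apply: mH.
Qed.

Lemma measurable_hold_le i (a : R) : measurable [set w | H i w <= a].
Proof.
have -> : [set w | H i w <= a] = ~` [set w | a < H i w].
  by apply/seteqP; split => w /=; rewrite leNgt => /negP.
by apply: measurableC; exact: measurable_hold_gt.
Qed.

Lemma measurable_pattern k y a b S : measurable (pattern k y a b S).
Proof.
have -> : pattern k y a b S = \bigcap_(i in [set i | (i <= k)%N])
   ([set w | Y i w = y i] `&` [set w | a i < H i w] `&`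
    [set w | S i -> H i w <= b i]).
  by apply/seteqP; split => [w pw i ik|w pw i ik];
     [have [] := pw _ ik|have [[]] := pw _ ik].
apply: bigcap_measurable => [|i _]; first by exists 0%N.
apply: measurableI; first apply: measurableI => //.
  exact: measurable_hold_gt.
case: (S i); last first.
  by rewrite (_ : [set _ | _] = setT) //; apply/seteqP; split.
rewrite (_ : [set w | _] = [set w | H i w <= b i]); first exact: measurable_hold_le.
by apply/seteqP; split => w /=; auto.
Qed.

(** An upper bound on one holding time is a difference of two lower bounds, [a < H] without [b < H];
    the indices of [S] are treated one at a time. *)
Lemma pattern_prob k y a b S : (forall i, 0 <= a i <= b i) ->
  P (pattern k y a b S) = (path_weight k y * \prod_(i < k.+1)
    (expR (- (tot (y i) * a i)) - if S i then expR (- (tot (y i) * b i)) else 0))%:E.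
Proof.
move=> ab; pose Sr r i := S i && (i < r)%N.
suff HS r : forall a, (forall i, 0 <= a i <= b i) -> P (pattern k y a b (Sr r)) =
   (path_weight k y * \prod_(i < k.+1)
    (expR (- (tot (y i) * a i)) - if Sr r i then expR (- (tot (y i) * b i)) else 0))%:E.
  have -> : pattern k y a b S = pattern k y a b (Sr k.+1).
    apply/seteqP; split => w pw i ik; have [h1 h2 h3] := pw i ik; split => //.
      by move=> /andP[/h3].
    by move=> Si; apply: h3; rewrite /Sr Si ltnS.
  rewrite HS //; congr (_ * _)%:E; apply: eq_bigr => i _.
  by rewrite /Sr ltn_ord andbT.
elim: r => [|r IH] {}a {}ab.
  have -> : pattern k y a b (Sr 0%N) =
      [set w | forall i, (i <= k)%N -> Y i w = y i /\ a i < H i w].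
    apply/seteqP; split => w pw i ik; first by have [] := pw i ik.
    by have [] := pw i ik; split => //; rewrite /Sr andbF.
  rewrite law; last by move=> i; case/andP: (ab i).
  congr (_ * _)%:E; apply: eq_bigr => i _.
  by rewrite /Sr ltn0 andbF subr0.
have [/andP[Sir rk]|Sir] := boolP (S r && (r <= k)%N); last first.
  have -> : pattern k y a b (Sr r.+1) = pattern k y a b (Sr r).
    apply/seteqP; split => w pw i ik; have [h1 h2 h3] := pw i ik; split => //.
      by rewrite /Sr => /andP[Si ir]; apply: h3; rewrite /Sr Si ltnW.
    rewrite /Sr ltnS leq_eqVlt => /andP[Si /orP[/eqP ir|ir]].
      by move: Sir; rewrite -ir Si ik.
    by apply: h3; rewrite /Sr Si.
  rewrite IH //; congr (_ * _)%:E; apply: eq_bigr => i _; congr (_ - _).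
  have [ir|ir] := eqVneq (i : nat) r.
    by move: Sir; rewrite /Sr -ir -ltnS ltn_ord andbT => /negbTE ->.
  by rewrite /Sr ltnS [(i <= r)%N]leq_eqVlt (negbTE ir).
(* The pattern to subtract has the lower bound at [r] raised to [b r]. *)
pose a' := upd a r (b r).
have ab' i : 0 <= a' i <= b i.
  rewrite /a' /upd; case: eqP => [->|_] //.
  by have /andP[h1 h2] := ab r; rewrite lexx (le_trans h1).
have a'r : a' r = b r by rewrite /a' /upd eqxx.
have a'i i : i != r -> a' i = a i by rewrite /a' /upd => /negbTE ->.
have sub : pattern k y a' b (Sr r) `<=` pattern k y a b (Sr r).
  move=> w pw i ik; have [h1 h2 h3] := pw i ik; split => //.
  have [ir|ir] := eqVneq i r; last by rewrite -a'i.
  by move: h2; rewrite ir a'r; apply: le_lt_trans; case/andP: (ab r).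
have -> : pattern k y a b (Sr r.+1) = pattern k y a b (Sr r) `\` pattern k y a' b (Sr r).
  apply/seteqP; split => w.
    move=> pw; split.
      move=> i ik; have [h1 h2 h3] := pw i ik; split => //.
      by rewrite /Sr => /andP[Si ir]; apply: h3; rewrite /Sr Si ltnW.
    move=> /(_ r rk)[_ + _]; have [_ _] := pw r rk.
    by rewrite /Sr Sir ltnSn a'r => /(_ isT); rewrite leNgt => /negP.
  move=> [pw pw'] i ik; have [h1 h2 h3] := pw i ik; split => //.
  rewrite /Sr ltnS leq_eqVlt => /andP[Si /orP[/eqP ir|ir]]; last first.
    by apply: h3; rewrite /Sr Si.
  rewrite leNgt; apply/negP => bH; apply: pw' => j jk; have [g1 g2 g3] := pw j jk.
  by split => //; have [->|jr] := eqVneq j r; rewrite ?a'r -?ir // a'i.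
rewrite measureD /=; [|exact: measurable_pattern|exact: measurable_pattern|].
  rewrite (setIidr sub) !IH // -EFinB -mulrBr; congr (_ * _)%:E.
  have D (f : nat -> R) : \prod_(i < k.+1) f i =
      f r * \prod_(i < k.+1 | i != inord r) f i.
    by rewrite (bigD1 (inord r)) //= inordK.
  pose phi a0 (Q : pred nat) i :=
    expR (- (tot (y i) * a0 i)) - if Q i then expR (- (tot (y i) * b i)) else 0.
  have E a0 (Q : pred nat) : \prod_(i < k.+1) (expR (- (tot (y i) * a0 i)) -
      if Q i then expR (- (tot (y i) * b i)) else 0) =
      phi a0 Q r * \prod_(i < k.+1 | i != inord r) phi a0 Q i by exact: (D (phi a0 Q)).
  rewrite (E a (Sr r)) (E a' (Sr r)) (E a (Sr r.+1)) {1}/phi {2}/phi {3}/phi a'r.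
  have -> : Sr r r = false by rewrite /Sr ltnn andbF.
  have -> : Sr r.+1 r by rewrite /Sr ltnSn Sir.
  rewrite !subr0.
  set A := \prod_(_ < _ | _) _; set A' := \prod_(_ < _ | _) _; set B := \prod_(_ < _ | _) _.
  have rE (i : 'I_k.+1) : i != inord r -> (i : nat) != r.
    by apply: contraNneq => <-; rewrite inord_val.
  have -> : A' = A.
    by apply: eq_bigr => i /rE ir; rewrite /phi a'i.
  have -> : B = A.
    apply: eq_bigr => i /rE ir; rewrite /phi; congr (_ - _).
    by rewrite /Sr ltnS [(i <= r)%N]leq_eqVlt (negbTE ir).
  by rewrite mulrBl.
by rewrite -ge0_fin_numE ?fin_num_measure //; exact: measurable_pattern.
Qed.

End JumpPatterns.

(** * Non-explosion *)

Section HoldingTimes.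
Context {R : realType} {T : countType} {disp : measure_display}
  {Omega : measurableType disp}.
Variables (P : probability Omega R) (o : T) (c : T -> T -> R) (tot : T -> R) (C : R).
Variables (Y : nat -> Omega -> T) (H : nat -> Omega -> R).
Hypothesis c_ge0 : forall x y, 0 <= c x y.
Hypothesis tot_gt0 : forall x, 0 < tot x.
Hypothesis tot_le : forall x, tot x <= C.
Hypothesis c_approx : forall x e, 0 < e ->
  exists2 s, uniq s & tot x - e < \sum_(y <- s) c x y.
Hypothesis mY : forall i x, measurable [set w | Y i w = x].
Hypothesis mH : forall i, measurable_fun setT (H i).
Hypothesis law : jump_chain_law P o c tot Y H.
Implicit Types (y : nat -> T) (S : pred nat).

Local Notation pattern := (pattern Y H).
Local Notation path_weight := (path_weight o c tot).

Definition visited k w : seq T := [seq Y i w | i <- iota 0 k.+1].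

Lemma visited_eq k (s : seq T) :
  [set w | visited k w = s] = set0 \/
  exists y, [set w | visited k w = s] = [set w | forall i, (i <= k)%N -> Y i w = y i].
Proof.
have [sk|sk] := eqVneq (size s) k.+1; last first.
  left; apply/seteqP; split => // w /= E; move: sk.
  by rewrite -E size_map size_iota eqxx.
right; exists (nth o s); apply/seteqP; split => w /=.
  move=> <- i ik; rewrite (nth_map 0%N) ?size_iota // nth_iota // add0n //.
move=> Yw; apply: (@eq_from_nth _ o); first by rewrite size_map size_iota.
move=> i; rewrite size_map size_iota => ik.
by rewrite (nth_map 0%N) ?size_iota // nth_iota // add0n Yw.
Qed.

Lemma measurable_path k y : measurable [set w | forall i, (i <= k)%N -> Y i w = y i].
Proof.
rewrite (_ : [set _ | _] = \bigcap_(i in [set i | (i <= k)%N]) [set w | Y i w = y i]).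
  by apply: bigcap_measurable => [|i _]; [exists 0%N|exact: mY].
by apply/seteqP; split.
Qed.

Lemma measurable_visited k s : measurable [set w | visited k w = s].
Proof.
by case: (visited_eq k s) => [->|[y ->]]; [exact: measurable0|exact: measurable_path].
Qed.

Definition hold_within k S (b : R) : set Omega :=
  [set w | forall i, (i <= k)%N -> 0 < H i w /\ (S i -> H i w <= b)].

Lemma hold_within_path k S b y :
  hold_within k S b `&` [set w | forall i, (i <= k)%N -> Y i w = y i] =
  pattern k y (fun=> 0) (fun=> b) S.
Proof.
apply/seteqP; split => [w [hw yw] i ik|w pw].
  by have [h1 h2] := hw i ik; split => //; exact: yw.
by split => i ik; have [h1 h2 h3] := pw i ik.
Qed.

Lemma measurable_hold_within k S b : measurable (hold_within k S b).
Proof.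
rewrite (_ : hold_within k S b = \bigcap_(i in [set i | (i <= k)%N])
   ([set w | 0 < H i w] `&` [set w | S i -> H i w <= b])).
  apply: bigcap_measurable => [|i _]; first by exists 0%N.
  apply: measurableI; first exact: measurable_hold_gt.
  case: (S i); last by rewrite (_ : [set _ | _] = setT) //; apply/seteqP; split.
  rewrite (_ : [set w | _] = [set w | H i w <= b]); first exact: measurable_hold_le.
  by apply/seteqP; split => w /=; auto.
by apply/seteqP; split => w hw i ik; have [] := hw i ik.
Qed.

Lemma prod_sub0 k y :
  \prod_(i < k.+1) (expR (- (tot (y i) * 0)) - 0) = 1.
Proof. by rewrite big1 // => i _; rewrite mulr0 subr0 oppr0 expR0. Qed.

Lemma pattern0_prob k y b :
  P (pattern k y (fun=> 0) b pred0) = (path_weight k y)%:E.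
Proof.
have -> : pattern k y (fun=> 0) b pred0 = pattern k y (fun=> 0) (fun=> 0) pred0.
  by apply/seteqP; split => w pw i ik; have [h1 h2 h3] := pw i ik.
rewrite (pattern_prob mY mH law) //=; last by move=> i; rewrite lexx.
by rewrite prod_sub0 mulr1.
Qed.

(** Prescribing the next site and a positive next holding time gives probability [path_weight k.+1].
    Since the kernel sums to 1, these weights add up to [path_weight k], so nothing is left for
    [H k.+1 <= 0]. *)
Lemma hold_gt0_step k :
  P (hold_within k pred0 0 `&` [set w | H k.+1 w <= 0]) = 0%E.
Proof.
apply/eqP; rewrite eq_le measure_ge0 andbT.
have m1 := measurable_hold_within k pred0 0; have m2 := measurable_hold_le mH k.+1 0.
have m12 := measurableI _ _ m1 m2.
rewrite -(mul0e (P setT)).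
apply: (le_measure_countable_fibers (Z := visited k)) => //.
  exact: measurable_visited.
move=> s; rewrite mul0e; case: (visited_eq k s) => [->|[y ->]].
  by rewrite setI0 measure0.
rewrite setIAC hold_within_path.
set A := pattern k y _ _ _.
have mA : measurable A by exact: measurable_pattern.
have PA : P A = (path_weight k y)%:E by exact: pattern0_prob.
set G := [set w | 0 < H k.+1 w]; have mG : measurable G by exact: measurable_hold_gt.
have -> : A `&` [set w | H k.+1 w <= 0] = A `\` G.
  by apply/seteqP; split => w [Aw h]; split => //; move: h; rewrite /G /= leNgt => /negP.
apply/lee_addgt0Pr => e e0; rewrite add0e.
have w0 := path_weight_ge0 o c_ge0 tot_gt0 k y.
set pw := path_weight k y in PA w0.
(* The tolerance is [e * tot (y k) / (pw + 1)]: after multiplication by [pw / tot (y k)] it is at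
   most [e]. *)
have [s' us' hs'] := c_approx (y k) (divr_gt0 (mulr_gt0 e0 (tot_gt0 (y k))) (ltr_pwDr ltr01 w0)).
pose F x := pattern k.+1 (upd y k.+1 x) (fun=> 0) (fun=> 0) pred0.
have FE x : F x = (A `&` G) `&` (Y k.+1 @^-1` [set x]).
  apply/seteqP; split => [w Fw|w [[Aw Gw] Yw] i].
    split; last first.
      by have [] := Fw k.+1 (leqnn _); rewrite /upd eqxx.
    split; last by have [] := Fw k.+1 (leqnn _).
    move=> i ik; have [h1 h2 h3] := Fw i (leqW ik); split => //.
    by rewrite h1 /upd ltn_eqF // ltnS.
  rewrite leq_eqVlt => /orP[/eqP ->|]; first by rewrite /upd eqxx; split.
  by rewrite ltnS => ik; have [h1 h2 h3] := Aw i ik; rewrite /upd ltn_eqF // ltnS.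
have mF x : measurable (F x) by exact: measurable_pattern.
have PF : (P (\bigcup_(x in [set` s']) F x) =
    (pw / tot (y k) * \sum_(x <- s') c (y k) x)%:E)%E.
  rewrite measure_fin_bigcup //.
    rewrite -fsbig_seq // mulr_sumr -sumEFin; apply: eq_bigr => x _.
    transitivity (path_weight k.+1 (upd y k.+1 x))%:E; first exact: pattern0_prob.
    congr _%:E; rewrite /path_weight big_ord_recr /= /pw /path_weight.
    rewrite /upd /= ltn_eqF // eqxx.
    have -> : \prod_(i < k) (c (if (i : nat) == k.+1 then x else y i)
        (if i.+1 == k.+1 then x else y i.+1) / tot (if (i : nat) == k.+1 then x else y i))
        = \prod_(i < k) (c (y i) (y i.+1) / tot (y i)).
      apply: eq_bigr => i _; rewrite eqSS !ltn_eqF //.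
      by rewrite (leq_trans (ltn_ord i)) // leqnSn.
    by rewrite -!mulrA; congr (_ * (_ * _)); rewrite mulrC.
    exact: finite_seq.
  move=> i j _ _; rewrite !FE => -[w [[_ Yi] [_ Yj]]].
  exact: etrans (esym Yi) Yj.
have PU : (P (\bigcup_(x in [set` s']) F x) <= P (A `&` G))%E.
  apply: le_measure; rewrite ?inE.
  - by apply: fin_bigcup_measurable => //; exact: finite_seq.
  - exact: measurableI.
  by move=> w [x _]; rewrite FE => -[].
rewrite probability_setD // PA leeBlDr ?fin_num_measure //; last exact: measurableI.
apply: le_trans (leeD2l _ PU); rewrite PF -EFinD lee_fin.
have tk := tot_gt0 (y k).
have : pw / tot (y k) * (tot (y k) - e * tot (y k) / (pw + 1)) <=
       pw / tot (y k) * \sum_(x <- s') c (y k) x.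
  apply: ler_wpM2l; last exact: ltW.
  by rewrite divr_ge0 // ltW.
have -> : pw / tot (y k) * (tot (y k) - e * tot (y k) / (pw + 1)) =
          pw - e * (pw / (pw + 1)).
  by field; rewrite (gt_eqF tk) gt_eqF // ltr_wpDl.
have : e * (pw / (pw + 1)) <= e.
  by rewrite ler_piMr ?(ltW e0) // ler_pdivrMr ?mul1r; lra.
lra.
Qed.

Lemma hold_gt0_prob k : P (hold_within k pred0 0) = 1%E.
Proof.
elim: k => [|k IH].
  apply/eqP; rewrite eq_le probability_le1 ?andbT; last exact: measurable_hold_within.
  have : P (pattern 0 (fun=> o) (fun=> 0) (fun=> 0) pred0) = 1%E.
    by rewrite pattern0_prob /path_weight big_ord0 mulr1 eqxx.
  move=> <-; apply: le_measure; rewrite ?inE.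
  - exact: measurable_pattern.
  - exact: measurable_hold_within.
  by move=> w pw i ik; have [] := pw i ik.
have m1 := measurable_hold_within k pred0 0; have m2 := measurable_hold_gt mH k.+1 0.
have -> : hold_within k.+1 pred0 0 =
    hold_within k pred0 0 `\` (hold_within k pred0 0 `&` [set w | H k.+1 w <= 0]).
  apply/seteqP; split => w.
    move=> hw; split; first by move=> i ik; exact: hw (leqW ik).
    by move=> [_ /=]; rewrite leNgt; have [->] := hw k.+1 (leqnn _).
  move=> [hw h] i; rewrite leq_eqVlt => /orP[/eqP ->|]; last exact: hw.
  split => //; rewrite ltNge; apply/negP => h'; exact: h.
rewrite probability_setD //.
- by rewrite setIA setIid hold_gt0_step sube0.
- by apply: measurableI => //; exact: measurable_hold_le.
Qed.

Lemma prod_tail (t : R) n r :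
  \prod_(i < n) (if (r <= i)%N then t else 1) = t ^+ (n - r).
Proof.
elim: n => [|n IH]; first by rewrite big_ord0 sub0n.
rewrite big_ord_recr IH /=; case: leqP => rn; first by rewrite subSn // exprSr.
have -> : (n.+1 - r = 0)%N by apply/eqP; rewrite subn_eq0.
rewrite mulr1; congr (t ^+ _).
by apply/eqP; rewrite subn_eq0 ltnW.
Qed.

(** Given the path, each of the [k.+1 - r] holding times is at most 1 with probability at most
    [1 - expR (- C)], as its rate is at most [C]. *)
Lemma hold_within_prob_le k r :
  (P (hold_within k (leq r) 1) <= ((1 - expR (- C)) ^+ (k.+1 - r))%:E)%E.
Proof.
have C0 : 0 <= C by rewrite (le_trans _ (tot_le o)) // ltW.
have t0 : 0 <= 1 - expR (- C) by rewrite subr_ge0 -expR0 ler_expR oppr_le0.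
have -> : ((1 - expR (- C)) ^+ (k.+1 - r))%:E =
  (((1 - expR (- C)) ^+ (k.+1 - r))%:E * P (hold_within k pred0 0))%E.
  by rewrite hold_gt0_prob mule1.
apply: (le_measure_countable_fibers (Z := visited k)).
- exact: measurable_visited.
- exact: measurable_hold_within.
- exact: measurable_hold_within.
- by rewrite exprn_ge0.
move=> s; case: (visited_eq k s) => [->|[y ->]].
  by rewrite !setI0 measure0 mule0.
rewrite !hold_within_path pattern0_prob.
rewrite (pattern_prob mY mH law); last by move=> i; rewrite lexx ler01.
rewrite -EFinM lee_fin mulrC ler_wpM2r ?(path_weight_ge0 o c_ge0 tot_gt0) //.
rewrite -prod_tail; apply: ler_prod => i _.
rewrite mulr0 oppr0 expR0 mulr1; case: ifP => _.
  rewrite subr_ge0 -expR0 ler_expR oppr_le0 ltW //=.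
  by rewrite lerD2l lerN2 ler_expR lerN2.
by rewrite subr0 ler01 lexx.
Qed.

Lemma ae_hold_diverge :
  {ae P, forall w, (forall i, 0 < H i w) /\ forall t, exists k, t < \sum_(i < k) H i w}.
Proof.
(* The bad events: some holding time is not positive ([B1]), or all of them from index [r] on are at
   most 1 ([B2]). Outside them, infinitely many exceed 1. *)
pose B1 k := ~` hold_within k pred0 0.
pose B2 r := \bigcap_k hold_within k (leq r) 1.
have nB1 k : P.-negligible (B1 k).
  exists (B1 k); split => //; first exact/measurableC/measurable_hold_within.
  rewrite /B1 probability_setC; last exact: measurable_hold_within.
  by rewrite hold_gt0_prob subee.
have nB2 r : P.-negligible (B2 r).
  have mB2 : measurable (B2 r).
    by apply: bigcapT_measurable => k; exact: measurable_hold_within.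
  exists (B2 r); split => //; apply/eqP; rewrite eq_le measure_ge0 andbT.
  have C0 : 0 <= C by rewrite (le_trans _ (tot_le o)) // ltW.
  set t := 1 - expR (- C).
  have t0 : 0 <= t by rewrite subr_ge0 -expR0 ler_expR oppr_le0.
  have t1 : t < 1 by rewrite gtrBl expR_gt0.
  have Pt n : (P (B2 r) <= (t ^+ n)%:E)%E.
    have := hold_within_prob_le (n + r) r.
    have -> : ((n + r).+1 - r = n.+1)%N by rewrite -addSn addnK.
    move=> h; apply: (@le_trans _ _ (t ^+ n.+1)%:E); last first.
      by rewrite lee_fin exprS ler_piMl ?exprn_ge0 // ltW.
    apply: le_trans h; apply: le_measure; rewrite ?inE //.
      exact: measurable_hold_within.
    by move=> w; apply.
  have fB : P (B2 r) \is a fin_num by exact: fin_num_measure.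
  rewrite -(fineK fB) lee_fin leNgt; apply/negP => p0.
  have := @cvg_expr R t; rewrite ger0_norm // => /(_ t1) /cvgr0Pnorm_lt /(_ _ p0).
  move=> [n _ /(_ n (leqnn n))] /=; rewrite ger0_norm ?exprn_ge0 //.
  by rewrite ltNge -lee_fin fineK // Pt.
have : P.-negligible (\bigcup_k B1 k `|` \bigcup_r B2 r).
  by apply: negligibleU; apply: negligible_bigcup.
apply: negligibleS => w /= nw; apply: contrapT => /not_orP[h1 h2]; apply: nw.
have H0 i : 0 < H i w.
  have : hold_within i pred0 0 w by apply: contrapT => h; apply: h1; exists i.
  by move=> /(_ i (leqnn i))[].
split => // t.
have big r : exists2 i, (r <= i)%N & 1 < H i w.
  apply: contrapT => h; apply: h2; exists r => // k _ i ik; split => // ri.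
  by rewrite leNgt; apply/negP => Hi; apply: h; exists i.
have mono k j : (k <= j)%N -> \sum_(i < k) H i w <= \sum_(i < j) H i w.
  move=> kj; rewrite -!(big_mkord xpredT (fun i => H i w)).
  rewrite (@big_cat_nat _ _ _ k 0 j) //= lerDl sumr_ge0 // => i _; exact: ltW.
have sums n : exists k, n%:R <= \sum_(i < k) H i w.
  elim: n => [|n [k hk]]; first by exists 0%N; rewrite big_ord0.
  have [i ki Hi] := big k; exists i.+1.
  rewrite big_ord_recr /= -[n.+1]addn1 natrD lerD //; last exact: ltW.
  exact: le_trans hk (mono _ _ ki).
have [k hk] := sums (Num.bound `|t|); exists k; apply: lt_le_trans hk.
by rewrite (le_lt_trans (ler_norm t)) // archi_boundP.
Qed.

End HoldingTimes.

(** * Discretised walk *)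

Section Survival.
Context {R : realType} {T : countType} {disp : measure_display}
  {Omega : measurableType disp}.
Variables (P : probability Omega R) (o : T) (c : T -> T -> R) (tot : T -> R) (h : R).
Variables (Y : nat -> Omega -> T) (H : nat -> Omega -> R).
Hypothesis c_ge0 : forall x y, 0 <= c x y.
Hypothesis tot_gt0 : forall x, 0 < tot x.
Hypothesis mY : forall i x, measurable [set w | Y i w = x].
Hypothesis mH : forall i, measurable_fun setT (H i).
Hypothesis law : jump_chain_law P o c tot Y H.
Hypothesis h_ge0 : 0 <= h.
Variables (r : nat) (chk : pred nat) (J : nat).
Implicit Types (y : nat -> T) (g : nat -> nat).

Local Notation killed := (killed_op c tot h (sites T r)).

Definition guard j (u : T -> R) := if chk j then kill_density o u else u.

(** Backward recursion with [s] steps left at grid time [j]: the chance to stay among the sites and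
    to be off [o] at every checked time, the present one included. *)
Fixpoint survival_value s j : T -> R :=
  guard j (if s is s'.+1 then killed (survival_value s' j.+1)
           else on_sites R (sites T r)).

(* [g i] is the number of complete time steps of length [h] spent in the [i]th
   holding time; the jump ending it is delayed to the next multiple of [h]. *)
Definition grid_pattern k y g : set Omega :=
  pattern Y H k y (fun i => (g i)%:R * h) (fun i => (g i).+1%:R * h) (fun i => (i < k)%N).

Definition grid_weight k y g : R :=
  path_weight o c tot k y *
  \prod_(i < k) (expR (- (tot (y i) * ((g i)%:R * h))) -
                 expR (- (tot (y i) * ((g i).+1%:R * h)))) *
  expR (- (tot (y k) * ((g k)%:R * h))).

(** A holding time with [g i] complete steps occupies [(g i).+1] steps once rounded up, so the
    delayed walk is at its [k]th site at grid time [j]. *)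
Definition grid_survives (w : Omega) := forall k g j,
  (forall i, (i < k)%N -> (g i)%:R * h < H i w <= (g i).+1%:R * h) ->
  (\sum_(i < k) (g i).+1 + g k)%N = j -> (j <= J)%N -> (g k)%:R * h < H k w ->
  Y k w \in sites T r /\ (chk j -> Y k w != o).

Lemma grid_pattern_prob k y g : P (grid_pattern k y g) = (grid_weight k y g)%:E.
Proof.
rewrite /grid_pattern (pattern_prob mY mH law); last first.
  by move=> i; rewrite mulr_ge0 //= ler_wpM2r // ler_nat.
rewrite big_ord_recr /= ltnn subr0 /grid_weight mulrA; congr (_ * _ * _)%:E.
by apply: eq_bigr => i _; rewrite ltn_ord.
Qed.

Lemma guard_ge0 j u : (forall x, 0 <= u x) -> forall x, 0 <= guard j u x.
Proof. by move=> u0 x; rewrite /guard /kill_density; case: ifP => // _; case: eqP. Qed.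

Lemma survival_value_ge0 s j x : 0 <= survival_value s j x.
Proof.
elim: s j x => [|s IH] j; apply: guard_ge0 => x; first by rewrite /on_sites ler0n.
by apply: killed_op_ge0.
Qed.

(** Induction on the steps left. During one step either the current holding time goes on, with
    factor [expR (- (tot (y k) * h))] by memorylessness, or it ends and the walk moves to a new
    site; these are the two terms of [killed_op]. *)
Lemma grid_survival_le (E : set Omega) : measurable E ->
  E `<=` grid_survives -> (forall w, E w -> forall i, 0 < H i w) ->
  forall s k y g, (\sum_(i < k) (g i).+1 + g k + s)%N = J ->
  (P (E `&` grid_pattern k y g) <=
   (grid_weight k y g * survival_value s (J - s) (y k))%:E)%E.
Proof.
move=> mE Esurv Epos.
have mG k y g : measurable (grid_pattern k y g) by exact: measurable_pattern.
have mEG k y g : measurable (E `&` grid_pattern k y g) by exact: measurableI.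
have gw0 k y g : 0 <= grid_weight k y g.
  by rewrite -lee_fin -grid_pattern_prob.
have surv k y g w : (\sum_(i < k) (g i).+1 + g k <= J)%N -> E w ->
    grid_pattern k y g w -> y k \in sites T r /\
      (chk (\sum_(i < k) (g i).+1 + g k) -> y k != o).
  move=> jJ Ew pw; have [Yk Hk _] := pw k (leqnn k).
  rewrite -Yk; apply: (Esurv w Ew k g _ _ erefl) => // i ik.
  have [_ h1 h2] := pw i (ltnW ik); rewrite h1; exact: h2.
elim=> [|s IH] k y g jE; set j := (\sum_(i < k) (g i).+1 + g k)%N in jE.
  have jJ : (j <= J)%N by rewrite -jE leq_addr.
  have Jj : (J - 0)%N = j by rewrite subn0 -jE addn0.
  rewrite Jj /=; have [[yr yo]|bad] := pselect (y k \in sites T r /\ (chk j -> y k != o)).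
    have -> : guard j (on_sites R (sites T r)) (y k) = 1.
      rewrite /guard /kill_density; case: ifP => cj; last by rewrite /on_sites yr.
      by rewrite (negbTE (yo cj)) /on_sites yr.
    rewrite mulr1 -grid_pattern_prob; by apply: le_measure; rewrite ?inE.
  rewrite (_ : _ `&` _ = set0); last first.
    by apply/seteqP; split => // w [Ew pw]; apply: bad; apply: surv pw.
  rewrite measure0 lee_fin mulr_ge0 //.
  exact: (survival_value_ge0 0 j (y k)).
have jJ : (j < J)%N by rewrite -jE -addSnnS leq_addr.
have Jj : (J - s.+1)%N = j by rewrite -jE addnK.
have Jj1 : (J - s)%N = j.+1 by rewrite -jE -addSnnS addnK.
have [[yr yo]|bad] := pselect (y k \in sites T r /\ (chk j -> y k != o)); last first.
  rewrite (_ : _ `&` _ = set0); last first.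
    by apply/seteqP; split => // w [Ew pw]; apply: bad; apply: surv pw => //; exact: ltnW.
  by rewrite measure0 lee_fin mulr_ge0 // survival_value_ge0.
set V := survival_value s j.+1.
have -> : survival_value s.+1 (J - s.+1) (y k) = killed V (y k).
  rewrite Jj /= /guard /kill_density; case: ifP => // cj.
  by rewrite (negbTE (yo cj)).
pose g1 := upd g k (g k).+1.
pose F x := grid_pattern k.+1 (upd y k.+1 x) (upd g k.+1 0%N).
have cover : E `&` grid_pattern k y g `<=` (E `&` grid_pattern k y g1) `|`
     \big[setU/set0]_(x <- sites T r) (E `&` F x).
  move=> w [Ew pw]; have [Yk Hk _] := pw k (leqnn k).
  have [Hk1|Hk1] := ltP ((g k).+1%:R * h) (H k w).
    left; split => // i ik; have [h1 h2 h3] := pw i ik.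
    rewrite /g1 /upd; case: eqVneq => [E1|]; last by split.
    by rewrite E1 ltnn; split => //; rewrite Yk.
  have pF : F (Y k.+1 w) w.
    move=> i; rewrite leq_eqVlt => /orP[/eqP ->|].
      by rewrite /upd eqxx ltnn; split => //; rewrite mul0r Epos.
    rewrite ltnS => ik; have [h1 h2 h3] := pw i ik.
    rewrite /upd ltn_eqF ?ltnS //; split => // _.
    move: ik; rewrite leq_eqVlt => /orP[/eqP ->//|]; exact: h3.
  (* The new site is among the finitely many allowed ones because [w] survives at the next grid
     time. *)
  right; have := surv k.+1 _ _ w _ Ew pF.
  rewrite /upd eqxx addn0 big_ord_recr /= ltn_eqF //.
  have -> : (\sum_(i < k) (if (i : nat) == k.+1 then 0 else g i).+1 = \sum_(i < k) (g i).+1)%N.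
    by apply: eq_bigr => i _; rewrite ltn_eqF // (leq_trans (ltn_ord i)).
  rewrite addnS => /(_ jJ)[Yr _].
  rewrite -bigcup_seq; exists (Y k.+1 w) => //.
have g1E : grid_weight k y g1 = grid_weight k y g * expR (- (tot (y k) * h)).
  rewrite /grid_weight -[RHS]mulrA -expRD; congr (_ * _ * expR _).
    by apply: eq_bigr => i _; rewrite /g1 /upd ltn_eqF.
  by rewrite /g1 /upd eqxx -[(g k).+1]addn1 natrD; ring.
have FE x : grid_weight k.+1 (upd y k.+1 x) (upd g k.+1 0%N) =
    grid_weight k y g * ((1 - expR (- (tot (y k) * h))) * (c (y k) x / tot (y k))).
  have upd_lt (i : nat) (A : Type) (f : nat -> A) a : (i <= k)%N -> upd f k.+1 a i = f i.
    by move=> ik; rewrite /upd ltn_eqF.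
  have updk (A : Type) (f : nat -> A) a : upd f k.+1 a k.+1 = a by rewrite /upd eqxx.
  rewrite /grid_weight /path_weight !big_ord_recr /= !updk !upd_lt //.
  rewrite mul0r mulr0 oppr0 expR0 mulr1.
  have -> : \prod_(i < k) (c (upd y k.+1 x i) (upd y k.+1 x i.+1) / tot (upd y k.+1 x i))
     = \prod_(i < k) (c (y i) (y i.+1) / tot (y i)).
    by apply: eq_bigr => i _; rewrite !upd_lt // ltnW.
  have -> : \prod_(i < k) (expR (- (tot (upd y k.+1 x i) * ((upd g k.+1 0%N i)%:R * h))) -
      expR (- (tot (upd y k.+1 x i) * ((upd g k.+1 0%N i).+1%:R * h)))) =
     \prod_(i < k) (expR (- (tot (y i) * ((g i)%:R * h))) -
                 expR (- (tot (y i) * ((g i).+1%:R * h)))).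
    by apply: eq_bigr => i _; rewrite !upd_lt // ltnW.
  have -> : expR (- (tot (y k) * ((g k).+1%:R * h))) =
    expR (- (tot (y k) * ((g k)%:R * h))) * expR (- (tot (y k) * h)).
    by rewrite -expRD; congr expR; rewrite -[(g k).+1]addn1 natrD; ring.
  ring.
have mF x : measurable (E `&` F x) by exact: mEG.
apply: (@le_trans _ _ (P ((E `&` grid_pattern k y g1) `|`
     \big[setU/set0]_(x <- sites T r) (E `&` F x)))).
  apply: le_measure; rewrite ?inE //.
  by apply: measurableU => //; exact: bigsetU_measurable.
apply: le_trans (measureU2 _ _ _) _ => //; first exact: bigsetU_measurable.
rewrite /killed_op yr mulrDr EFinD; apply: leeD.
  have := IH k y g1; rewrite Jj1 -/V g1E mulrA; apply.
  rewrite /g1 /upd eqxx addnS addSnnS -jE; congr (_ + _ + _)%N.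
  by apply: eq_bigr => i _; rewrite ltn_eqF.
apply: le_trans (measure_bigsetU_le _ _ mF) _.
rewrite mulr_sumr -sumEFin; apply: lee_sum => x _.
have := IH k.+1 (upd y k.+1 x) (upd g k.+1 0%N).
have updk : upd y k.+1 x k.+1 = x by rewrite /upd eqxx.
rewrite Jj1 -/V FE updk -mulrA; apply.
rewrite /upd eqxx addn0 big_ord_recr /= ltn_eqF // -jE addnS addSnnS.
congr (_ + _ + _)%N; apply: eq_bigr => i _; rewrite ltn_eqF //.
by rewrite (leq_trans (ltn_ord i)).
Qed.

Lemma survival_le (E : set Omega) : measurable E ->
  E `<=` grid_survives -> (forall w, E w -> forall i, 0 < H i w) ->
  (P E <= (survival_value J 0 o)%:E)%E.
Proof.
move=> mE Esurv Epos.
have := @grid_survival_le E mE Esurv Epos J 0%N (fun=> o) (fun=> 0%N).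
rewrite big_ord0 !add0n => /(_ erefl); rewrite subnn.
have w1 : grid_weight 0 (fun=> o) (fun=> 0%N) = 1.
  by rewrite /grid_weight /path_weight !big_ord0 eqxx mul0r mulr0 oppr0 expR0 !mulr1.
rewrite w1 mul1r; set G := grid_pattern _ _ _.
have mG : measurable G by exact: measurable_pattern.
have PG : P G = 1%E by rewrite grid_pattern_prob w1.
apply: le_trans.
have PGC : P (~` G) = 0%E by rewrite probability_setC // PG subee.
apply: (@le_trans _ _ (P ((E `&` G) `|` ~` G))).
  apply: le_measure; rewrite ?inE //.
    by apply: measurableU; [exact: measurableI|exact: measurableC].
  by move=> w Ew; have [Gw|Gw] := pselect (G w); [left|right].
apply: le_trans (measureU2 _ _ _) _; [exact: measurableI|exact: measurableC|].
by rewrite [X in (_ + X <= _)%E]PGC adde0.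
Qed.

End Survival.

(** * The delayed walk against the walk in continuous time *)

Section Escape.
Context {R : realType} {T : countType} {disp : measure_display}
  {Omega : measurableType disp}.
Variables (P : probability Omega R) (o : T) (c : T -> T -> R) (tot : T -> R) (C : R).
Variables (Y : nat -> Omega -> T) (H : nat -> Omega -> R) (X : R -> Omega -> T).
Hypothesis c_ge0 : forall x y, 0 <= c x y.
Hypothesis tot_gt0 : forall x, 0 < tot x.
Hypothesis tot_le : forall x, tot x <= C.
Hypothesis c_approx : forall x e, 0 < e ->
  exists2 s, uniq s & tot x - e < \sum_(y <- s) c x y.
Hypothesis mY : forall i x, measurable [set w | Y i w = x].
Hypothesis mH : forall i, measurable_fun setT (H i).
Hypothesis law : jump_chain_law P o c tot Y H.
Hypothesis mX : forall t x, 0 <= t -> measurable [set w | X t w = x].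
Hypothesis X_jumps : {ae P, forall w, forall t k, 0 <= t ->
  \sum_(i < k) H i w <= t < \sum_(i < k.+1) H i w -> X t w = Y k w}.
Implicit Types (k m : nat).

Section Grid.
Variables (h : R) (m M : nat).
Hypothesis M_gt0 : (0 < M)%N.

(** Checks take place at [i M + m] instead of [i M], for [i >= 1]: rounding up delays the walk by at
    most one step per jump, so by at most [m] steps over [m] jumps. *)
Definition check_time j := (m < j)%N && (M %| j - m)%N.

Local Notation value := (survival_value o c tot h m check_time).
Local Notation killed := (killed_op c tot h (sites T m)).
Local Notation guarded := (guard o check_time).

Lemma survival_value_run t s j :
  (forall i, (i < t)%N -> ~~ check_time (j + i)) ->
  value (t + s) j = iter t killed (value s (j + t)%N).
Proof.
elim: t j => [|t IH] j nc; first by rewrite addn0.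
rewrite addSn /= -[in RHS]addSnnS -IH => [|i it]; last by rewrite addSnnS nc.
by rewrite /guard -[j]addn0 (negbTE (nc 0%N _)).
Qed.

Lemma survival_value_rounds k :
  value (k * M + m) 0 =
  iter m killed (iter k (killed_round c tot h o m M) (on_sites R (sites T m))).
Proof.
rewrite addnC survival_value_run => [|i im]; last first.
  by rewrite add0n /check_time ltnNge ltnW.
congr iter; rewrite add0n.
have H1 j : check_time (m + j * M) = (0 < j)%N.
  rewrite /check_time addKn dvdn_mull // andbT -[X in (X < _)%N]addn0 ltn_add2l.
  by rewrite muln_gt0 M_gt0 andbT.
suff HI i j : value (i * M) (m + j * M) =
    guarded (m + j * M)%N (iter i (killed_round c tot h o m M) (on_sites R (sites T m))).
  have := HI k 0%N; rewrite mul0n addn0 => ->.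
  by rewrite /guard /check_time ltnn.
elim: i j => [|i IH] j; first by rewrite mul0n.
have -> : (i.+1 * M = (M.-1 + i * M).+1)%N by rewrite -addSn prednK // mulSn.
rewrite /= survival_value_run => [|a aM].
  have -> : ((m + j * M).+1 + M.-1 = m + j.+1 * M)%N.
    by rewrite addSnnS prednK // mulSn [(M + _)%N]addnC addnA.
  have E u : guarded (m + j.+1 * M)%N u = kill_density o u by rewrite /guard H1.
  have R1 u : killed_round c tot h o m M u = killed (iter M.-1 killed (kill_density o u)).
    by rewrite /killed_round -{1}(prednK M_gt0).
  by rewrite IH E R1.
rewrite /check_time negb_and addSnnS -addnA addKn dvdn_addr ?dvdn_mull //.
apply/orP; right; apply/negP => /dvdn_leq => /(_ isT).
by rewrite -(prednK M_gt0) ltnS leqNgt aM.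
Qed.

End Grid.

Definition jump_time k w : R := \sum_(i < k) H i w.

Definition clear_path k m (K : nat) : set Omega :=
  [set w | k.+1%:R < jump_time K w] `&`
  ([set w | forall i, (i < K)%N -> Y i w \in sites T m] `&`
   [set w | forall i l, (i <= k)%N -> (l < K)%N ->
      ~ (i%:R < jump_time l.+1 w <= i%:R + m%:R^-1)]).

Lemma measurable_jump_time k : measurable_fun setT (jump_time k).
Proof. by apply: measurable_sum => i; exact: mH. Qed.

Lemma measurable_clear_path k m K : measurable (clear_path k m K).
Proof.
have mJ l (a : R) : measurable [set w | a < jump_time l w].
  have -> : [set w | a < jump_time l w] = jump_time l @^-1` `]a, +oo[.
    by apply/seteqP; split => w /=; rewrite in_itv /= andbT.
  by rewrite -[A in measurable A]setTI; apply: measurable_jump_time.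
apply: measurableI => //; apply: measurableI.
  have -> : [set w | forall i, (i < K)%N -> Y i w \in sites T m] =
      \bigcap_i [set w | (i < K)%N -> Y i w \in sites T m].
    by apply/seteqP; split => w h => [i _|i]; exact: h.
  apply: bigcapT_measurable => i; case: (i < K)%N; last first.
    by rewrite (_ : [set _ | _] = setT) //; apply/seteqP; split.
  have := @measurable_countable_fiber _ _ _ (Y i) [set x | x \in sites T m] (mY i).
  by congr measurable; apply/seteqP; split => w /=; auto.
have -> : [set w | forall i l, (i <= k)%N -> (l < K)%N ->
      ~ (i%:R < jump_time l.+1 w <= i%:R + m%:R^-1)] =
    \bigcap_i \bigcap_l [set w | (i <= k)%N -> (l < K)%N ->
      ~ (i%:R < jump_time l.+1 w <= i%:R + m%:R^-1)].
  by apply/seteqP; split => w h => [i _ l _|i l]; exact: h.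
apply: bigcapT_measurable => i; apply: bigcapT_measurable => l.
case: (i <= k)%N; last first.
  by rewrite (_ : [set _ | _] = setT) //; apply/seteqP; split.
case: (l < K)%N; last first.
  by rewrite (_ : [set _ | _] = setT) //; apply/seteqP; split.
have -> : [set w | true -> true -> ~ (i%:R < jump_time l.+1 w <= i%:R + m%:R^-1)] =
  ~` ([set w | i%:R < jump_time l.+1 w] `\` [set w | i%:R + m%:R^-1 < jump_time l.+1 w]).
  apply/seteqP; split => w /= h.
    by move=> [h1 h2]; apply: h => //; rewrite h1 leNgt; apply/negP.
  by move=> _ _ /andP[h1 h2]; apply: h; split => //; rewrite ltNge h2.
by apply: measurableC; exact: measurableD.
Qed.

Definition avoids k : set Omega :=
  [set w | forall i, (1 <= i <= k)%N -> X i%:R w != o].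

Lemma measurable_avoids k : measurable (avoids k).
Proof.
have -> : avoids k = \bigcap_i [set w | (1 <= i <= k)%N -> X i%:R w != o].
  by apply/seteqP; split => w h => [i _|i]; exact: h.
apply: bigcapT_measurable => i; case: (1 <= i <= k)%N; last first.
  by rewrite (_ : [set _ | _] = setT) //; apply/seteqP; split.
have -> : [set w | true -> X i%:R w != o] = ~` [set w | X i%:R w = o].
  by apply/seteqP; split => w /= h; [move=> E; move: (h isT); rewrite E eqxx|move=> _; exact/eqP].
by apply: measurableC; exact: mX.
Qed.

(** At the check for time [i] the delayed clock reads [i + 1/m]. If the delayed walk is then at its
    [l]th site, the true [l]th jump is over by [i + 1/m], hence by [i] as the gap contains no jump;
    and the next one is after [i], as the delay is at most [l h <= 1/m]. So the site is [X i], which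
    avoids [o]. *)
Lemma clear_path_grid_survives k m K w : (0 < m)%N -> (K <= m)%N ->
  (forall i, 0 < H i w) ->
  (forall t l, 0 <= t -> \sum_(i < l) H i w <= t < \sum_(i < l.+1) H i w -> X t w = Y l w) ->
  avoids k w -> clear_path k m K w ->
  grid_survives o ((m ^ 2)%:R^-1 : R) Y H m (check_time m (m ^ 2)) (k * m ^ 2 + m) w.
Proof.
set M := (m ^ 2)%N; set h : R := M%:R^-1.
move=> m0 Km Hpos XY av [/= JK [inB gap]] l g j gH jE jJ gl.
have M0 : (0 < M)%N by rewrite expn_gt0 m0.
have Mr : 0 < M%:R :> R by rewrite ltr0n.
have h0 : 0 < h by rewrite invr_gt0.
have Mh : M%:R * h = 1 by rewrite mulfV // gt_eqF.
have mr : 0 < m%:R :> R by rewrite ltr0n.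
have mh : m%:R * h = m%:R^-1.
  by rewrite /h /M natrX expr2; field; rewrite gt_eqF.
set G := (\sum_(i < l) (g i).+1)%N in jE.
have up : jump_time l w <= G%:R * h.
  rewrite /jump_time /G natr_sum mulr_suml; apply: ler_sum => i _.
  by have /andP[] := gH i (ltn_ord i).
(* Together with [up]: the delay after [l] jumps lies between 0 and [l h]. *)
have low : (G%:R - l%:R) * h <= jump_time l w.
  have -> : (G%:R - l%:R) * h = \sum_(i < l) (g i)%:R * h.
    rewrite -mulr_suml; congr (_ * _); rewrite /G.
    have -> : (\sum_(i < l) (g i).+1 = \sum_(i < l) g i + l)%N.
      by under eq_bigr do rewrite -addn1; rewrite big_split /= sum1_card card_ord.
    by rewrite natrD addrK natr_sum.
  apply: ler_sum => i _; have /andP[/ltW] := gH i (ltn_ord i) => //.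
have jh : j%:R * h = G%:R * h + (g l)%:R * h by rewrite -jE natrD mulrDl.
have gl0 : 0 <= (g l)%:R * h by rewrite mulr_ge0 // ltW.
have JhJ : j%:R * h <= k%:R + m%:R^-1.
  have : j%:R * h <= (k * M + m)%:R * h by rewrite ler_pM2r // ler_nat.
  by rewrite natrD natrM mulrDl -mulrA Mh mulr1 mh.
have m1 : m%:R^-1 <= 1 :> R by rewrite invf_le1 // ler1n.
have mono a b : (a <= b)%N -> jump_time a w <= jump_time b w.
  move=> ab; rewrite /jump_time -!(big_mkord xpredT (fun i => H i w)).
  rewrite (@big_cat_nat _ _ _ a 0 b) //= lerDl sumr_ge0 // => i _; exact: ltW.
have lK : (l < K)%N.
  rewrite ltnNge; apply/negP => /mono Kl; move: JK; rewrite -[k.+1]addn1 natrD; lra.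
split; first exact: inB.
move=> /andP[mj /dvdnP[i jm]]; have {}jm : j = (i * M + m)%N by rewrite -jm subnK // ltnW.
have i0 : (0 < i)%N by rewrite lt0n; apply: contraTneq mj => i0; rewrite jm i0 ltnn.
have ik : (i <= k)%N.
  by move: jJ; rewrite jm leq_add2r leq_pmul2r.
have jhi : j%:R * h = i%:R + m%:R^-1.
  by rewrite jm natrD natrM mulrDl -mulrA Mh mulr1 mh.
have lm : l%:R * h <= m%:R^-1.
  by rewrite -mh ler_pM2r // ler_nat (leq_trans (ltnW lK)).
rewrite -(XY i%:R l) //; first by apply: av; rewrite i0.
apply/andP; split; last first.
  rewrite big_ord_recr /= -/(jump_time l w); lra.
rewrite -/(jump_time l w) leNgt; apply/negP => il.
have l0 : (0 < l)%N.
  rewrite lt0n; apply: contraTneq il => ->.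
  by rewrite /jump_time big_ord0 ltNge ler0n.
apply: (gap i l.-1 ik); first by rewrite prednK // ltnW.
by rewrite prednK // il /=; lra.
Qed.

(** By non-explosion almost every avoiding path is clear for large [m]; continuity from below then
    bounds what is lost by [e]. *)
Lemma escape_le k (e : R) : 0 < e -> exists m0 : nat, forall m, (m0 <= m)%N ->
  (P (avoids k) <= (iter m (killed_op c tot ((m ^ 2)%:R^-1) (sites T m))
    (iter k (killed_round c tot ((m ^ 2)%:R^-1) o m (m ^ 2)) (on_sites R (sites T m))) o
    + e)%:E)%E.
Proof.
move=> e0.
have := ae_hold_diverge c_ge0 tot_gt0 tot_le c_approx mY mH law => -[N1 [mN1 PN1 N1s]].
have [N2 [mN2 PN2 N2s]] := X_jumps.
pose G := ~` (N1 `|` N2).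
have mN : measurable (N1 `|` N2) by exact: measurableU.
have mG : measurable G by exact: measurableC.
have Gpos w : G w -> (forall i, 0 < H i w) /\ forall t, exists k, t < jump_time k w.
  by move=> Gw; apply: contrapT => nh; apply: Gw; left; exact: N1s.
have GX w : G w -> forall t l, 0 <= t ->
    \sum_(i < l) H i w <= t < \sum_(i < l.+1) H i w -> X t w = Y l w.
  by move=> Gw; apply: contrapT => nh; apply: Gw; right; exact: N2s.
pose F m := (avoids k `&` G) `&` \bigcup_(K in [set K | (K <= m)%N]) clear_path k m K.
have mAG : measurable (avoids k `&` G) by apply: measurableI => //; exact: measurable_avoids.
have mF m : measurable (F m).
  apply: measurableI => //; apply: bigcup_measurable => K _; exact: measurable_clear_path.
have Fincr : {homo (fun m => F m.+1) : n m / (n <= m)%N >-> (n <= m)%O}.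
  move=> n m nm; apply/subsetPset => w [AGw [K /= Kn [h1 [h2 h3]]]]; split => //.
  exists K => /=; first exact: leq_trans Kn _.
  split => //; split => [i iK|i l ik lK /andP[i1 i2]].
    exact: sub_sites (h2 i iK).
  apply: (h3 i l ik lK); rewrite i1 (le_trans i2) // lerD2l.
  by rewrite lef_pV2 ?posrE ?ltr0n // ler_nat.
have Fcup : \bigcup_m F m.+1 = avoids k `&` G.
  apply/seteqP; split => [w [m _ []]//|w AGw].
  have [Aw Gw] := AGw; have [Hp /(_ k.+1%:R)[K hK]] := Gpos w Gw.
  have [m1 hm1] : exists m1, forall i, (i < K)%N -> (choice.pickle (Y i w) < m1)%N.
    exists (\max_(i < K) choice.pickle (Y i w)).+1 => i iK; rewrite ltnS.
    exact: (leq_bigmax (Ordinal iK)).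
  (* Finitely many jumps and integer times are involved, and each jump after [i] has a positive
     distance from [i]. *)
  have [m2 m20 hm2] : exists2 m2, (0 < m2)%N & forall m, (m2 <= m)%N ->
      forall i l, (i <= k)%N -> (l < K)%N ->
      ~ (i%:R < jump_time l.+1 w <= i%:R + m%:R^-1).
    pose D (i l : nat) := if i%:R < jump_time l.+1 w then
      (Num.bound (jump_time l.+1 w - i%:R)^-1) else 0%N.
    exists (\max_(i < k.+1) \max_(l < K) D i l).+1 => // m hm i l ik lK /andP[h1 h2].
    have Dm : (D i l < m)%N.
      apply: leq_trans hm; rewrite ltnS.
      apply: leq_trans (leq_bigmax (Ordinal (ik : (i < k.+1)%N))).
      exact: (leq_bigmax (Ordinal lK)).
    move: Dm; rewrite /D h1 => Dm.
    have d0 : 0 < jump_time l.+1 w - i%:R by rewrite subr_gt0.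
    have : (jump_time l.+1 w - i%:R)^-1 < m%:R.
      rewrite (lt_trans (archi_boundP _)) ?ltr_nat // invr_ge0 ltW //.
    have m0 : 0 < m%:R :> R by rewrite ltr0n (leq_ltn_trans _ Dm).
    rewrite ltNge => /negP; apply; rewrite -[leLHS]invrK lef_pV2 ?posrE ?invr_gt0 //.
    lra.
  pose m := maxn K (maxn m1 m2); exists m => //; split => //; exists K => /=.
    by rewrite /m; apply: leqW; rewrite leq_max leqnn.
  split => //; split => [i iK|].
    rewrite mem_sites; apply: leq_trans (hm1 i iK) _.
    by apply: leqW; rewrite /m !leq_max leqnn orbT.
  by apply: hm2; apply: leqW; rewrite /m !leq_max leqnn !orbT.
have PF := @nondecreasing_cvg_mu _ _ _ P (fun m => F m.+1) (fun m => mF m.+1).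
rewrite Fcup in PF.
have {}PF : P (F m.+1) @[m --> \oo] --> P (avoids k `&` G) by exact: PF mAG Fincr.
have PAG : P (avoids k `&` G) = P (avoids k).
  rewrite /G -setDE probability_setD //; last exact: measurable_avoids.
  rewrite (_ : P (_ `&` (N1 `|` N2)) = 0%E) ?sube0 //.
  apply/eqP; rewrite eq_le measure_ge0 andbT.
  apply: (@le_trans _ _ (P (N1 `|` N2))).
    by apply: le_measure; rewrite ?inE //; apply: measurableI => //; exact: measurable_avoids.
  apply: le_trans (measureU2 _ _ _) _ => //.
  by rewrite [X in (X + _)%E]PN1 [X in (_ + X)%E]PN2 adde0.
have [m0 hm0] : exists m0, forall m, (m0 <= m)%N -> (P (avoids k) <= P (F m.+1) + e%:E)%E.
  have fA : P (avoids k) \is a fin_num by apply: fin_num_measure; exact: measurable_avoids.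
  move: PF; rewrite PAG -(fineK fA) => /fine_cvgP[_ /cvgrPdist_lt /(_ e e0)] [m0 _ hm0].
  exists m0 => m mm; have := hm0 m mm => /=.
  rewrite -[in leRHS](fineK (fin_num_measure P _ (mF m.+1))) -EFinD lee_fin.
  by rewrite ltr_norml => /andP[_]; lra.
exists m0.+1 => -[//|m]; rewrite ltnS => /hm0 hm.
apply: (le_trans hm); rewrite EFinD leeD2r //.
have h0 : 0 <= (m.+1 ^ 2)%:R^-1 :> R by rewrite invr_ge0 ler0n.
have := @survival_le R T _ _ P o c tot _ Y H c_ge0 tot_gt0 mY mH law h0 m.+1
   (check_time m.+1 (m.+1 ^ 2)) (k * m.+1 ^ 2 + m.+1) (F m.+1) (mF _) _ _.
rewrite survival_value_rounds ?expn_gt0 //; apply.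
  move=> w [[Aw Gw] [K /= Km cw]].
  by apply: clear_path_grid_survives Km _ _ Aw cw => //; [case: (Gpos w Gw)|exact: GX].
by move=> w [[_ Gw] _]; case: (Gpos w Gw).
Qed.

End Escape.

(** * Discretised stirring *)

Section CellMoves.
Variable T : countType.
Implicit Types (x y z : T) (e : T * T) (l : seq (T * T)) (rung : pred (T * T)).

Definition cell_move rung l z : T :=
  foldl (fun z e => if rung e then partner z e else z) z l.

Lemma cell_move_id rung l z :
  (forall e, e \in l -> incident z e -> ~~ rung e) -> cell_move rung l z = z.
Proof.
elim: l => //= e l IH nr; rewrite /cell_move /= -/(cell_move _ _ _).
have -> : (if rung e then partner z e else z) = z.
  have [ie|ie] := boolP (incident z e); last by rewrite partner_id // if_same.
  by rewrite (negbTE (nr e _ ie)) // mem_head.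
by apply: IH => e' el; apply: nr; rewrite inE el orbT.
Qed.

(** Within a cell the pairs act in the order of the list, not of their rings. The order is
    irrelevant if no other ringing pair meets the site before or after its jump. *)
Lemma cell_move_jump rung l z e0 : uniq l -> e0 \in l -> rung e0 ->
  (forall e, e \in l -> e != e0 ->
     incident z e || incident (partner z e0) e -> ~~ rung e) ->
  cell_move rung l z = partner z e0.
Proof.
move=> ul e0l re0; case/splitPr: e0l ul => l1 l2.
rewrite cat_uniq /= negb_or => /and3P[_ /andP[e01 _] /andP[e02 _]] nr.
rewrite /cell_move foldl_cat /= -!/(cell_move _ _ _).
rewrite (@cell_move_id rung l1) => [|e el ie].
  rewrite re0 cell_move_id // => e el ie.
  apply: nr; rewrite ?ie ?orbT // ?mem_cat ?inE ?el ?orbT //.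
  by apply: contraNneq e02 => <-.
apply: nr; rewrite ?ie // ?mem_cat ?el //.
by apply: contraNneq e01 => <-.
Qed.

Lemma cell_move_inj rung l : injective (cell_move rung l).
Proof.
elim: l => //= e l IH x y; rewrite /cell_move /= -!/(cell_move _ _ _) => /IH.
by case: (rung e) => //; exact: (inv_inj (swap_siteK e.1 e.2)).
Qed.

Lemma pairs_eq m e e' : e \in pairs T m -> e' \in pairs T m ->
  forall z, incident z e -> incident z e' -> partner z e = partner z e' -> e = e'.
Proof.
move=> em em' z ie ie' pp; have zm : z \in sites T m.
  move: em; rewrite mem_pairs => /and3P[_ e1 e2].
  by move: ie => /orP[/eqP ->|/eqP ->].
have := perm_uniq (perm_partner zm).
rewrite (filter_uniq _ (uniq_sites T m)) => /(uniqP z) U.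
have mem f : f \in pairs T m -> incident z f -> f \in [seq e <- pairs T m | incident z e].
  by move=> fm If; rewrite mem_filter If.
have idx f : f \in [seq e <- pairs T m | incident z e] ->
  nth z [seq partner z e | e <- pairs T m & incident z e]
    (index f [seq e <- pairs T m | incident z e]) = partner z f.
  by move=> fm; rewrite (nth_map f) ?index_mem // nth_index.
have [m1 m2] := (mem e em ie, mem e' em' ie').
have := U (index e [seq e <- pairs T m | incident z e])
   (index e' [seq e <- pairs T m | incident z e]).
rewrite !inE !size_map !index_mem m1 m2 !idx // => /(_ isT isT pp) E.
by rewrite -(nth_index e m1) E nth_index.
Qed.

End CellMoves.

(** * Short cells follow the stirring path *)

Section Coupling.
Context {R : realType} {d : nat}.
Local Notation T := (Z^d).
Variables (N : {fset T} -> set R) (tau : R -> T -> T).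
Hypothesis path : stirring_path N tau.
Implicit Types (x y z v : T) (e : T * T) (t s a b h : R).

Definition edge e : {fset T} := [fset e.1; e.2]%fset.

Definition rings_in a b e : bool := `[< N (edge e) `&` `]a, b] !=set0 >].

Definition ring_times v : set R := [set s | exists2 y, y != v & N [fset v; y]%fset s].

Hypothesis loc_finite : forall v b, finite_set (ring_times v `&` [set s | s <= b]).

Lemma finite_separated (S : set R) t : finite_set S ->
  exists2 e : R, 0 < e & forall s, S s -> s != t -> e <= `|s - t|.
Proof.
move=> /finite_seqP[l ->]; elim: l => [|s l [e e0 IH]]; first by exists 1.
have [->|st] := eqVneq s t.
  exists e => // u /=; rewrite inE => /orP[/eqP ->|]; first by rewrite eqxx.
  exact: IH.
exists (Num.min e `|s - t|); first by rewrite lt_min e0 normr_gt0 subr_eq0.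
move=> u /=; rewrite inE => /orP[/eqP -> _|ul ut]; first by rewrite ge_min lexx orbT.
by rewrite ge_min IH.
Qed.

Lemma edge_incident z e : e.1 != e.2 -> incident z e ->
  partner z e != z /\ edge e = [fset z; partner z e]%fset.
Proof.
move=> e12 ie; rewrite /edge; have [[-> ->]|[-> ->]] := partner_cases e12 ie.
  by rewrite eq_sym.
by split => //; rewrite fsetUC.
Qed.

(** Let [a] be the position at [t] and [v] the one just before. For small [dl] the particle rests at
    [v] before [t] and at [a] from [t] on, and the only rings touching [v] or [a] near [t] occur at
    [t] itself. A short cell thus contains at most this one jump, along the pair of [v] and [a]. *)
Lemma cell_move_near x t : 0 <= t -> exists2 dl : R, 0 < dl & exists m0 : nat,
  forall m, (m0 <= m)%N -> forall t' h, 0 <= t' -> 0 < h -> t - dl < t' -> t' + h < t + dl ->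
  cell_move (rings_in t' (t' + h)) (pairs T m) (tau t' x) = tau (t' + h) x.
Proof.
move=> t0; have [tau0 tauR tauL] := path.
set a := tau t x.
have [d1 d10 H1] : exists2 dl : R, 0 < dl & forall s, t <= s < t + dl -> tau s x = a.
  have /nbhs_ballP[dl /= dl0 H] : nbhs t [set s | t < s -> tau s x = a] := tauR t t0 x.
  exists dl => // s /andP[ts sd]; have [->//|st] := eqVneq s t.
  apply: H; last by rewrite lt_neqAle eq_sym st.
  by rewrite /ball /= ler0_norm ?subr_le0 //; lra.
have [v [d2 d20 H2] Ht] : exists2 v, exists2 dl : R, 0 < dl &
    (forall s, 0 <= s -> t - dl < s < t -> tau s x = v) &
    0 < t -> [/\ forall y z, y != z -> N [fset y; z]%fset t -> a = transposition y z v &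
     (forall f, site_pairs f -> ~ N f t) -> a = v].
  (* At time 0 there is no past; [v := a] is a placeholder. *)
  have [t00|tn0] := eqVneq t 0.
    exists a; last by rewrite t00 ltxx.
    by exists 1 => // s s0 /andP[_]; rewrite t00 ltNge s0.
  have tp : 0 < t by rewrite lt_neqAle eq_sym tn0.
  have [taum [L1 L2 L3]] := tauL t tp; exists (taum x).
    have /nbhs_ballP[dl /= dl0 H] : nbhs t [set s | s < t -> tau s x = taum x] := L1 x.
    exists dl => // s _ /andP[ts sd]; apply: H => //.
    by rewrite /ball /= ger0_norm ?subr_ge0 //; lra.
  move=> _; split; first by move=> y z yz /(L2 y z yz) E; rewrite /a E.
  by move=> /L3 E; rewrite /a E.
have [d3 d30 H3] := finite_separated t (loc_finite v (t + 1)).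
have [d4 d40 H4] := finite_separated t (loc_finite a (t + 1)).
pose dl := Num.min 1 (Num.min (Num.min d1 d2) (Num.min d3 d4)).
have dl0 : 0 < dl by rewrite !lt_min ltr01 d10 d20 d30 d40.
have : dl <= Num.min 1 (Num.min (Num.min d1 d2) (Num.min d3 d4)) by [].
rewrite !le_min => /and3P[dl1 /andP[dld1 dld2] /andP[dld3 dld4]].
exists dl => //.
exists (maxn (choice.pickle v) (choice.pickle a)).+1 => m hm t' h t'0 h0 lt_t' lt_th.
have vm : v \in sites T m by rewrite mem_sites (leq_ltn_trans _ hm) // leq_maxl.
have am : a \in sites T m by rewrite mem_sites (leq_ltn_trans _ hm) // leq_maxr.
have ringP z e : e \in pairs T m -> incident z e -> rings_in t' (t' + h) e ->
    exists2 s, t' < s <= t' + h & ring_times z s /\ N (edge e) s.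
  move=> em ie /asboolP[s [Ns]] /=; rewrite in_itv /= => st; exists s => //.
  have [pz E] := edge_incident (pairs_neq em) ie.
  by split => //; exists (partner z e) => //; rewrite -E.
have only_t z s (dz : R) : dl <= dz ->
    (forall s, (ring_times z `&` [set s | s <= t + 1]) s -> s != t -> dz <= `|s - t|) ->
    t' < s <= t' + h -> ring_times z s -> s = t.
  move=> dlz Hz /andP[s1 s2] rz; apply/eqP; apply: contraT => st.
  have := Hz s; rewrite leNgt => /(_ _ st) Hs.
  suff : ~~ true by []. 
  apply: contraTN (Hs _) => //; last by split => //=; lra.
  by move=> _; rewrite negbK ltr_norml; lra.
have only_v s := @only_t v s d3 dld3 H3.
have only_a s := @only_t a s d4 dld4 H4.
have [tt'|t't] := leP t t'.
  have -> : tau t' x = a by apply: H1; rewrite tt' /=; lra.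
  have -> : tau (t' + h) x = a by apply: H1; lra.
  apply: cell_move_id => e em ie; apply/negP => /(ringP _ _ em ie)[s st [rs _]].
  by have := only_a s st rs; move: st => /andP[]; lra.
have tp : 0 < t by lra.
have [Hring Hno] := Ht tp.
have -> : tau t' x = v by apply: H2 => //; lra.
have [tth|tth] := ltP (t' + h) t.
  have -> : tau (t' + h) x = v by apply: H2; lra.
  apply: cell_move_id => e em ie; apply/negP => /(ringP _ _ em ie)[s st [rs _]].
  by have := only_v s st rs; move: st => /andP[]; lra.
have -> : tau (t' + h) x = a by apply: H1; lra.
have at_t z e : e \in pairs T m -> incident z e -> (z = v \/ z = a) ->
    rings_in t' (t' + h) e -> N [fset z; partner z e]%fset t.
  move=> em ie zva /(ringP _ _ em ie)[s st [rs Ne]].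
  have E : s = t by case: zva => Ez; rewrite Ez in rs; [exact: only_v|exact: only_a].
  by have [_ <-] := edge_incident (pairs_neq em) ie; rewrite -E.
have ring_v e : e \in pairs T m -> incident v e -> rings_in t' (t' + h) e -> a = partner v e.
  move=> em ie re; have [pv _] := edge_incident (pairs_neq em) ie.
  have := at_t v e em ie (or_introl erefl) re.
  by move=> /(Hring v (partner v e)); rewrite eq_sym pv => /(_ isT) ->; rewrite /transposition eqxx.
have [va|va] := eqVneq v a.
  rewrite -va; apply: cell_move_id => e em ie; apply/negP => re.
  have [pv _] := edge_incident (pairs_neq em) ie.
  by move: pv; rewrite -(ring_v e em ie re) -va eqxx.
(* A particle that moves at [t] is moved by some ringing pair, whose transposition sends [v] to
   [a]. *)
have Nva : N [fset v; a]%fset t.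
  have [f [[y [z [yz fE]]] Nf]] : exists f, site_pairs f /\ N f t.
    apply: contrapT => nf; move/eqP: va; apply; apply/esym; apply: Hno => f pf Nf.
    by apply: nf; exists f.
  move: Nf; rewrite fE => Nf; have := Hring y z yz Nf; rewrite /transposition.
  have [vy|vy] := eqVneq v y; first by move=> az; rewrite vy az.
  have [vz|vz] := eqVneq v z; first by move=> ay; rewrite vz ay fsetUC.
  by move=> av; move: va; rewrite av eqxx.
have [e0 e0m [ie0 pe0]] := pairs_incident vm am va.
have re0 : rings_in t' (t' + h) e0.
  apply/asboolP; exists t; split; last by rewrite /= in_itv /= t't.
  by have [_ ->] := edge_incident (pairs_neq e0m) ie0; rewrite pe0.
rewrite -[RHS]pe0; apply: cell_move_jump => //; first exact: uniq_pairs.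
rewrite pe0 => e em ee0 inc; apply/negP => re; move/negP: ee0; apply; apply/eqP.
have [ie|nie] := boolP (incident v e).
  by apply: (pairs_eq em e0m ie ie0); rewrite pe0 -(ring_v e em ie re).
(* A pair at [a] ringing at [t] must contain [v]: otherwise its transposition would fix [v], forcing
   [a = v]. *)
have ia : incident a e by move: inc; rewrite (negbTE nie).
have [pa Ea] := edge_incident (pairs_neq em) ia.
have := at_t a e em ia (or_intror erefl) re.
move=> /(Hring a (partner a e)); rewrite eq_sym pa => /(_ isT); rewrite /transposition.
rewrite (negbTE va); have [vp|vp] := eqVneq v (partner a e); last first.
  by move=> av; move: va; rewrite -av eqxx.
move=> _; case/negP: nie; rewrite /incident vp.
by have [[_ ->]|[_ ->]] := partner_cases (pairs_neq em) ia; rewrite eqxx ?orbT.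
Qed.

(** Compactness of [[0, b]] makes the local threshold of [cell_move_near] uniform in [t]. *)
Lemma cell_move_eventually x (b : R) : exists m0 : nat, forall m, (m0 <= m)%N ->
  forall t, 0 <= t <= b ->
  cell_move (rings_in t (t + (m ^ 2)%:R^-1)) (pairs T m) (tau t x) = tau (t + (m ^ 2)%:R^-1) x.
Proof.
pose Q (m : nat) t := 0 <= t ->
  cell_move (rings_in t (t + (m ^ 2)%:R^-1)) (pairs T m) (tau t x) = tau (t + (m ^ 2)%:R^-1) x.
have /compact_near_coveringP cov := @segment_compact R 0 b.
have : \forall m \near \oo, `[0, b]%classic `<=` Q m.
  apply: cov => t /=; rewrite in_itv /= => /andP[t0 tb].
  have [dl dl0 [m0 Hm]] := cell_move_near x t0.
  have dl2 : 0 < dl / 2 by rewrite divr_gt0.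
  exists (ball t (dl / 2), [set m | (maxn m0 (Num.bound (dl / 2)^-1).+1 <= m)%N]).
    split; first exact: nbhsx_ballx.
    by exists (maxn m0 (Num.bound (dl / 2)^-1).+1).
  move=> [t' m] [/= bt mm] t'0.
  have bm : (Num.bound (dl / 2)^-1 < m)%N by apply: leq_trans mm; rewrite leq_max leqnn orbT.
  have m1 : (0 < m)%N by apply: leq_ltn_trans bm.
  have h0 : 0 < (m ^ 2)%:R^-1 :> R by rewrite invr_gt0 ltr0n expn_gt0 m1.
  have hd : (m ^ 2)%:R^-1 < dl / 2.
    rewrite -[ltRHS]invrK ltf_pV2 ?posrE ?invr_gt0 ?ltr0n ?expn_gt0 ?m1 //.
    apply: lt_trans (archi_boundP _) _; first by rewrite invr_ge0 ltW.
    rewrite ltr_nat (leq_trans bm) // -mulnn leq_pmulr //.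
  move: bt; rewrite /ball /= ltr_norml => /andP[b1 b2].
  apply: Hm => //; first by rewrite (leq_trans _ mm) // leq_maxl.
    by move: b1 b2; lra.
  by move: b1 b2 hd; lra.
move=> [m0 _ Hm]; exists m0 => m mm t /andP[t0 tb].
by apply: (Hm m mm t) => //=; rewrite in_itv /= t0.
Qed.

End Coupling.

(** * Trajectories and visits on the grid *)

Section Trajectories.
Variables (T : countType) (o : T) (m M : nat) (rung : nat -> pred (T * T)).
Local Notation I := (nat * (T * T))%type.
Implicit Types (x z : T) (i : I) (j k n a b : nat).

Fixpoint grid_path x j : T :=
  if j is j'.+1 then cell_move (rung j') (pairs T m) (grid_path x j') else x.

Lemma grid_path_inj j : injective (grid_path^~ j).
Proof.
elim: j => [|j IH] x y //= /cell_move_inj; exact: IH.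
Qed.

Local Notation bits_of prog := [seq rung i.1 i.2 | i <- pmap id prog].
Local Notation visits := (visits o (@snd nat (T * T))).

Lemma visits_swaps (l : seq I) p z :
  visits (map Some l ++ p) (bits_of (map Some l ++ p)) z =
  visits p (bits_of p)
    (foldl (fun z i => if rung i.1 i.2 then swap_of (@snd nat (T * T)) i z else z) z l).
Proof. by elim: l z => //= i l IH z; rewrite IH. Qed.

Lemma grid_path_cells a b x :
  foldl (fun z i => if rung i.1 i.2 then swap_of (@snd nat (T * T)) i z else z)
    (grid_path x a) [seq (j, e) | j <- iota a b, e <- pairs T m] = grid_path x (a + b).
Proof.
elim: b a => [|b IH] a; first by rewrite addn0.
rewrite /= foldl_cat.
have -> : foldl (fun z (i : I) => if rung i.1 i.2 then swap_of (@snd nat (T * T)) i z else z)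
   (grid_path x a) [seq (a, e) | e <- pairs T m] = grid_path x a.+1.
  rewrite /= /cell_move; by elim: (pairs T m) (grid_path x a) => [|e l IHl] z //=; rewrite IHl.
by rewrite IH addSnnS.
Qed.

Lemma mem_inspect_swaps k n i : i \in pmap id (inspect_prog T m M k n) ->
  i.2 \in pairs T m /\ (k * M <= i.1)%N.
Proof.
elim: n k => [|n IH] k //=; rewrite pmap_cat mem_cat => /orP[|/IH[-> h]]; last first.
  by split => //; apply: leq_trans h; rewrite leq_mul2r leqnSn orbT.
rewrite mem_pmap map_id => /allpairsP[[j e] [/= + em [->]]].
by rewrite mem_iota => /andP[].
Qed.

Lemma uniq_inspect_swaps k n : uniq (pmap id (inspect_prog T m M k n)).
Proof.
elim: n k => [|n IH] k //=; rewrite pmap_cat cat_uniq IH andbT.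
have -> : pmap id (cell_prog T m M k) = [seq (j, e) | j <- iota (k * M) M, e <- pairs T m].
  rewrite (_ : cell_prog T m M k =
   map Some [seq (j, e) | j <- iota (k * M) M, e <- pairs T m]).
    by elim: [seq _ | _ <- _, _ <- _] => //= a l ->.
  by rewrite /cell_prog map_allpairs.
apply/andP; split.
  apply: allpairs_uniq; [exact: iota_uniq|exact: uniq_pairs|].
  by move=> [? ?] [? ?].
apply/hasPn => i /mem_inspect_swaps[_ h]; apply/negP => /allpairsP[[j e] [/= + _ E]].
by rewrite mem_iota => /andP[_]; move: h; rewrite E /= mulSn addnC leqNgt => /negbTE ->.
Qed.

Lemma visits_inspect k n x :
  (0 < visits (inspect_prog T m M k n) (bits_of (inspect_prog T m M k n))
     (grid_path x (k * M)))%N ->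
  exists2 i, (i <= n)%N & grid_path x ((k + i) * M) = o.
Proof.
elim: n k => [|n IH] k.
  rewrite /= addn0; case: eqP => // xo _; exists 0%N => //; by rewrite addn0.
rewrite [inspect_prog _ _ _ _ _]/= [visits _ _ _]/=.
case: eqP => [xo _|_]; first by exists 0%N; rewrite ?addn0.
rewrite add0n.
have -> : cell_prog T m M k =
   map Some [seq (j, e) | j <- iota (k * M) M, e <- pairs T m].
  by rewrite /cell_prog map_allpairs.
rewrite visits_swaps grid_path_cells addnC -mulSn => /IH[i i_n E].
by exists i.+1; rewrite // addnS -addSn.
Qed.

End Trajectories.

(** * Independent bits from a product formula *)

Section BitsLaw.
Context {R : realType} {I : choiceType} {disp : measure_display}
  {Omega : measurableType disp}.
Variables (P : probability Omega R) (A : I -> set Omega) (th : I -> R).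
Hypothesis mA : forall i, measurable (A i).
Implicit Types (l J : seq I) (D : set Omega).

Definition bits l w : seq bool := [seq ~~ `[< A i w >] | i <- l].

Lemma measurable_bits l (b : seq bool) : measurable [set w | bits l w = b].
Proof.
elim: l b => [|i l IH] [|x b] /=.
- by rewrite (_ : [set _ | _] = setT) //; apply/seteqP; split.
- by rewrite (_ : [set _ | _] = set0) //; apply/seteqP; split.
- by rewrite (_ : [set _ | _] = set0) //; apply/seteqP; split.
have -> : [set w | ~~ `[< A i w >] :: bits l w = x :: b] =
   (if x then ~` A i else A i) `&` [set w | bits l w = b].
  apply/seteqP; split => w.
    move=> [] <- <-; split => //.
    by case: (asboolP (A i w)).
  by case: x => -[/= h ->]; rewrite ?(asboolT h) ?(asboolF h).
apply: measurableI => //; case: x => //; exact: measurableC.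
Qed.

Lemma measurable_fun_bits l (G : seq bool -> R) :
  measurable_fun setT (fun w => G (bits l w)).
Proof.
move=> _ B mB; rewrite setTI.
exact: (measurable_countable_fiber [set b | B (G b)] (measurable_bits l)).
Qed.

(** Independence is given only for intersections of the silent events [A i]. Splitting [D] along the
    first [A i] and generalising over [D] lets the product formula pass to both pieces, by
    difference for the second. *)
Lemma integral_bits l (G : seq bool -> R) D : (forall b, 0 <= G b) ->
  uniq l -> measurable D ->
  (forall J, subseq J l -> P (D `&` \bigcap_(i in [set` J]) A i) =
     (P D * (\prod_(i <- J) (1 - th i))%:E)%E) ->
  (\int[P]_(w in D) (G (bits l w))%:E =
   P D * (bits_expectation [seq th i | i <- l] G)%:E)%E.
Proof.
move=> + + ; elim: l G D => [|i l IH] G D G0 ul mD HD.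
  transitivity (\int[P]_(w in D) cst (G [::])%:E w)%E; first by [].
  by rewrite integral_cst // muleC.
have [/= il ul'] := andP ul.
have cap (J : seq I) : \bigcap_(j in [set` i :: J]) A j = A i `&` \bigcap_(j in [set` J]) A j.
  apply/seteqP; split => [w h|w [h1 h2] j /=].
    by split => [|j jJ]; apply: h; rewrite /= inE ?eqxx // jJ orbT.
  by rewrite inE => /orP[/eqP -> //|]; exact: h2.
have PDA J : subseq J l -> P (D `&` A i `&` \bigcap_(j in [set` J]) A j) =
    (P D * (1 - th i)%:E * (\prod_(j <- J) (1 - th j))%:E)%E.
  move=> Jl; rewrite -setIA -cap HD; last by rewrite /= eqxx.
  by rewrite big_cons EFinM muleA.
have cap0 : \bigcap_(j in [set` [::]]) A j = setT.
  by apply/seteqP; split => // w _ j.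
have PDi : P (D `&` A i) = (P D * (1 - th i)%:E)%E.
  by have := PDA [::] (sub0seq l); rewrite cap0 setIT big_nil mule1.
have PDn : P (D `\` A i) = (P D * (th i)%:E)%E.
  rewrite probability_setD // PDi.
  have fD : P D \is a fin_num by exact: fin_num_measure.
  by rewrite -(fineK fD) -!EFinM -EFinB; congr _%:E; ring.
have mcap J : measurable (\bigcap_(j in [set` J]) A j).
  by apply: fin_bigcap_measurable => //; exact: finite_seq.
have H1 : (\int[P]_(w in D `&` A i) (G (bits (i :: l) w))%:E =
   P D * (1 - th i)%:E * (bits_expectation [seq th i | i <- l] (fun b => G (false :: b)))%:E)%E.
  rewrite -PDi -IH //; first last.
  - by move=> J Jl; rewrite PDA // PDi.
  - exact: measurableI.
  apply: eq_integral => w; rewrite inE => -[_ Aw] /=.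
  by rewrite (asboolT Aw).
have H2 : (\int[P]_(w in D `\` A i) (G (bits (i :: l) w))%:E =
   P D * (th i)%:E * (bits_expectation [seq th i | i <- l] (fun b => G (true :: b)))%:E)%E.
  rewrite -PDn -IH //; first last.
  - move=> J Jl; rewrite (_ : (D `\` A i) `&` \bigcap_(j in [set` J]) A j =
      (D `&` \bigcap_(j in [set` J]) A j) `\` A i); last first.
      by apply/seteqP; split => w; [move=> [[? ?] ?]|move=> [[? ?] ?]].
    rewrite probability_setD //; last exact: measurableI.
    rewrite setIAC PDA // HD; last by rewrite (subseq_trans Jl) // subseq_cons.
    rewrite PDn; have fD : P D \is a fin_num by exact: fin_num_measure.
    by rewrite -(fineK fD) -!EFinM -EFinB; congr _%:E; ring.
  - exact: measurableD.
  apply: eq_integral => w; rewrite inE => -[_ Aw] /=.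
  by rewrite (asboolF Aw).
have -> : (\int[P]_(w in D) (G (bits (i :: l) w))%:E =
    \int[P]_(w in (D `&` A i) `|` (D `\` A i)) (G (bits (i :: l) w))%:E)%E.
  by rewrite setUIDK.
rewrite ge0_integral_setU //=; first last.
- by rewrite disj_set2E; apply/eqP/seteqP; split => // w [[_ ?] [_ ?]].
- by move=> w _; rewrite lee_fin.
- by apply/measurable_EFinP/measurable_funTS; exact: (measurable_fun_bits (i :: l)).
- exact: measurableD.
- exact: measurableI.
rewrite H1 H2 /=.
have fD : P D \is a fin_num by exact: fin_num_measure.
by rewrite -(fineK fD) -!EFinM -EFinD; congr _%:E; ring.
Qed.

End BitsLaw.

(** * Silent cells of the Poisson clocks *)

Section SilentCells.
Context {R : realType} {d : nat} {disp : measure_display} {Omega : measurableType disp}.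
Local Notation T := (Z^d).
Local Notation Ix := (nat * (T * T))%type.
Variables (P : probability Omega R) (c : T -> T -> R) (N : {fset T} -> Omega -> set R).
Hypothesis poisson : forall x y, x != y ->
  poisson_point_process P (c x y) (N [fset x; y]%fset).
Hypothesis indep : mutually_independent P site_pairs (fun f => point_sigma_algebra (N f)).
Variables (h : R).
Hypothesis h_ge0 : 0 <= h.
Implicit Types (e : T * T) (i : Ix) (J : seq Ix) (m : nat).

Definition cell (j : nat) : set R := `]j%:R * h, j%:R * h + h].

Definition silent i : set Omega := count_event (N (edge i.2)) (cell i.1) 0.

Lemma silentE i w : silent i w <-> N (edge i.2) w `&` cell i.1 = set0.
Proof. by rewrite /silent /count_event /= II0 card_eq0; split => /eqP. Qed.

Lemma rings_in_silent i w :
  rings_in (fun f => N f w) (i.1%:R * h) (i.1%:R * h + h) i.2 = ~~ `[< silent i w >].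
Proof.
rewrite /rings_in; apply/asboolP/asboolPn => [ne /silentE E|nE].
  by move: ne; rewrite -/(cell i.1) E => -[].
by apply/set0P/eqP => E; apply: nE; apply/silentE.
Qed.

Lemma measurable_cell j : measurable (cell j).
Proof. exact: measurable_itv. Qed.

Lemma measurable_silent i : i.2.1 != i.2.2 -> measurable (silent i).
Proof.
by move=> e12; have [_ mN _] := poisson e12; apply: mN; exact: measurable_cell.
Qed.

Lemma lebesgue_cell j : lebesgue_measure (cell j) = h%:E.
Proof.
rewrite /cell lebesgue_measure_itv /= lte_fin ltrDl.
have [h0|] := ltP 0 h; first by rewrite -EFinB addrAC subrr add0r.
by move=> h0; congr _%:E; apply/eqP; rewrite eq_le h0 h_ge0.
Qed.

Lemma cell_disjoint j k t : cell j t -> cell k t -> j = k.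
Proof.
rewrite /cell /= !in_itv /=.
wlog jk : j k / (j <= k)%N => [H|].
  by case: (leqP j k) => [/H//|/ltnW/H Hk a b]; apply/esym/Hk.
move=> /andP[a1 a2] /andP[b1 b2]; apply/eqP; rewrite eqn_leq jk leqNgt.
apply/negP => lt; have : j.+1%:R * h <= k%:R * h by rewrite ler_wpM2r // ler_nat.
rewrite -[j.+1]addn1 natrD; lra.
Qed.

Lemma silent_edge_prob e (js : seq nat) : e.1 != e.2 -> uniq js ->
  P (\bigcap_(j in [set` js]) silent (j, e)) =
  (\prod_(j <- js) expR (- (c e.1 e.2 * h)))%:E.
Proof.
move=> e12 ujs; have [_ _ law] := poisson e12.
have -> : \bigcap_(j in [set` js]) silent (j, e) =
   \bigcap_(i in [set: 'I_(size js)]) count_event (N (edge e)) (cell (nth 0%N js i)) 0.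
  apply/seteqP; split => w hw.
    by move=> i _; apply: (hw (nth 0%N js i)); rewrite /= mem_nth.
  move=> j /= jj; have jl : (index j js < size js)%N by rewrite index_mem.
  by have := hw (Ordinal jl) I; rewrite /= nth_index.
rewrite (law _ (fun i : 'I_(size js) => cell (nth 0%N js i)) (fun=> 0%N)).
- rewrite (big_nth 0%N) big_mkord; congr _%:E; apply: eq_bigr => i _.
  by rewrite lebesgue_cell /= /poisson_weight expr0 fact0 divr1 mul1r.
- move=> i; split; first exact: measurable_cell.
    move=> t; rewrite /cell /= in_itv /= => /andP[/ltW + _].
    by apply: le_trans; rewrite mulr_ge0.
  by rewrite lebesgue_cell ltry.
move=> i j _ _ [t [ti tj]]; apply/val_inj/eqP.
rewrite -(nth_uniq 0%N (ltn_ord i) (ltn_ord j) ujs); apply/eqP.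
exact: cell_disjoint ti tj.
Qed.

Lemma edge_inj m : {in pairs T m &, injective edge}.
Proof.
move=> e e' em em' E; have e12 := pairs_neq em; have e12' := pairs_neq em'.
have ie : incident e.1 e by rewrite /incident eqxx.
have ie' : incident e.1 e'.
  have : e.1 \in edge e by rewrite !inE eqxx.
  by rewrite E !inE.
apply: (pairs_eq em em' ie ie'); apply/eqP.
have [p1 E1] := edge_incident e12 ie; have [p2 E2] := edge_incident e12' ie'.
have : partner e.1 e \in edge e by rewrite E1 !inE eqxx orbT.
by rewrite E E2 !inE (negbTE p1).
Qed.

(** Instructions are grouped by edge: distinct edges are independent, and on one edge the cells are
    disjoint, so the Poisson law gives a product. *)
Lemma silent_prob m J : uniq J -> (forall i, i \in J -> i.2 \in pairs T m) ->
  P (\bigcap_(i in [set` J]) silent i) =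
  (\prod_(i <- J) expR (- (c i.2.1 i.2.2 * h)))%:E.
Proof.
move=> uJ Jm.
pose B (f : {fset T}) := \bigcap_(i in [set i | i \in J /\ edge i.2 = f]) silent i.
pose K : {fset {fset T}} := [fset edge e | e in pairs T m]%fset.
have -> : \bigcap_(i in [set` J]) silent i = \bigcap_(f in [set` K]) B f.
  apply/seteqP; split => w hw; first by move=> f _ i [iJ _]; exact: hw.
  move=> i /= iJ; apply: (hw (edge i.2)) => //=.
  by apply/imfsetP; exists i.2 => //; exact: Jm.
have BJ e : e \in pairs T m -> B (edge e) =
    \bigcap_(j in [set` [seq i.1 | i <- J & i.2 == e]]) silent (j, e).
  move=> em; apply/seteqP; split => w hw.
    move=> j /= /mapP[i0]; rewrite mem_filter => /andP[/eqP ie iJ] ->.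
    by rewrite -ie -surjective_pairing; apply: hw; rewrite /= ie.
  move=> i [iJ ie]; have E : i.2 = e by apply: (edge_inj _ em ie); exact: Jm.
  rewrite (surjective_pairing i) E; apply: hw => /=.
  by apply/mapP; exists i; rewrite ?mem_filter ?E ?eqxx.
have uj e : uniq [seq i.1 | i <- J & i.2 == e].
  rewrite map_inj_in_uniq ?filter_uniq // => i i'.
  rewrite !mem_filter => /andP[/eqP E _] /andP[/eqP E' _] E1.
  by rewrite (surjective_pairing i) (surjective_pairing i') E E' E1.
rewrite (indep (J := K) (A := B)).
- rewrite (perm_big [seq edge e | e <- pairs T m]) /=; last first.
    apply: uniq_perm; first exact: fset_uniq.
      by rewrite map_inj_in_uniq ?uniq_pairs //; exact: edge_inj.
    move=> f; apply/imfsetP/mapP => [[e /= em ->]|[e em ->]]; by exists e.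
  rewrite big_map big_seq.
  rewrite (eq_bigr (fun e => (\prod_(i <- J | i.2 == e) expR (- (c i.2.1 i.2.2 * h)))%:E)).
    rewrite -big_seq -(big_morph EFin EFinM erefl); congr _%:E.
    under eq_bigr do rewrite big_mkcond.
    rewrite exchange_big /= big_seq [RHS]big_seq; apply: eq_bigr => i iJ.
    rewrite (bigD1_seq i.2) ?uniq_pairs ?Jm //= eqxx big1 ?mulr1 // => e.
    by rewrite eq_sym => /negbTE ->.
  move=> e em; rewrite BJ // silent_edge_prob ?(pairs_neq em) ?uj //.
  rewrite big_map big_filter; congr _%:E; apply: eq_bigr => i /eqP ->.
  by [].
- move=> f /imfsetP[e /= em ->]; exists e.1, e.2; split => //.
  exact: pairs_neq em.
move=> f /imfsetP[e /= em ->]; rewrite BJ //.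
pose G := [set A | exists B k, measurable B /\ A = count_event (N (edge e)) B k].
rewrite /point_sigma_algebra -/G.
change (@measurable _ (g_sigma_algebraType G)
  (\bigcap_(j in [set` [seq i.1 | i <- J & i.2 == e]]) silent (j, e))).
apply: fin_bigcap_measurable; first exact: finite_seq.
move=> j _; apply: sub_sigma_algebra; exists (cell j), 0%N; split => //.
exact: measurable_cell.
Qed.

End SilentCells.

(** * Poisson clocks *)

Section PoissonFinite.
Context {R : realType} {disp : measure_display} {Omega : measurableType disp}.
Variables (P : probability Omega R) (r : R) (N : Omega -> set R).
Hypothesis poisson : poisson_point_process P r N.
Variable b : R.
Hypothesis b_ge0 : 0 <= b.

Let B : set R := `[0, b].

Lemma measurable_count k : measurable (count_event N B k).
Proof. by have [_ mN _] := poisson; apply: mN; exact: measurable_itv. Qed.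

Lemma count_prob k : P (count_event N B k) = (poisson_weight (r * b) k)%:E.
Proof.
have [_ _ law] := poisson.
have lB : lebesgue_measure B = b%:E.
  rewrite /B lebesgue_measure_itv /= lte_fin; case: ltP => [_|b0]; first by rewrite sube0.
  by congr _%:E; apply/eqP; rewrite eq_le b_ge0.
have := law 1%N (fun=> B) (fun=> k).
rewrite big_ord_recl big_ord0 mulr1 lB /= => <-.
- by congr (P _); apply/seteqP; split => [w h i _ //|w h]; exact: (h ord0 I).
- move=> _; split; [exact: measurable_itv| |by rewrite ltry].
  by move=> t; rewrite /B /= in_itv /= => /andP[].
- by move=> i j _ _ _; rewrite !ord1.
Qed.

(** The Poisson weights sum to 1, so some finite count is attained almost surely. *)
Lemma ae_finite_points : {ae P, forall w, finite_set (N w `&` B)}.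
Proof.
pose F := \bigcup_k count_event N B k.
have mF : measurable F by apply: bigcupT_measurable; exact: measurable_count.
have PF : P F = 1%E.
  rewrite measure_bigcup //; last 2 first.
  - by move=> k _; exact: measurable_count.
  - move=> i j _ _ [w [/= wi wj]]; apply/card_eq_II.
    by rewrite (card_eq_trans _ wj) // card_eq_sym.
  apply/cvg_lim => //.
  have -> : (fun n => \sum_(0 <= k < n | k \in [set: nat]) P (count_event N B k))%E =
      EFin \o (fun n => series (exp_coeff (r * b)) n * expR (- (r * b))).
    apply/funext => n /=; rewrite /series /= mulr_suml -sumEFin.
    apply: eq_big => [k|k _]; first by rewrite in_setT.
    by rewrite count_prob /poisson_weight /exp_coeff.
  apply: cvg_EFin; first exact: nearW.
  have -> : 1 = expR (r * b) * expR (- (r * b)) by rewrite -expRD subrr expR0.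
  by apply: cvgMl; exact: is_cvg_series_exp_coeff.
exists (~` F); split; first exact: measurableC.
  by rewrite probability_setC // PF subee.
by move=> w /= nf; apply: contra_not nf => -[k _ ck]; exists k.
Qed.

End PoissonFinite.

(** * Finitely many rings at a site *)

Section LocalFiniteness.
Context {R : realType} {d : nat} {disp : measure_display} {Omega : measurableType disp}.
Local Notation T := (Z^d).
Variables (P : probability Omega R) (c : T -> T -> R) (tot : T -> R).
Variable N : {fset T} -> Omega -> set R.
Hypothesis poisson : forall x y, x != y ->
  poisson_point_process P (c x y) (N [fset x; y]%fset).
Hypothesis c_ge0 : forall x y, 0 <= c x y.
Hypothesis c_sum : forall x s, uniq s -> \sum_(y <- s) c x y <= tot x.

Lemma big_sites (f : T -> R) K : \sum_(k < K) oapp f 0 (pickle_inv k) = \sum_(y <- sites T K) f y.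
Proof.
elim: K => [|K IH]; first by rewrite big_ord0 /sites big_nil.
rewrite big_ord_recr IH /sites -[in RHS](addn1 K) iotaD pmap_cat big_cat /= add0n; congr (_ + _).
by case: (pickle_inv K) => [y|] /=; rewrite ?big_nil ?big_cons ?big_nil ?addr0.
Qed.

(** Borel-Cantelli: the edge to [y] rings before [n] with probability at most [n * c v y], which is
    summable. So finitely many edges at [v] ring, each finitely often. *)
Lemma ae_finite_rings_upto v (n : nat) :
  {ae P, forall w, finite_set (ring_times (fun f => N f w) v `&` [set s | s <= n%:R])}.
Proof.
pose B : set R := `[0, n%:R]%classic.
have n0 : 0 <= n%:R :> R by [].
pose E k := if @pickle_inv T k is Some y then
   if y != v then ~` count_event (N [fset v; y]%fset) B 0 else set0 else set0.
have mE k : measurable (E k).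
  rewrite /E; case: pickle_inv => [y|] //; case: ifP => // yv.
  by apply: measurableC; apply: measurable_count; apply: poisson; rewrite eq_sym.
have PE k : (P (E k) <= (n%:R * oapp (c v) 0 (pickle_inv k))%:E)%E.
  rewrite /E; case: pickle_inv => [y|] /=; last by rewrite measure0 lee_fin mulr0.
  case: ifP => yv; last by rewrite measure0 lee_fin mulr_ge0.
  have vy : v != y by rewrite eq_sym.
  rewrite probability_setC; last exact: measurable_count (poisson vy) _ _.
  rewrite (count_prob (poisson vy) n0) /poisson_weight expr0 fact0 divr1 mul1r.
  by rewrite -EFinB lee_fin lerBlDr addrC -lerBlDr mulrC; exact: expR_ge1Dx.
have sumE : (\sum_(0 <= k <oo) P (E k) < +oo)%E.
  apply: (@le_lt_trans _ _ (n%:R * tot v)%:E); last by rewrite ltry.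
  apply: lime_le; first exact: is_cvg_nneseries.
  apply: nearW => K.
  apply: (@le_trans _ _ (\sum_(0 <= k < K) (n%:R * oapp (c v) 0 (pickle_inv k))%:E)%E).
    by apply: lee_sum => k _; exact: PE.
  by rewrite sumEFin lee_fin -mulr_sumr big_mkord big_sites ler_wpM2l // c_sum // uniq_sites.
have PL := lim_sup_set_cvg0 mE sumE.
have nL : P.-negligible (lim_sup_set E).
  exists (lim_sup_set E); split => //.
  by apply: bigcapT_measurable => i; apply: bigcup_measurable.
have fin : {ae P, forall w, forall k, if @pickle_inv T k is Some y then
    y != v -> finite_set (N [fset v; y]%fset w `&` B) else True}.
  apply: ae_foralln => k; case: pickle_inv => [y|]; last exact: aeW.
  have [yv|yv] := boolP (y != v); last exact: aeW.
  have vy : v != y by rewrite eq_sym.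
  by have := ae_finite_points (poisson vy) n0; apply: filterS => w + _.
have nLc : {ae P, forall w, ~ lim_sup_set E w}.
  by apply: negligibleS nL => w /= /contrapT.
apply: filterS2 fin nLc => w finw nlw.
have [K hK] : exists K, forall k, (K <= k)%N -> ~ E k w.
  apply: contrapT => h; apply: nlw => K _; apply: contrapT => h'; apply: h.
  by exists K => k Kk Ek; apply: h'; exists k.
have fU : finite_set (\bigcup_(k in `I_K) (if @pickle_inv T k is Some y then
   if y != v then N [fset v; y]%fset w `&` B else set0 else set0)).
  apply: bigcup_finite; first exact: finite_II.
  move=> k _; have := finw k; case: pickle_inv => // y.
  by case: ifP => // _; apply.
apply: sub_finite_set fU => s [[y yv Ns] sn].
have Bs : B s.
  rewrite /B /= in_itv /= sn andbT.
  have vy : v != y by rewrite eq_sym.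
  by have [N0 _ _] := poisson vy; exact: N0 Ns.
exists (choice.pickle y); last by rewrite choice.pickleK_inv yv.
rewrite /= ltnNge; apply/negP => /hK; rewrite /E choice.pickleK_inv yv; apply.
rewrite /count_event /= II0 card_eq0 => /eqP E0.
by have : (N [fset v; y]%fset w `&` B) s by []; rewrite E0.
Qed.

Lemma ae_finite_rings : {ae P, forall w, forall v b,
  finite_set (ring_times (fun f => N f w) v `&` [set s | s <= b])}.
Proof.
have : {ae P, forall w, forall k n, if @pickle_inv T k is Some v then
   finite_set (ring_times (fun f => N f w) v `&` [set s | s <= n%:R]) else True}.
  apply: ae_foralln => k; apply: ae_foralln => n.
  case: pickle_inv => [v|]; [exact: ae_finite_rings_upto|exact: aeW].
apply: filterS => w H v b.
have := H (choice.pickle v) (Num.bound `|b|); rewrite choice.pickleK_inv.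
apply: sub_finite_set => s [h sb]; split => //=.
rewrite (le_trans sb) // (le_trans (ler_norm b)) // ltW //.
exact: archi_boundP.
Qed.

End LocalFiniteness.

(** * Conductances *)

Section LimInf.
Context {R : realType}.
Implicit Types (u : (\bar R)^nat) (a b : \bar R).

Lemma limn_einf_le u b : (forall n, (u n <= b)%E) -> (limn_einf u <= b)%E.
Proof.
move=> ub; rewrite limn_einf_lim; apply: lime_le; first exact: is_cvg_einfs.
apply: nearW => n; apply: le_trans (ub n).
by apply: ereal_inf_lbound; exists n => //=.
Qed.

Lemma limn_einf_ge u a m : (forall n, (m <= n)%N -> (a <= u n)%E) -> (a <= limn_einf u)%E.
Proof.
move=> ua; rewrite limn_einf_lim; apply: lime_ge; first exact: is_cvg_einfs.
exists m => // n /= mn; apply: le_ereal_inf_tmp => _ [k /= nk <-].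
exact/ua/(leq_trans mn).
Qed.

End LimInf.

Section Conductances.
Context {R : realType} {d : nat}.
Local Notation T := (Z^d).
Variable c : T -> T -> R.
Hypothesis cc : conductance_profile c.

Definition max_rate : R := fine (ereal_sup (range (total_rate_ereal c))).

Lemma rate_ge0 x y : 0 <= c x y. Proof. by have [] := cc. Qed.

Lemma rate_sym x y : c x y = c y x. Proof. by have [] := cc. Qed.

Lemma total_rateE x : (total_rate c x)%:E = total_rate_ereal c x.
Proof.
have [_ _ /(_ x)/andP[c0 coo] _] := cc.
by rewrite /total_rate fineK // ge0_fin_numE // ltW.
Qed.

Lemma total_rate_gt0 x : 0 < total_rate c x.
Proof. by rewrite -lte_fin total_rateE; have [_ _ /(_ x)/andP[]] := cc. Qed.

Lemma total_rate_le x : total_rate c x <= max_rate.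
Proof.
have [_ _ _ supoo] := cc; rewrite -lee_fin total_rateE /max_rate fineK.
  by apply: ereal_sup_ubound; exists x.
rewrite ge0_fin_numE //; apply: (@le_trans _ _ (total_rate_ereal c x)).
  by rewrite -total_rateE lee_fin ltW // total_rate_gt0.
by apply: ereal_sup_ubound; exists x.
Qed.

Lemma rate_sum x (s : seq T) : uniq s -> \sum_(y <- s) c x y <= total_rate c x.
Proof.
move=> us; rewrite -lee_fin total_rateE; apply: esum_ge; exists [set` s].
  by split => //; exact: finite_seq.
by rewrite -fsbig_seq // sumEFin.
Qed.

Lemma rate_approx x (e : R) : 0 < e ->
  exists2 s : seq T, uniq s & total_rate c x - e < \sum_(y <- s) c x y.
Proof.
move=> e0; have fin : total_rate_ereal c x \is a fin_num by rewrite -total_rateE.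
have [_ [A [fA _] <-]] := ub_ereal_sup_adherent e0 fin.
move=> H; have {}H : (total_rate_ereal c x - e%:E < \sum_(y \in A) (c x y)%:E)%E := H.
exists (fset_set A); first exact: fset_uniq.
move: H; rewrite -total_rateE fsbig_finite //= sumEFin -EFinB lte_fin; exact.
Qed.

End Conductances.

(** * Lower bound for the density at the origin *)

Section Escape.
Context {R : realType} {d : nat} {disp : measure_display} {Omega : measurableType disp}.
Local Notation T := (Z^d).
Variables (P : probability Omega R) (c : T -> T -> R) (X : R -> Omega -> T).
Hypothesis cc : conductance_profile c.
Hypothesis walk : random_walk P c X.

Lemma return_time_infty :
  [set w | return_time X w = +oo%E] = \bigcap_k avoids (0%R : T) X k.
Proof.
apply/seteqP; split => w.
  move=> /= Tw k _ i /andP[i1 _]; apply/eqP => Xi.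
  have : (return_time X w <= i%:R%:E)%E.
    by apply: ereal_inf_lbound; exists i.
  by rewrite Tw leye_eq.
move=> av; apply/eqP; rewrite /= -leye_eq; apply: le_ereal_inf_tmp => _ [i [i1 Xi] <-].
by have := av i Logic.I i; rewrite i1 leqnn Xi eqxx => /(_ isT).
Qed.

Lemma escape_probability_le k : ((escape_probability P X)%:E <= P (avoids (0%R : T) X k))%E.
Proof.
have mA j : measurable (avoids (0%R : T) X j).
  by apply: measurable_avoids => t x; have [mX _] := walk; exact: mX.
have mE : measurable [set w | return_time X w = +oo%E].
  by rewrite return_time_infty; exact: bigcapT_measurable.
rewrite /escape_probability fineK ?fin_num_measure //.
by apply: le_measure; rewrite ?inE // return_time_infty => w; apply.
Qed.

Lemma escape_probability_ge0 : 0 <= escape_probability P X.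
Proof. by rewrite /escape_probability fine_ge0. Qed.

Let chain_lower_bound (p a b x k1 k2 k3 e : R) : 0 < e -> p - e / 3 <= a ->
  a <= b + k1 -> b <= x + k2 -> k2 <= k3 -> k1 + k3 <= e / 3 -> p - e <= x.
Proof. by move=> *; lra. Qed.

(** Chains the comparisons: escape with avoidance up to time [k], the latter with [k] killed rounds
    plus [m] free steps (error [e / 3]), removal of the free steps ([C / m]), and killed rounds with
    stirring rounds (at most [4 n C^2 / m]). *)
Lemma round_density_ge n (e : R) : 0 < e -> exists m0 : nat, forall m, (m0 <= m)%N ->
  forall k, (k <= n)%N -> escape_probability P X - e <=
    iter k (round_density c (m ^ 2)%:R^-1 (0%R : T) m (m ^ 2)) (on_sites R (sites T m)) 0.
Proof.
move=> e0; have [mX [Y [H [mY mH law XY]]]] := walk.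
pose C := max_rate c; pose p := escape_probability P X.
have c0 := rate_ge0 cc; have cs := rate_sym cc; have t0 := total_rate_gt0 cc.
have tC := total_rate_le cc; have cT := rate_sum cc; have cA := rate_approx cc.
have C0 : 0 <= C by rewrite (le_trans (ltW (t0 0)) (tC 0)).
have e3 : 0 < e / 3 by rewrite divr_gt0.
have esc k : exists m0 : nat, forall m, (m0 <= m)%N ->
    p - e / 3 <= iter m (killed_op c (total_rate c) ((m ^ 2)%:R^-1) (sites T m))
    (iter k (killed_round c (total_rate c) ((m ^ 2)%:R^-1) 0 m (m ^ 2))
       (on_sites R (sites T m))) 0.
  have [m0 Hm] := escape_le c0 t0 tC cA mY mH law mX XY k e3.
  exists m0 => m /Hm; move/(le_trans (escape_probability_le k)).
  by rewrite lee_fin -/p; lra.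
have [m1 Hm1] : exists m1 : nat, forall m, (m1 <= m)%N -> forall k, (k <= n)%N ->
    p - e / 3 <= iter m (killed_op c (total_rate c) ((m ^ 2)%:R^-1) (sites T m))
    (iter k (killed_round c (total_rate c) ((m ^ 2)%:R^-1) 0 m (m ^ 2))
       (on_sites R (sites T m))) 0.
  elim: n => [|n [m1 IH]].
    by have [m0 Hm] := esc 0%N; exists m0 => m /Hm h k; rewrite leqn0 => /eqP ->.
  have [m0 Hm] := esc n.+1; exists (maxn m0 m1) => m; rewrite geq_max => /andP[/Hm h1 /IH h2] k.
  by rewrite leq_eqVlt => /orP[/eqP ->|]; [|rewrite ltnS; exact: h2].
(* The last two errors together are at most [K / m]. *)
pose K := C + n%:R * (4 * C ^+ 2).
have K0 : 0 <= K by rewrite addr_ge0 // !mulr_ge0 // sqr_ge0.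
exists (maxn m1 (Num.bound (K / (e / 3))).+1) => m; rewrite geq_max => /andP[m1m bm] k kn.
have m0 : (0 < m)%N by apply: leq_ltn_trans bm.
have mr : 0 < m%:R :> R by rewrite ltr0n.
set h : R := (m ^ 2)%:R^-1.
have hE : h = m%:R^-1 * m%:R^-1 by rewrite /h natrX expr2 invfM.
have h0 : 0 <= h by rewrite invr_ge0.
have Km : K * m%:R^-1 <= e / 3.
  rewrite ler_pdivrMr // mulrC -ler_pdivrMr // ltW //.
  apply: lt_trans (archi_boundP _) _; first by rewrite divr_ge0 // ltW.
  by rewrite ltr_nat.
have m1' : m%:R^-1 <= 1 :> R by rewrite invf_le1 // ler1n.
have r0 : 0 <= m%:R^-1 :> R by rewrite invr_ge0.
have mh : m%:R * (C * h) = C * m%:R^-1 by rewrite hE; field; rewrite gt_eqF.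
have Mh : (m ^ 2)%:R * (4 * C ^+ 2 * h ^+ 2) = 4 * C ^+ 2 * (m%:R^-1 * m%:R^-1).
  by rewrite natrX hE; field; rewrite gt_eqF.
have H1 := Hm1 m m1m k kn; rewrite -/h in H1.
have on01 := @on_sites01 R T (sites T m).
have kr01 : forall x, 0 <= iter k (killed_round c (total_rate c) h 0 m (m ^ 2))
   (on_sites R (sites T m)) x <= 1.
  elim: {H1 kn} k => [|k IH] x; first exact: on01.
  rewrite iterS /killed_round; apply: iter_killed01 => //.
  exact: kill_density01.
have H2 := iter_killed_le_id c0 t0 tC cT h0 m m 0 kr01.
have H3 := killed_round_le 0 c0 cs t0 tC cT h0 (m ^ 2) k (leqnn m) 0.
rewrite mh in H2; rewrite Mh in H3.
have H4 : k%:R * (4 * C ^+ 2 * (m%:R^-1 * m%:R^-1)) <= n%:R * (4 * C ^+ 2) * m%:R^-1.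
  rewrite -[leRHS]mulrA ler_pM //; [by rewrite !mulr_ge0 // sqr_ge0|by rewrite ler_nat|].
  rewrite ler_wpM2l ?mulr_ge0 ?sqr_ge0 // ler_piMl //.
exact: (chain_lower_bound e0 H1 H2 H3 H4 (eq_ind _ (fun z => z <= e / 3) Km _ (mulrDl _ _ _))).
Qed.

End Escape.

(** * From the grid to the inverted orbit *)

Section InvertedOrbit.
Context {R : realType} {d : nat} {disp : measure_display} {Omega : measurableType disp}.
Local Notation T := (Z^d).
Variables (P : probability Omega R) (c : T -> T -> R) (tau : R -> Omega -> T -> T).
Hypothesis cc : conductance_profile c.
Hypothesis tau_bij : forall t w, 0 <= t -> bijective (tau t w).
Hypothesis mtau : forall t x y, 0 <= t -> measurable [set w | tau t w x = y].
Variables (q : R) (n : nat).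
Hypothesis q01 : 0 <= q <= 1.
Implicit Types (k m : nat) (w : Omega) (x y : T).

Definition occupant k w : T := xget 0 [set x | tau k%:R w x = 0].

Lemma occupantP k w x : (tau k%:R w x = 0) <-> occupant k w = x.
Proof.
have [f fK Kf] := tau_bij w (ler0n R k).
have ux : tau k%:R w (f 0) = 0 by rewrite Kf.
have E : occupant k w = f 0.
  by apply: xget_unique ux _ => y /= <-; rewrite fK.
rewrite E; split => [<-|<- //]; by rewrite fK.
Qed.

(** A sequence rather than a set: its values form a countable type, which gives measurability. *)
Definition occupants w : seq T := [seq occupant k w | k <- iota 0 n.+1].

Lemma inverted_orbitE w : inverted_orbit tau n w = [set` occupants w].
Proof.
apply/seteqP; split => x.
  move=> [k /= kn /occupantP <-]; apply/mapP; exists k => //.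
  by rewrite mem_iota.
move=> /mapP[k]; rewrite mem_iota add0n => /andP[_ kn] E; exists k => //=.
exact/occupantP.
Qed.

Lemma measurable_occupants (s : seq T) : measurable [set w | occupants w = s].
Proof.
rewrite /occupants; elim: (iota 0 n.+1) s => [|k l IH] [|x s] /=.
- by rewrite (_ : [set _ | _] = setT) //; apply/seteqP; split.
- by rewrite (_ : [set _ | _] = set0) //; apply/seteqP; split.
- by rewrite (_ : [set _ | _] = set0) //; apply/seteqP; split.
rewrite (_ : [set _ | _] = [set w | tau k%:R w x = 0] `&`
   [set w | [seq occupant k w | k <- l] = s]); last first.
  apply/seteqP; split => w; first by move=> [/occupantP].
  by move=> [/= /occupantP -> ->].
by apply: measurableI => //; exact: mtau.
Qed.

Lemma measurable_orbit_weight :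
  measurable_fun setT (fun w => (1 - q) ^+ #|` fset_set (inverted_orbit tau n w)|).
Proof.
move=> _ B mB; rewrite setTI.
pose G (s : seq T) : R := (1 - q) ^+ #|` fset_set [set` s]|.
have := measurable_countable_fiber [set s | B (G s)] measurable_occupants.
by congr measurable; apply/seteqP; split => w /=; rewrite inverted_orbitE.
Qed.

Variable N : {fset T} -> Omega -> set R.
Hypothesis poisson : forall x y, x != y ->
  poisson_point_process P (c x y) (N [fset x; y]%fset).
Hypothesis indep : mutually_independent P site_pairs (fun f => point_sigma_algebra (N f)).
Hypothesis path : {ae P, forall w, stirring_path (fun f => N f w) (fun t => tau t w)}.

Local Notation step m := ((m ^ 2)%:R^-1 : R).
Local Notation prog m := (inspect_prog T m (m ^ 2) 0 n).
Local Notation swaps m := (pmap id (prog m)).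

Definition avoid_weight (eps : R) m w : R :=
  \prod_(x <- sites T m) (1 - q + q * eps ^+
    visits (0 : T) (@snd nat (T * T)) (prog m) (bits (silent N (step m)) (swaps m) w) x).

Lemma mem_swaps m (i : nat * (T * T)) : i \in swaps m -> i.2 \in pairs T m.
Proof. by case/mem_inspect_swaps. Qed.

Lemma step_ge0 m : 0 <= step m. Proof. by rewrite invr_ge0. Qed.

Lemma silent_swap m i : i \in swaps m -> measurable (silent N (step m) i).
Proof. by move=> /mem_swaps/pairs_neq; exact: measurable_silent poisson _ _. Qed.

(* Outside the pairs of distinct sites [silent] is not an event. *)
Definition silent' m (i : nat * (T * T)) : set Omega :=
  if i \in swaps m then silent N (step m) i else set0.

Lemma bits_silent' m w : bits (silent N (step m)) (swaps m) w = bits (silent' m) (swaps m) w.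
Proof. by apply/eq_in_map => i im; rewrite /silent' im. Qed.

Lemma measurable_silent' m i : measurable (silent' m i).
Proof. by rewrite /silent'; case: ifP => // /silent_swap. Qed.

Lemma avoid_weight_ge0 eps m w : 0 < eps <= 1 -> 0 <= avoid_weight eps m w.
Proof.
move=> /andP[e0 _]; have /andP[q0 q1] := q01; apply: prodr_ge0 => x _.
by rewrite addr_ge0 ?subr_ge0 // mulr_ge0 // exprn_ge0 // ltW.
Qed.

Lemma measurable_avoid_weight eps m : measurable_fun setT (avoid_weight eps m).
Proof.
rewrite /avoid_weight; under eq_fun do rewrite bits_silent'.
exact: (measurable_fun_bits (measurable_silent' m) (swaps m) (fun b =>
   \prod_(x <- sites T m) (1 - q + q * eps ^+
     visits (0 : T) (@snd nat (T * T)) (prog m) b x))).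
Qed.

Lemma integral_avoid_weight eps m : 0 < eps <= 1 ->
  (\int[P]_w (avoid_weight eps m w)%:E <=
   (\prod_(i < n.+1) (1 - (1 - eps) * (q * iter i (round_density c (step m) 0 m (m ^ 2))
      (on_sites R (sites T m)) 0)))%:E)%E.
Proof.
move=> eps01; have c0 := rate_ge0 cc.
pose G b : R := \prod_(x <- sites T m) (1 - q + q * eps ^+
     visits (0 : T) (@snd nat (T * T)) (prog m) b x).
have G0 b : 0 <= G b.
  have /andP[e0 _] := eps01; have /andP[q0 q1] := q01; apply: prodr_ge0 => x _.
  by rewrite addr_ge0 ?subr_ge0 // mulr_ge0 // exprn_ge0 // ltW.
have -> : (\int[P]_w (avoid_weight eps m w)%:E =
   \int[P]_w (G (bits (silent' m) (swaps m) w))%:E)%E.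
  by apply: eq_integral => w _; rewrite /avoid_weight bits_silent'.
rewrite (@integral_bits _ _ _ _ P _ (fun i => ring_prob c (step m) i.2)) //.
- rewrite [X in (X * _)%E]probability_setT mul1e lee_fin.
  apply: le_trans (@avoid_probability_le _ _ _ (0 : T) (@snd nat (T * T))
     (fun i => ring_prob c (step m) i.2) _ _ (prog m) (sites T m) q eps01 q01 (uniq_sites T m)) _.
    by move=> i; apply: ring_prob01 => //; exact: step_ge0.
  rewrite avoid_bound_inspect le_eqVlt; apply/orP; left; apply/eqP.
  apply: eq_bigr => i _; congr (1 - _ * _).
  rewrite (_ : (fun x => if x \in sites T m then q else 0) =
    (fun x => q * on_sites R (sites T m) x)); last first.
    by apply/funext => x; rewrite /on_sites; case: ifP; rewrite ?mulr1 ?mulr0.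
  move: (on_sites _ _) => u.
  have -> : iter i (round_density c (step m) 0 m (m ^ 2)) (fun x => q * u x) =
     fun x => q * iter i (round_density c (step m) 0 m (m ^ 2)) u x.
    elim: (nat_of_ord i) => //= j ->; exact: round_density_scale.
  by [].
- exact: measurable_silent'.
- exact: uniq_inspect_swaps.
move=> J Jl; rewrite setTI [X in (X * _)%E]probability_setT mul1e.
have Jm i : i \in J -> i \in swaps m by move=> iJ; exact: mem_subseq Jl _ iJ.
have -> : \bigcap_(i in [set` J]) silent' m i = \bigcap_(i in [set` J]) silent N (step m) i.
  by apply/seteqP; split => w h i iJ; have := h i iJ; rewrite /silent' Jm.
rewrite (silent_prob poisson indep (step_ge0 m) (m := m)).
- by congr _%:E; apply: eq_bigr => i _; rewrite /ring_prob opprB addrCA subrr addr0.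
- exact: subseq_uniq Jl (uniq_inspect_swaps _ _ _ _ _).
by move=> i /Jm/mem_swaps.
Qed.

(** For large [m] the grid follows the finitely many particles that are ever at the origin at times
    [0, ..., n]. As grid trajectories are injective, no other particle is seen there, so sites off
    the orbit contribute 1 and each listed site of the orbit at least [1 - q]. *)
Lemma ae_orbit_weight_le eps : 0 < eps <= 1 -> {ae P, forall w, exists m0 : nat,
  forall m, (m0 <= m)%N ->
  (1 - q) ^+ #|` fset_set (inverted_orbit tau n w)| <= avoid_weight eps m w}.
Proof.
move=> /andP[e0 e1]; have /andP[q0 q1] := q01.
have LF := ae_finite_rings poisson (rate_ge0 cc) (rate_sum cc).
apply: filterS2 path LF => w pw lf.
have [m0 Hm] : exists m0 : nat, forall m, (m0 <= m)%N -> forall k, (k <= n)%N ->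
    forall t, 0 <= t <= n%:R ->
    cell_move (rings_in (fun f => N f w) t (t + step m)) (pairs T m)
      (tau t w (occupant k w)) = tau (t + step m) w (occupant k w).
  elim: {1}n => [|n' [m1 IH]].
    have [m1 Hm] := cell_move_eventually pw lf (occupant 0 w) n%:R.
    by exists m1 => m mm k; rewrite leqn0 => /eqP -> t tn; exact: Hm.
  have [m2 Hm] := cell_move_eventually pw lf (occupant n'.+1 w) n%:R.
  exists (maxn m1 m2) => m; rewrite geq_max => /andP[mm1 mm2] k.
  rewrite leq_eqVlt => /orP[/eqP -> t tn|]; first exact: Hm.
  by rewrite ltnS => kn; exact: IH.
exists m0.+1 => m mm.
have m_gt0 : (0 < m)%N by apply: leq_ltn_trans mm.
pose rung j e := rings_in (fun f => N f w) (j%:R * step m) (j%:R * step m + step m) e.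
have Mr : (m ^ 2)%:R != 0 :> R by rewrite pnatr_eq0 -lt0n expn_gt0 m_gt0.
have gp k j : (k <= n)%N -> (j <= n * m ^ 2)%N ->
    grid_path m rung (occupant k w) j = tau (j%:R * step m) w (occupant k w).
  move=> kn; elim: j => [|j IH] jn.
    by rewrite mul0r; have [-> _ _] := pw.
  rewrite /= IH; last exact: ltnW.
  rewrite (Hm m (ltnW mm) k kn); last first.
    apply/andP; split; first by rewrite mulr_ge0.
    by rewrite ler_pdivrMr ?lt0r ?Mr ?ler0n // -natrM ler_nat ltnW.
  by rewrite -[j.+1]addn1 natrD mulrDl mul1r.
have vis0 x : ~ inverted_orbit tau n w x ->
   visits (0 : T) (@snd nat (T * T)) (prog m) (bits (silent N (step m)) (swaps m) w) x = 0%N.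
  move=> xO; apply/eqP; rewrite -leqn0 leqNgt; apply/negP => vx; apply: xO.
  have bE : bits (silent N (step m)) (swaps m) w = [seq rung i.1 i.2 | i <- swaps m].
    by apply/eq_map => i; rewrite /rung rings_in_silent.
  have := @visits_inspect _ (0 : T) m (m ^ 2) rung 0 n x.
  rewrite mul0n -bE => /(_ vx)[i i_n]; rewrite add0n => gx.
  have gi : grid_path m rung (occupant i w) (i * m ^ 2) = 0.
    rewrite gp // ?leq_mul2r ?i_n ?orbT //.
    by rewrite natrM mulfK //; exact/occupantP.
  (* Both [x] and the true occupant at time [i] reach the origin on the grid, so they coincide. *)
  exists i => //=; apply/occupantP; apply: (@grid_path_inj _ m rung (i * m ^ 2)).
  by rewrite gi gx.
rewrite inverted_orbitE in vis0 *; rewrite /avoid_weight.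
have fO : finite_set [set` occupants w] by exact: finite_seq.
set O := fset_set _.
have OE x : (x \in O) = (x \in occupants w).
  by rewrite in_fset_set //; apply/idP/idP; rewrite inE.
have q1' : 0 <= 1 - q <= 1 by rewrite subr_ge0 q1 gerBl.
have [a0 a1] := andP q1'.
apply: (@le_trans _ _ (\prod_(x <- sites T m) (if x \in O then 1 - q else 1))).
  rewrite -big_mkcond /= -big_filter prodr_const_seq || rewrite -big_mkcond /= -big_filter.
  rewrite big_const_seq count_predT iter_mulr_1.
  apply: ler_wiXn2l => //; apply: uniq_leq_size; first exact/filter_uniq/uniq_sites.
  by move=> x; rewrite mem_filter => /andP[].
apply: ler_prod => x _; case: ifP => xO; last first.
  rewrite ler01 vis0 ?expr0 ?mulr1 ?subrK ?lexx //.
  by move=> /= xO'; rewrite OE xO' in xO.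
by rewrite a0 lerDl mulr_ge0 // exprn_ge0 // ltW.
Qed.

(** The pathwise inequality holds only from a random [m] on, hence Fatou's lemma. *)
Lemma orbit_weight_le eps (B : R) m0 : 0 < eps <= 1 ->
  (forall m, (m0 <= m)%N -> (\int[P]_w (avoid_weight eps m w)%:E <= B%:E)%E) ->
  ('E_P[fun w => ((1 - q) ^+ #|` fset_set (inverted_orbit tau n w)|)%R] <= B%:E)%E.
Proof.
move=> eps01 HB; rewrite unlock.
pose f m w := (avoid_weight eps (m0 + m) w)%:E.
have mf m : measurable_fun setT (f m).
  by apply/measurable_EFinP; exact: measurable_avoid_weight.
have f0 m w : setT w -> (0 <= f m w)%E by move=> _; rewrite lee_fin avoid_weight_ge0.
apply: (@le_trans _ _ (\int[P]_w limn_einf (f^~ w))%E); last first.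
  apply: le_trans (fatou P measurableT mf f0) _; apply: limn_einf_le => m.
  by apply: HB; exact: leq_addr.
have /andP[q0 q1] := q01.
apply: ae_ge0_le_integral => //.
- by move=> w _; rewrite lee_fin exprn_ge0 // subr_ge0.
- by apply/measurable_EFinP; exact: measurable_orbit_weight.
- by move=> w _; apply: (@limn_einf_ge _ _ _ 0%N) => m _; exact: f0.
- have mNf m : measurable_fun setT (fun w => - f m w)%E.
    by apply: measurableT_comp (mf m); exact: oppe_measurable.
  have mL := measurable_fun_limn_esup mNf.
  by apply: measurableT_comp mL; exact: oppe_measurable.
have := ae_orbit_weight_le eps01; apply: filterS => w [m1 Hm] _.
by apply: (@limn_einf_ge _ _ _ m1) => m mm; rewrite lee_fin Hm // (leq_trans mm) // leq_addl.
Qed.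

End InvertedOrbit.

(** * Removing the errors *)

Lemma le_expR_approx (R : realType) (E : \bar R) (a : R) :
  (0 <= E)%E -> (forall e, 0 < e -> (E <= (expR (a + e))%:E)%E) -> (E <= (expR a)%:E)%E.
Proof.
move=> E0 H; have := H 1 ltr01; case: E E0 H => [r| |] //; rewrite lee_fin => r0 H _.
rewrite lee_fin leNgt; apply/negP => ar.
have rp : 0 < r by apply: lt_trans ar; exact: expR_gt0.
have al : a < ln r by rewrite -ltr_expR lnK.
have e0 : 0 < (ln r - a) / 2 by rewrite divr_gt0 // subr_gt0.
have := H _ e0; rewrite lee_fin -{1}(@lnK _ r) // ler_expR; lra.
Qed.

Lemma esum_scale_le (R : realType) (I : choiceType) (l : R) (a : I -> R) : 0 <= l ->
  (\esum_(i in [set: I]) (l * a i)%:E <= l%:E * \esum_(i in [set: I]) (a i)%:E)%E.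
Proof.
move=> l0; apply: ge_ereal_sup => _ [A [fA _] <-].
rewrite (_ : \sum_(i \in A) (l * a i)%:E = l%:E * \sum_(i \in A) (a i)%:E)%E.
  rewrite lee_wpmul2l ?lee_fin //.
  by apply: ereal_sup_ubound; exists A.
by rewrite !fsbig_finite //= !sumEFin -EFinM mulr_sumr.
Qed.

(** The inequality [esum_scale_le] is used twice, for [l] and for its inverse. *)
Lemma esum_scale (R : realType) (I : choiceType) (l : R) (a : I -> R) : 0 < l ->
  (\esum_(i in [set: I]) (l * a i)%:E = l%:E * \esum_(i in [set: I]) (a i)%:E)%E.
Proof.
move=> l0; apply/eqP; rewrite eq_le esum_scale_le ?(ltW l0) //=.
have := @esum_scale_le R I l^-1 (fun i => l * a i).
rewrite invr_ge0 => /(_ (ltW l0)) h.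
rewrite -lee_pdivlMl //; apply: le_trans h.
by apply: le_esum => // i _; rewrite mulrA mulVf ?mul1r // gt_eqF.
Qed.

Section StirringBound.
Context {R : realType} {d : nat} {disp disp' : measure_display}
  {Omega : measurableType disp} {Omega' : measurableType disp'}.
Variables (P : probability Omega R) (P' : probability Omega' R).

Lemma prod_one_sub_le (n : nat) (b : R) (f : nat -> R) :
  (forall i, (i <= n)%N -> b <= f i <= 1) ->
  \prod_(i < n.+1) (1 - f i) <= expR (- (n.+1%:R * b)).
Proof.
move=> H; have -> : expR (- (n.+1%:R * b)) = \prod_(i < n.+1) expR (- b).
  by rewrite prodr_const card_ord -expRM_natl mulrN.
apply: ler_prod => i _; have /andP[h1 h2] := H i (ltn_ord i).
rewrite subr_ge0 h2 /=; apply: le_trans (expR_ge1Dx _).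
by rewrite lerD2l lerN2.
Qed.

Let final_arith (ap da eps e : R) : (1 - eps) * da <= da -> eps * ap <= e / 2 ->
  da <= e / 2 -> - ((1 - eps) * ap - (1 - eps) * da) <= - ap + e.
Proof. by move=> h1 h2 h3; nra. Qed.

Lemma scaled_kernel_profile (l : R) (p : Z^d -> Z^d -> R) : 0 < l ->
  symmetric_kernel p -> conductance_profile (fun x y => l * p x y).
Proof.
move=> l0 [p0 ps p1].
have E x : total_rate_ereal (fun x y => l * p x y) x = l%:E.
  by rewrite /total_rate_ereal esum_scale // p1 mule1.
split.
- by move=> x y; rewrite mulr_ge0 // ltW.
- by move=> x y; rewrite ps.
- by move=> x; rewrite E lte_fin l0 ltry.
have -> : range (total_rate_ereal (fun x y => l * p x y)) = [set l%:E].
  apply/seteqP; split => [_ [x _ <-]|_ ->]; first by rewrite E.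
  by exists 0; rewrite ?E.
by rewrite ereal_sup1 ltry.
Qed.

Lemma stirring_bound (q : R) (c : Z^d -> Z^d -> R)
    (tau : R -> Omega -> Z^d -> Z^d) (X : R -> Omega' -> Z^d) (n : nat) :
  0 <= q <= 1 -> conductance_profile c ->
  stirring_process P c tau -> random_walk P' c X ->
  ('E_P[fun w => ((1 - q) ^+ #|` fset_set (inverted_orbit tau n w)|)%R]
    <= (expR (- (q * n.+1%:R * escape_probability P' X)))%R%:E)%E.
Proof.
move=> q01 cc [tb mt [N [poi ind path]]] walk.
set p := escape_probability P' X.
have p0 : 0 <= p by exact: escape_probability_ge0.
have /andP[q0 q1] := q01.
apply: le_expR_approx.
  by rewrite unlock; apply: integral_ge0 => w _; rewrite lee_fin exprn_ge0 // subr_ge0.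
move=> e e0.
pose a := q * n.+1%:R.
have a0 : 0 <= a by rewrite mulr_ge0.
(* [eps] and [dl] each cost at most [e / 2] in the exponent; the added 1 keeps the denominators
   positive. *)
pose eps := Num.min 1 (e / 2 / (a * p + 1)).
pose dl := e / 2 / (a + 1).
have ap0 : 0 <= a * p by rewrite mulr_ge0.
have eps0 : 0 < eps by rewrite lt_min ltr01 !divr_gt0 // ltr_wpDl.
have eps1 : eps <= 1 by rewrite ge_min lexx.
have dl0 : 0 < dl by rewrite !divr_gt0 // ltr_wpDl.
have epsap : eps * (a * p) <= e / 2.
  apply: (@le_trans _ _ (e / 2 / (a * p + 1) * (a * p))).
    by rewrite ler_wpM2r // ge_min lexx orbT.
  rewrite mulrAC ler_pdivrMr ?ltr_wpDl // ler_wpM2l ?divr_ge0 ?(ltW e0) //.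
  by rewrite lerDl.
have dla : dl * a <= e / 2.
  rewrite /dl mulrAC ler_pdivrMr ?ltr_wpDl // ler_wpM2l ?divr_ge0 ?(ltW e0) //.
  by rewrite lerDl.
have [m0 Hm] := round_density_ge cc walk n dl0.
have eps01 : 0 < eps <= 1 by rewrite eps0.
apply: (orbit_weight_le cc tb mt q01 poi path (m0 := m0) eps01) => m mm.
apply: le_trans (integral_avoid_weight cc n q01 poi ind m eps01) _.
pose D i := iter i (round_density c (m ^ 2)%:R^-1 0 m (m ^ 2)) (on_sites R (sites _ m)) 0.
have D01 i : 0 <= D i <= 1.
  rewrite /D; suff H x : 0 <= iter i (round_density c (m ^ 2)%:R^-1 0 m (m ^ 2))
    (on_sites R (sites _ m)) x <= 1 by exact: H.
  elim: i x => [|i IH] x; first exact: on_sites01.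
  have h0 : 0 <= (m ^ 2)%:R^-1 :> R by rewrite invr_ge0.
  exact: (@iter_cell01 R _ c _ (rate_ge0 cc) h0 m (m ^ 2) _ (kill_density01 0 IH) x).
have Dp i : (i <= n)%N -> p - dl <= D i by exact: Hm.
rewrite lee_fin; apply: le_trans (@prod_one_sub_le n ((1 - eps) * (q * (p - dl)))
  (fun i => (1 - eps) * (q * D i)) _) _.
  move=> i i_n; have /andP[d0 d1] := D01 i.
  have eps1' : 0 <= 1 - eps by rewrite subr_ge0.
  apply/andP; split; first by rewrite !ler_wpM2l // Dp.
  by rewrite !mulr_ile1 ?mulr_ge0 // gerBl ltW.
rewrite ler_expR.
have -> : n.+1%:R * ((1 - eps) * (q * (p - dl))) = (1 - eps) * (a * p) - (1 - eps) * (dl * a).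
  by rewrite /a; ring.
have h1 : (1 - eps) * (dl * a) <= dl * a.
  by rewrite ler_piMl ?gerBl ?(ltW eps0) // mulr_ge0 // ltW.
exact: final_arith h1 epsap dla.
Qed.

End StirringBound.

Theorem theorem2p5 (R : realType) (d : nat)
    (disp : measure_display) (Omega : measurableType disp)
    (P : probability Omega R)
    (disp' : measure_display) (Omega' : measurableType disp')
    (P' : probability Omega' R) :
  (forall (p : Z^d -> Z^d -> R) (lambda : R)
          (tau : R -> Omega -> Z^d -> Z^d) (X : R -> Omega' -> Z^d),
     symmetric_kernel p -> 0 < lambda ->
     stirring_process P (fun x y => lambda * p x y) tau ->
     random_walk P' (fun x y => lambda * p x y) X ->
     forall n : nat,
       ('E_P[fun w => ((1 / 2) ^+ #|` fset_set (inverted_orbit tau n w)|)%R]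
        <= (expR (- (n.+1%:R / 2 * escape_probability P' X)))%R%:E)%E)
  /\
  (forall (q : R) (c : Z^d -> Z^d -> R)
          (tau : R -> Omega -> Z^d -> Z^d) (X : R -> Omega' -> Z^d),
     0 <= q <= 1 -> conductance_profile c ->
     stirring_process P c tau ->
     random_walk P' c X ->
     forall n : nat,
       ('E_P[fun w => ((1 - q) ^+ #|` fset_set (inverted_orbit tau n w)|)%R]
        <= (expR (- (q * n.+1%:R * escape_probability P' X)))%R%:E)%E).
Proof.
split=> [p lambda tau X pk l0 st wk n|q c tau X q01 cc st wk n]; last first.
  exact: (stirring_bound n q01 cc st wk).
have half : (1 / 2 : R) = 1 - 2^-1 by lra.
have half01 : 0 <= (2^-1 : R) <= 1 by lra.
rewrite half (_ : n.+1%:R / 2 = 2^-1 * n.+1%:R); last by rewrite mulrC.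
exact: (stirring_bound n half01 (scaled_kernel_profile l0 pk) st wk).
Qed.
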